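(* Let $\xi\in\Bbbk$ be a primitive third root of unity and let $H$ be either $A_{18,\xi}$ or its dual $(A_{18,\xi})^*$. Then there is a non-zero Yetter-Drinfeld module $V\in{}^{H}_{H}\mathcal{YD}$ whose Nichols algebra $\mathfrak{B}(V)$ satisfies $\dim\mathfrak{B}(V)<\infty$, and by bosonization one obtains a Hopf algebra $\mathfrak{B}(V)\# H$ with the dual Chevalley property of dimension $216$.
   Context: The ground field $\Bbbk$ is algebraically closed of characteristic $0$. ${}^{H}_{H}\mathcal{YD}$ is the category of finite-dimensional Yetter-Drinfeld modules over $H$. A Hopf algebra has the dual Chevalley property if its coradical is a Hopf subalgebra (equivalently, the tensor product of two simple comodules is semisimple). The Hopf algebra $A_{18,\xi}$ (Masuoka), $\xi\in\Bbbk$ with $\xi^3=1$: let $L=\langle x\rangle\simeq C_2$ and $N=\langle a\rangle\times\langle b\rangle\simeq C_3\times C_3$. Then $A_{18,\xi}=\Bbbk^{N}\,{}^{\tau}\#_{\sigma}\,\Bbbk L$ is the abelian extension (bicrossed product) of $\Bbbk L$ by $\Bbbk^N$ associated to the matched pair $(L,N)$ with $\triangleright:N\times L\to L$ trivial, $\triangleleft:N\times L\to N$ given by $a^ib^j\triangleleft x=a^ib^{-j}$, and cocycles $\sigma:L\times L\to(\Bbbk^N)^\times$ trivial and $\tau:N\times N\to(\Bbbk^L)^\times$, $\tau(a^ib^j,a^rb^s)=\delta_1+\xi^{jr}\delta_x$. Explicitly, it has basis $e_g\# y$ ($g\in N$, $y\in L$), multiplication $(e_g\# y)(e_h\# z)=\delta_{g\triangleleft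 y,h}\,e_g\# yz$ and comultiplication $\Delta(e_g\# y)=\sum_{st=g}\tau(s,t)(y)\,(e_s\# y)\otimes(e_t\# y)$. *)

(* Defs.v *)
From HB Require Import structures.
From mathcomp Require Import all_boot all_order all_algebra.
Set Implicit Arguments.
Unset Strict Implicit.
Unset Printing Implicit Defensive.
Import GRing.Theory.
Local Open Scope ring_scope.

(* Finite-dimensional spaces are handled with a chosen basis, indexed by a
   finType: [vec k I] is the space with basis I, and the tensor product of
   [vec k I] and [vec k J] is [vec k (I * J)].  Linear maps and subspaces are
   the library's ['Hom(_, _)] and [{vspace _}]. *)
Notation vec k I := {ffun I -> k^o}.

Section Tensors.
Variable k : fieldType.
Implicit Types I J K : finType.

Definition bv I (i : I) : vec k I := [ffun j => (i == j)%:R].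

Definition lin I (W : vectType k) (F : I -> W) : 'Hom(vec k I, W) :=
  linfun (fun v : vec k I => \sum_i (v i : k) *: F i).

Definition reidx I J (s : I -> J) : 'Hom(vec k I, vec k J) :=
  lin (fun i => bv (s i)).

Definition tens I J (v : vec k I) (w : vec k J) : vec k (I * J) :=
  [ffun p => v p.1 * w p.2].

Definition tensl I J I' J' (f : 'Hom(vec k I, vec k I'))
    (g : 'Hom(vec k J, vec k J')) : 'Hom(vec k (I * J), vec k (I' * J')) :=
  lin (fun p : I * J => tens (f (bv p.1)) (g (bv p.2))).

Definition tensv I J (U : {vspace vec k I}) (W : {vspace vec k J}) :
    {vspace vec k (I * J)} :=
  <<[seq tens u w | u <- vbasis U, w <- vbasis W]>>%VS.

(* phi (x) id and id (x) phi, for a linear form phi. *)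
Definition forml I J (phi : 'Hom(vec k I, k^o)) :
    'Hom(vec k (I * J), vec k J) :=
  lin (fun p : I * J => (phi (bv p.1) : k) *: bv p.2).

Definition formr I J (phi : 'Hom(vec k J, k^o)) :
    'Hom(vec k (I * J), vec k I) :=
  lin (fun p : I * J => (phi (bv p.2) : k) *: bv p.1).

Definition transp I J (f : 'Hom(vec k I, vec k J)) :
    'Hom(vec k J, vec k I) :=
  lin (fun j => [ffun i => f (bv i) j] : vec k I).

Definition assoc I J K := reidx (fun p : (I * J) * K => (p.1.1, (p.1.2, p.2))).

End Tensors.

Arguments reidx k {I J} s.
Arguments assoc k I J K : clear implicits.

Notation "v ⊗ w" := (tens v w) (at level 40, left associativity) : ring_scope.
Notation "f ⊠ g" := (tensl f g) (at level 40, left associativity) : ring_scope.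

(* The structure maps, without axioms, of a Hopf algebra (in vector spaces or
   in a braided category) with underlying space [vec k I]. *)
Record hopf (k : fieldType) (I : finType) := Hopf {
  hmul : 'Hom(vec k (I * I), vec k I);
  hone : vec k I;
  hcomul : 'Hom(vec k I, vec k (I * I));
  hcounit : 'Hom(vec k I, k^o);
  hantip : 'Hom(vec k I, vec k I) }.

Arguments hopf k I%_type_scope.

Section Hopf.
Variables (k : fieldType) (I : finType).
Implicit Types H : hopf k I.

(* The product of the tensor square, relative to a braiding c:
   (a (x) b)(a' (x) b') = a c(b (x) a') b'. *)
Definition mul2 H (c : 'Hom(vec k (I * I), vec k (I * I))) :
    'Hom(vec k ((I * I) * (I * I)), vec k (I * I)) :=
  ((hmul H ⊠ hmul H)
   \o reidx k (fun p : I * ((I * I) * I) =>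
                 ((p.1, p.2.1.1), (p.2.1.2, p.2.2)))
   \o (\1 ⊠ (c ⊠ \1))
   \o reidx k (fun p : (I * I) * (I * I) =>
                 (p.1.1, ((p.1.2, p.2.1), p.2.2))))%VF.

(* Hopf algebra axioms relative to a braiding c of the underlying space. *)
Record is_hopf_for c H : Prop := IsHopfFor {
  hopf_mulA : forall x y z,
    hmul H (hmul H (x ⊗ y) ⊗ z) = hmul H (x ⊗ hmul H (y ⊗ z));
  hopf_mul1l : forall x, hmul H (hone H ⊗ x) = x;
  hopf_mul1r : forall x, hmul H (x ⊗ hone H) = x;
  hopf_comulA : (assoc k I I I \o (hcomul H ⊠ \1) \o hcomul H
                 = (\1 ⊠ hcomul H) \o hcomul H)%VF;
  hopf_counitl : forall x, forml I (hcounit H) (hcomul H x) = x;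
  hopf_counitr : forall x, formr I (hcounit H) (hcomul H x) = x;
  hopf_comulM : forall x y,
    hcomul H (hmul H (x ⊗ y)) = mul2 H c (hcomul H x ⊗ hcomul H y);
  hopf_comul1 : hcomul H (hone H) = hone H ⊗ hone H;
  hopf_counitM : forall x y,
    hcounit H (hmul H (x ⊗ y)) = (hcounit H x : k) * hcounit H y;
  hopf_counit1 : hcounit H (hone H) = 1;
  hopf_antipl : forall x,
    hmul H ((hantip H ⊠ \1)%VF (hcomul H x)) = (hcounit H x : k) *: hone H;
  hopf_antipr : forall x,
    hmul H ((\1 ⊠ hantip H)%VF (hcomul H x)) = (hcounit H x : k) *: hone H }.

Definition is_hopf H : Prop :=
  is_hopf_for (reidx k (fun p : I * I => (p.2, p.1))) H.

Definition subcoalgebra H (C : {vspace vec k I}) : Prop :=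
  (hcomul H @: C <= tensv C C)%VS.

Definition simple_subcoalgebra H (C : {vspace vec k I}) : Prop :=
  [/\ subcoalgebra H C, C <> 0%VS &
    forall D, subcoalgebra H D -> (D <= C)%VS -> D = 0%VS \/ D = C].

(* C is the sum of the simple subcoalgebras, i.e. the least subspace
   containing all of them. *)
Definition is_coradical H (C : {vspace vec k I}) : Prop :=
  (forall D, simple_subcoalgebra H D -> (D <= C)%VS) /\
  (forall W, (forall D, simple_subcoalgebra H D -> (D <= W)%VS) ->
             (C <= W)%VS).

Definition hopf_subalgebra H (C : {vspace vec k I}) : Prop :=
  [/\ hone H \in C, (hmul H @: tensv C C <= C)%VS, subcoalgebra H C &
    (hantip H @: C <= C)%VS].

Definition dual_chevalley H : Prop :=
  exists C, is_coradical H C /\ hopf_subalgebra H C.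

(* The dual Hopf algebra, on the dual basis. *)
Definition hopf_dual H : hopf k I :=
  {| hmul := transp (hcomul H);
     hone := [ffun i => hcounit H (bv k i)];
     hcomul := transp (hmul H);
     hcounit := lin (fun i => hone H i);
     hantip := transp (hantip H) |}.

End Hopf.

(* The structure maps, without axioms, of a left-left Yetter-Drinfeld module
   with underlying space [vec k J]. *)
Record yd (k : fieldType) (I J : finType) := Yd {
  act : 'Hom(vec k (I * J), vec k J);
  coact : 'Hom(vec k J, vec k (I * J)) }.

Arguments yd k (I J)%_type_scope.

Section YetterDrinfeld.
Variables (k : fieldType) (I : finType) (H : hopf k I).
Implicit Types J K : finType.

(* h (x) v |-> h_(1) v_(-1) S(h_(3)) (x) h_(2) . v_(0) *)
Definition yd_twist J (V : yd k I J) : 'Hom(vec k (I * J), vec k (I * J)) :=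
  (((hmul H \o (hmul H ⊠ hantip H)) ⊠ act V)
   \o reidx k (fun p : ((I * I) * I) * (I * J) =>
                 (((p.1.1.1, p.2.1), p.1.2), (p.1.1.2, p.2.2)))
   \o (((hcomul H ⊠ \1) \o hcomul H) ⊠ coact V))%VF.

Record is_yd J (V : yd k I J) : Prop := IsYd {
  yd_actA : forall g h v,
    act V (g ⊗ act V (h ⊗ v)) = act V (hmul H (g ⊗ h) ⊗ v);
  yd_act1 : forall v, act V (hone H ⊗ v) = v;
  yd_coactA : (assoc k I I J \o (hcomul H ⊠ \1) \o coact V
               = (\1 ⊠ coact V) \o coact V)%VF;
  yd_coact1 : forall v, forml J (hcounit H) (coact V v) = v;
  yd_compat : forall h v, coact V (act V (h ⊗ v)) = yd_twist V (h ⊗ v) }.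

Definition yd_morphism J K (V : yd k I J) (W : yd k I K)
    (f : 'Hom(vec k J, vec k K)) : Prop :=
  (forall h v, f (act V (h ⊗ v)) = act W (h ⊗ f v)) /\
  (forall v, coact W (f v) = (\1 ⊠ f)%VF (coact V v)).

(* h . (v (x) w) = h_(1) . v (x) h_(2) . w,
   v (x) w |-> v_(-1) w_(-1) (x) v_(0) (x) w_(0). *)
Definition yd_tens J K (V : yd k I J) (W : yd k I K) : yd k I (J * K) :=
  {| act := ((act V ⊠ act W)
             \o reidx k (fun p : (I * I) * (J * K) =>
                           ((p.1.1, p.2.1), (p.1.2, p.2.2)))
             \o (hcomul H ⊠ \1))%VF;
     coact := ((hmul H ⊠ \1)
               \o reidx k (fun p : (I * J) * (I * K) =>
                             ((p.1.1, p.2.1), (p.1.2, p.2.2)))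
               \o (coact V ⊠ coact W))%VF |}.

(* v (x) w |-> v_(-1) . w (x) v_(0) *)
Definition yd_braiding J K (V : yd k I J) (W : yd k I K) :
    'Hom(vec k (J * K), vec k (K * J)) :=
  ((act W ⊠ \1)
   \o reidx k (fun p : (I * J) * K => ((p.1.1, p.2), p.1.2))
   \o (coact V ⊠ \1))%VF.

(* (B, R) is a Hopf algebra in the category of Yetter-Drinfeld modules. *)
Record is_yd_hopf J (B : yd k I J) (R : hopf k J) : Prop := IsYdHopf {
  ydh_yd : is_yd B;
  ydh_mul : yd_morphism (yd_tens B B) B (hmul R);
  ydh_one_act : forall h,
    act B (h ⊗ hone R) = (hcounit H h : k) *: hone R;
  ydh_one_coact : coact B (hone R) = hone H ⊗ hone R;
  ydh_comul : yd_morphism B (yd_tens B B) (hcomul R);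
  ydh_counit_act : forall h x,
    hcounit R (act B (h ⊗ x)) = (hcounit H h : k) * hcounit R x;
  ydh_counit_coact : forall x,
    formr I (hcounit R) (coact B x) = (hcounit R x : k) *: hone H;
  ydh_antip : yd_morphism B B (hantip R);
  ydh_hopf : is_hopf_for (yd_braiding B B) R }.

(* R = R(0) + ... + R(n-1), a direct sum, with R(i) = 0 for i >= n, is a
   grading of the Hopf algebra (B, R) by Yetter-Drinfeld submodules. *)
Record is_grading J (B : yd k I J) (R : hopf k J)
    (gr : nat -> {vspace vec k J}) : Prop := IsGrading {
  gr_sum : exists n : nat,
    [/\ (\sum_(i < n) gr i)%VS = fullv, directv (\sum_(i < n) gr i)%VS &
      forall i, (n <= i)%N -> gr i = 0%VS];
  gr_act : forall i, (act B @: tensv fullv (gr i) <= gr i)%VS;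
  gr_coact : forall i, (coact B @: gr i <= tensv fullv (gr i))%VS;
  gr_mul : forall i j, (hmul R @: tensv (gr i) (gr j) <= gr (i + j)%N)%VS;
  gr_one : hone R \in gr 0%N;
  gr_comul : forall n,
    (hcomul R @: gr n <= \sum_(i < n.+1) tensv (gr i) (gr (n - i)%N))%VS;
  gr_counit : forall i x, (0 < i)%N -> x \in gr i -> hcounit R x = 0;
  gr_antip : forall i, (hantip R @: gr i <= gr i)%VS }.

Definition primitive J (R : hopf k J) (x : vec k J) : Prop :=
  hcomul R x = x ⊗ hone R + hone R ⊗ x.

Definition generated_by J (R : hopf k J) (U : {vspace vec k J}) : Prop :=
  forall W : {vspace vec k J}, hone R \in W -> (U <= W)%VS ->
    (hmul R @: tensv W W <= W)%VS -> W = fullv.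

(* (B, R) is the Nichols algebra of V: a graded Hopf algebra in the category
   of Yetter-Drinfeld modules, with R(0) = k, R(1) isomorphic to V, P(R) = R(1),
   and generated as an algebra by R(1).  These properties determine it up to
   isomorphism. *)
Definition is_nichols J K (V : yd k I J) (B : yd k I K) (R : hopf k K) : Prop :=
  is_yd_hopf B R /\
  exists gr : nat -> {vspace vec k K}, is_grading B R gr /\
    [/\ gr 0%N = <[hone R]>%VS,
        exists iota : 'Hom(vec k J, vec k K),
          [/\ yd_morphism V B iota, lker iota = 0%VS & limg iota = gr 1%N],
        forall x, x \in gr 1%N <-> primitive R x &
        generated_by R (gr 1%N)].

Section Bosonization.
Variables (J : finType) (B : yd k I J) (R : hopf k J).

(* (r # h)(s # f) = r (h_(1) . s) # h_(2) f *)
Definition bos_mul : 'Hom(vec k ((J * I) * (J * I)), vec k (J * I)) :=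
  (((hmul R \o (\1 ⊠ act B)) ⊠ hmul H)
   \o reidx k (fun p : (J * (I * I)) * (J * I) =>
                 ((p.1.1, (p.1.2.1, p.2.1)), (p.1.2.2, p.2.2)))
   \o ((\1 ⊠ hcomul H) ⊠ \1))%VF.

(* r # h |-> (r^(1) # (r^(2))_(-1) h_(1)) (x) ((r^(2))_(0) # h_(2)) *)
Definition bos_comul : 'Hom(vec k (J * I), vec k ((J * I) * (J * I))) :=
  (((\1 ⊠ hmul H) ⊠ \1)
   \o reidx k (fun p : (J * (I * J)) * (I * I) =>
                 ((p.1.1, (p.1.2.1, p.2.1)), (p.1.2.2, p.2.2)))
   \o (((\1 ⊠ coact B) \o hcomul R) ⊠ hcomul H))%VF.

(* r # h |-> (1 # S(r_(-1) h)) (S_R(r_(0)) # 1) *)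
Definition bos_antip : 'Hom(vec k (J * I), vec k (J * I)) :=
  (bos_mul
   \o (lin (fun g : I => hone R ⊗ bv k g) ⊠ lin (fun r : J => bv k r ⊗ hone H))
   \o ((hantip H \o hmul H) ⊠ hantip R)
   \o reidx k (fun p : (I * J) * I => ((p.1.1, p.2), p.1.2))
   \o (coact B ⊠ \1))%VF.

Definition bosonization : hopf k (J * I) :=
  {| hmul := bos_mul;
     hone := hone R ⊗ hone H;
     hcomul := bos_comul;
     hcounit := lin (fun p : J * I =>
                 (hcounit R (bv k p.1) : k) * hcounit H (bv k p.2) : k^o);
     hantip := bos_antip |}.

End Bosonization.

End YetterDrinfeld.

Section A18.
Variables (k : fieldType) (xi : k).

(* N = C_3 x C_3, with a^i b^j written (i, j), and L = C_2 = {0, 1}, where 1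
   stands for x; the basis element e_g # y is the pair (g, y). *)
Definition N18 : finType := ('Z_3 * 'Z_3)%type.
Definition A18_basis : finType := (N18 * 'Z_2)%type.

Definition nadd (s t : N18) : N18 := (s.1 + t.1, s.2 + t.2).
Definition nopp (s : N18) : N18 := (- s.1, - s.2).
Definition nzero : N18 := (0, 0).

Definition nact (g : N18) (y : 'Z_2) : N18 :=
  if y == 0 then g else (g.1, - g.2).

Definition tau (s t : N18) (y : 'Z_2) : k :=
  if y == 0 then 1 else xi ^+ (s.2 * t.1)%N.

(* The antipode is the one forced by the other structure maps,
   see [A18_is_hopf]. *)
Definition A18 : hopf k A18_basis :=
  {| hmul := lin (fun p : A18_basis * A18_basis =>
       (nact p.1.1 p.1.2 == p.2.1)%:R *: bv k (p.1.1, p.1.2 + p.2.2));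
     hone := \sum_(g : N18) bv k (g, 0);
     hcomul := lin (fun p : A18_basis =>
       \sum_(st : N18 * N18 | nadd st.1 st.2 == p.1)
          tau st.1 st.2 p.2 *: (bv k (st.1, p.2) ⊗ bv k (st.2, p.2)));
     hcounit := lin (fun p : A18_basis => (p.1 == nzero)%:R : k^o);
     hantip := lin (fun p : A18_basis =>
       (tau p.1 (nopp p.1) p.2)^-1 *: bv k (nopp (nact p.1 p.2), - p.2)) |}.

End A18.

Section TensorLemmas.
Variable k : fieldType.
Implicit Types (I J K : finType).

Lemma linE I (W : vectType k) (F : I -> W) v :
  lin F v = \sum_i (v i : k) *: F i.
Proof.
pose f (v : vec k I) := \sum_i (v i : k) *: F i.
have f_lin : linear f.
  move=> a u w; rewrite /f scaler_sumr -big_split; apply: eq_bigr => i _.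
  by rewrite !ffunE scalerA scalerDl.
by rewrite /lin -/f (@lfunE _ _ _ (HB.pack f (GRing.isLinear.Build _ _ _ _ f f_lin))).
Qed.

Lemma lin_bv I (W : vectType k) (F : I -> W) i : lin F (bv k i) = F i.
Proof.
rewrite linE (bigD1 i) //= ffunE eqxx scale1r big1 ?addr0 // => j ji.
by rewrite ffunE eq_sym (negPf ji) scale0r.
Qed.

Lemma vecE I (v : vec k I) : v = \sum_i (v i : k) *: bv k i.
Proof.
apply/ffunP => j; rewrite sum_ffunE (bigD1 j) //= !ffunE eqxx.
rewrite [_ *: _]mulr1 big1 ?addr0 // => i ij.
by rewrite !ffunE (negPf ij) [_ *: _]mulr0.
Qed.

Lemma hom_ext I (W : vectType k) (f g : 'Hom(vec k I, W)) :
  (forall i, f (bv k i) = g (bv k i)) -> f = g.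
Proof.
move=> fg; apply/lfunP => v; rewrite (vecE v) !linear_sum.
by apply: eq_bigr => i _; rewrite !linearZ /= fg.
Qed.

Lemma tens_bv I J (i : I) (j : J) : bv k i ⊗ bv k j = bv k (i, j).
Proof.
by apply/ffunP => -[a b]; rewrite !ffunE /= xpair_eqE -natrM mulnb.
Qed.

Lemma tensZl I J c (v : vec k I) (w : vec k J) : (c *: v) ⊗ w = c *: (v ⊗ w).
Proof. by apply/ffunP => p; rewrite !ffunE; exact/esym/mulrA. Qed.
Lemma tensZr I J c (v : vec k I) (w : vec k J) : v ⊗ (c *: w) = c *: (v ⊗ w).
Proof. by apply/ffunP => p; rewrite !ffunE; exact: mulrCA. Qed.

Lemma tens_suml I J (A : Type) (r : seq A) P (F : A -> vec k I) (w : vec k J) :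
  (\sum_(a <- r | P a) F a) ⊗ w = \sum_(a <- r | P a) (F a ⊗ w).
Proof.
apply/ffunP => p; rewrite ffunE !sum_ffunE mulr_suml.
by apply: eq_bigr => a _; rewrite ffunE.
Qed.
Lemma tens_sumr I J (A : Type) (r : seq A) P (v : vec k I) (F : A -> vec k J) :
  v ⊗ (\sum_(a <- r | P a) F a) = \sum_(a <- r | P a) (v ⊗ F a).
Proof.
apply/ffunP => p; rewrite ffunE !sum_ffunE mulr_sumr.
by apply: eq_bigr => a _; rewrite ffunE.
Qed.

Lemma tensl_tens I J I' J' (f : 'Hom(vec k I, vec k I'))
    (g : 'Hom(vec k J, vec k J')) v w : (f ⊠ g) (v ⊗ w) = f v ⊗ g w.
Proof.
rewrite (vecE v) (vecE w) !tens_suml !linear_sum /= !tens_suml.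
apply: eq_bigr => i _; rewrite !tens_sumr !linear_sum /=.
apply: eq_bigr => j _; rewrite !tensZl !tensZr !linearZ /= tens_bv lin_bv.
by rewrite tensZl tensZr.
Qed.

Lemma ext2 I J (W : vectType k) (f g : 'Hom(vec k (I * J), W)) :
  (forall i j, f (bv k i ⊗ bv k j) = g (bv k i ⊗ bv k j)) -> f = g.
Proof. by move=> fg; apply: hom_ext => -[i j]; rewrite -tens_bv. Qed.

Lemma reidxE I J (s : I -> J) (t : J -> I) (v : vec k I) j :
  cancel s t -> cancel t s -> reidx k s v j = v (t j).
Proof.
move=> st ts; rewrite linE sum_ffunE (bigD1 (t j)) //= !ffunE ts eqxx.
rewrite [_ *: _]mulr1 big1 ?addr0 // => i ij.
rewrite !ffunE; case: eqP => [sij|_]; last exact: mulr0.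
by rewrite -sij st eqxx in ij.
Qed.

Lemma assoc_tens I J K (u : vec k I) (v : vec k J) (w : vec k K) :
  assoc k I J K (u ⊗ v ⊗ w) = u ⊗ (v ⊗ w).
Proof.
apply/ffunP => -[i [j l]].
rewrite (reidxE (t := fun p => ((p.1, p.2.1), p.2.2))) ?ffunE /= ?mulrA //.
  by case=> [[]].
by case=> ? [].
Qed.

Lemma form_ext I J (f : 'Hom(vec k I, vec k J)) (e : 'Hom(vec k I, k^o)) c :
  (forall i, f (bv k i) = (e (bv k i) : k) *: c) ->
  forall x, f x = (e x : k) *: c.
Proof.
move=> fe x; rewrite (vecE x) !linear_sum.
transitivity (\sum_i (e (x i *: bv k i) : k) *: c); last exact/esym/scaler_suml.
by apply: eq_bigr => i _; rewrite !linearZ /= fe scalerA.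
Qed.

Lemma ext3 I J K (W : vectType k) (f g : 'Hom(vec k ((I * J) * K), W)) :
  (forall i j l, f ((bv k i ⊗ bv k j) ⊗ bv k l)
     = g ((bv k i ⊗ bv k j) ⊗ bv k l)) -> f = g.
Proof. by move=> fg; apply: ext2 => -[i j] l; rewrite -tens_bv. Qed.

Lemma reidx_bv I J (s : I -> J) i : reidx k s (bv k i) = bv k (s i).
Proof. exact: lin_bv. Qed.

End TensorLemmas.

Section A18Hopf.
Variables (k : fieldType) (xi : k) (xi3 : xi ^+ 3 = 1).
Notation A := (A18 xi).
Let nsub (s t : N18) := nadd s (nopp t).

Lemma naddE (s t : N18) : nadd s t = (s : 'Z_3 * 'Z_3) + t. Proof. by []. Qed.
Lemma noppE (s : N18) : nopp s = - (s : 'Z_3 * 'Z_3). Proof. by []. Qed.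

Lemma nactD s t y : nact (nadd s t) y = nadd (nact s y) (nact t y).
Proof. by rewrite /nact; case: ifP => //; rewrite /nadd /= opprD. Qed.
Lemma nactN s y : nact (nopp s) y = nopp (nact s y).
Proof. by rewrite /nact; case: ifP. Qed.
Lemma nact_add s y z : nact s (y + z) = nact (nact s y) z.
Proof.
case: s => a b; rewrite /nact.
by move: y z => [[|[|//]] ?] [[|[|//]] ?] //=; rewrite opprK.
Qed.

Lemma xiE a b : a = b %[mod 3] -> xi ^+ a = xi ^+ b.
Proof. by move=> ab; rewrite -(expr_mod a xi3) ab expr_mod. Qed.

Lemma tau_cocycle u v w y :
  tau xi (nadd u v) w y * tau xi u v y = tau xi u (nadd v w) y * tau xi v w y.
Proof.
rewrite /tau; case: ifP => _; first by [].
case: u v w => [? u2] [v1 v2] [w1 ?] /=; rewrite -!exprD; apply: xiE.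
by move: u2 v1 v2 w1; do 4![case=> [[|[|[|//]]] ?] //].
Qed.

Lemma tau_mul s t y z :
  tau xi s t (y + z) = tau xi s t y * tau xi (nact s y) (nact t y) z.
Proof.
rewrite /tau; case: s t => [s1 s2] [t1 t2] /=.
move: y z => [[|[|//]] yi] [[|[|//]] zi] /=; rewrite /nact /= ?mulr1 ?mul1r //.
rewrite -exprD -[LHS](expr0 xi); apply: xiE.
by move: s2 t1 {s1 t2}; do 2![case=> [[|[|[|//]]] ?] //].
Qed.

Lemma tau0 y s : tau xi nzero s y = 1.
Proof. by rewrite /tau; case: ifP. Qed.
Lemma tau0r y s : tau xi s nzero y = 1.
Proof. by rewrite /tau muln0; case: ifP. Qed.
Lemma tau_neq0 s t y : tau xi s t y != 0.
Proof.
rewrite /tau; case: ifP => _; rewrite ?oner_eq0 // expf_neq0 //.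
by apply/eqP => x0; move/eqP: xi3; rewrite x0 expr0n eq_sym oner_eq0.
Qed.

Lemma A_mul g y h z : hmul A (bv k (g, y) ⊗ bv k (h, z)) =
  (nact g y == h)%:R *: bv k (g, y + z).
Proof. by rewrite tens_bv lin_bv. Qed.

Lemma A_comul g y : hcomul A (bv k (g, y)) =
  \sum_s tau xi s (nsub g s) y *: (bv k (s, y) ⊗ bv k (nsub g s, y)).
Proof.
rewrite lin_bv /=.
rewrite (reindex (fun s : N18 => (s, nsub g s))) /=.
  by apply: eq_bigl => s; rewrite /nsub !naddE noppE addrC subrK eqxx.
exists fst => [s _|[s t]] //=; rewrite inE /= => /eqP <-.
by rewrite /nsub !naddE noppE addrAC subrr add0r.
Qed.

Lemma A_counit g y : hcounit A (bv k (g, y)) = (g == nzero)%:R.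
Proof. by rewrite lin_bv. Qed.

Lemma A_antip g y : hantip A (bv k (g, y)) =
  (tau xi g (nopp g) y)^-1 *: bv k (nopp (nact g y), - y).
Proof. by rewrite lin_bv. Qed.

Lemma nact_inj y : injective (nact^~ y).
Proof.
move=> s t /(congr1 (nact^~ (- y))); rewrite -!nact_add subrr.
by [].
Qed.

Lemma A_one : hone A = \sum_g bv k (g, 0). Proof. by []. Qed.
Local Opaque A18.

Lemma nsub_eq0 g s : (nsub g s == nzero) = (g == s).
Proof. by rewrite /nsub naddE noppE subr_eq0. Qed.

Lemma A_mulA x y z :
  hmul A (hmul A (x ⊗ y) ⊗ z) = hmul A (x ⊗ hmul A (y ⊗ z)).
Proof.
have: (hmul A \o (hmul A ⊠ \1) = hmul A \o (\1 ⊠ hmul A) \o assoc k _ _ _)%VF.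
  apply: ext3 => -[g u] [h v] [l w].
  rewrite !comp_lfunE assoc_tens !tensl_tens !id_lfunE !A_mul.
  rewrite tensZl tensZr !linearZ /= !A_mul !scalerA addrA.
  by case: eqP => [<-|_]; rewrite ?nact_add ?mulr0 ?mul0r ?mul1r ?mulr1.
move/lfunP/(_ ((x ⊗ y) ⊗ z)); rewrite !comp_lfunE.
rewrite !tensl_tens !id_lfunE => ->.
by rewrite assoc_tens tensl_tens id_lfunE.
Qed.

Lemma A_mul1l x : hmul A (hone A ⊗ x) = x.
Proof.
rewrite (vecE x) tens_sumr linear_sum; apply: eq_bigr => -[h z] _.
rewrite tensZr linearZ /= A_one tens_suml linear_sum; congr (_ *: _).
rewrite (bigD1 h) //= A_mul eqxx scale1r add0r big1 ?addr0 // => g gh.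
by rewrite A_mul (negPf gh) scale0r.
Qed.

Lemma A_mul1r x : hmul A (x ⊗ hone A) = x.
Proof.
rewrite (vecE x) tens_suml linear_sum; apply: eq_bigr => -[h z] _.
rewrite tensZl linearZ /= A_one tens_sumr linear_sum; congr (_ *: _).
rewrite (bigD1 (nact h z)) //= A_mul eqxx scale1r addr0 big1 ?addr0 // => g gh.
by rewrite A_mul eq_sym (negPf gh) scale0r.
Qed.

Lemma A_comulA : (assoc k _ _ _ \o (hcomul A ⊠ \1) \o hcomul A
                 = (\1 ⊠ hcomul A) \o hcomul A)%VF.
Proof.
apply: hom_ext => -[g y]; rewrite !comp_lfunE !A_comul !linear_sum /=.
pose F (u v w : N18) := bv k (u, y) ⊗ (bv k (v, y) ⊗ bv k (w, y)).
transitivity (\sum_(s : N18) \sum_(u : N18)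
   (tau xi s (nsub g s) y * tau xi u (nsub s u) y) *:
     F u (nsub s u) (nsub g s)).
  apply: eq_bigr => s _; rewrite !linearZ /= tensl_tens id_lfunE A_comul.
  rewrite tens_suml linear_sum scaler_sumr; apply: eq_bigr => u _ /=.
  by rewrite tensZl linearZ /= assoc_tens scalerA.
transitivity (\sum_(u : N18) \sum_(v : N18)
   (tau xi u (nsub g u) y * tau xi v (nsub (nsub g u) v) y) *:
     F u v (nsub (nsub g u) v)); last first.
  apply: eq_bigr => s _; rewrite linearZ /= tensl_tens id_lfunE A_comul.
  rewrite tens_sumr scaler_sumr; apply: eq_bigr => u _ /=.
  by rewrite tensZr scalerA.
rewrite exchange_big /=; apply: eq_bigr => u _.
rewrite (reindex_inj (h := fun v : N18 => nadd u v)) /=; last first.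
  by move=> v w; rewrite !naddE => /addrI.
apply: eq_bigr => v _.
have -> : nsub (nadd u v) u = v.
  by rewrite /nsub !naddE noppE addrAC subrr add0r.
have -> : nsub g (nadd u v) = nsub (nsub g u) v.
  by rewrite /nsub !naddE !noppE opprD addrA.
rewrite tau_cocycle; congr ((tau xi _ _ _ * _) *: _).
by rewrite /nsub !naddE !noppE addrC subrK.
Qed.

Lemma A_counitl x : forml _ (hcounit A) (hcomul A x) = x.
Proof.
have: (forml A18_basis (hcounit A) \o hcomul A = \1)%VF; last first.
  by move/lfunP/(_ x); rewrite comp_lfunE id_lfunE.
apply: hom_ext => -[g y]; rewrite comp_lfunE id_lfunE A_comul linear_sum.
rewrite (bigD1 nzero) //= big1 ?addr0 => [|s s0]; rewrite linearZ /= tens_bv lin_bv A_counit.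
  rewrite eqxx scale1r tau0 scale1r; congr (bv k (_, _)).
  by rewrite /nsub naddE noppE subr0.
by rewrite (negPf s0) scale0r scaler0.
Qed.

Lemma A_counitr x : formr _ (hcounit A) (hcomul A x) = x.
Proof.
have: (formr A18_basis (hcounit A) \o hcomul A = \1)%VF; last first.
  by move/lfunP/(_ x); rewrite comp_lfunE id_lfunE.
apply: hom_ext => -[g y]; rewrite comp_lfunE id_lfunE A_comul linear_sum.
rewrite (bigD1 g) //= big1 ?addr0 => [|s s0]; rewrite linearZ /= tens_bv lin_bv A_counit /= nsub_eq0.
  rewrite eqxx scale1r (_ : nsub g g = nzero) ?tau0r ?scale1r //.
  by apply/eqP; rewrite nsub_eq0.
by rewrite eq_sym (negPf s0) scale0r scaler0.
Qed.

Lemma mul2_tens I (H : hopf k I) a b c d :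
  mul2 H (reidx k (fun p : I * I => (p.2, p.1))) ((a ⊗ b) ⊗ (c ⊗ d))
  = hmul H (a ⊗ c) ⊗ hmul H (b ⊗ d).
Proof.
rewrite /mul2 !comp_lfunE.
have -> : reidx k (fun p : (I * I) * (I * I) =>
                 (p.1.1, ((p.1.2, p.2.1), p.2.2))) (a ⊗ b ⊗ (c ⊗ d))
   = a ⊗ (b ⊗ c ⊗ d).
  apply/ffunP => -[i [[j l] m]].
  rewrite (reidxE (t := fun p => ((p.1, p.2.1.1), (p.2.1.2, p.2.2)))) ?ffunE /= ?mulrA //.
    by case=> [[? ?] [? ?]].
  by case=> [? [[? ?] ?]].
rewrite !tensl_tens !id_lfunE.
have -> : reidx k (fun p : I * I => (p.2, p.1)) (b ⊗ c) = c ⊗ b.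
  apply/ffunP => -[i j].
  rewrite (reidxE (t := fun p => (p.2, p.1))) ?ffunE /= 1?mulrC //.
    by case.
  by case.
have -> : reidx k (fun p : I * ((I * I) * I) =>
                 ((p.1, p.2.1.1), (p.2.1.2, p.2.2))) (a ⊗ (c ⊗ b ⊗ d))
   = (a ⊗ c) ⊗ (b ⊗ d).
  apply/ffunP => -[[i j] [l m]].
  rewrite (reidxE (t := fun p => (p.1.1, ((p.1.2, p.2.1), p.2.2)))) ?ffunE /= ?mulrA //.
    by case=> [? [[? ?] ?]].
  by case=> [[? ?] [? ?]].
by rewrite tensl_tens.
Qed.

Lemma A_comulM x y :
  hcomul A (hmul A (x ⊗ y))
  = mul2 A (reidx k (fun p => (p.2, p.1))) (hcomul A x ⊗ hcomul A y).
Proof.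
have: (hcomul A \o hmul A = mul2 A (reidx k (fun p => (p.2, p.1)))
        \o (hcomul A ⊠ hcomul A))%VF; last first.
  by move/lfunP/(_ (x ⊗ y)) => e; rewrite -[LHS]comp_lfunE e [LHS]comp_lfunE tensl_tens.
apply: ext2 => -[g u] [h v]; rewrite [LHS]comp_lfunE [RHS]comp_lfunE tensl_tens A_mul linearZ /=.
rewrite !A_comul scaler_sumr tens_suml linear_sum; apply: eq_bigr => s _ /=.
rewrite tens_sumr linear_sum (bigD1 (nact s u)) //= big1 ?addr0 => [|t ts].
  rewrite tensZl tensZr !linearZ /= mul2_tens !A_mul eqxx scale1r tensZr !scalerA.
  have -> : (nact (nsub g s) u == nsub h (nact s u)) = (nact g u == h).
    rewrite /nsub nactD nactN !naddE !noppE.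
    by rewrite (inj_eq (addIr _)).
  case: eqP => [<-|_]; last by rewrite !mulr0 !scale0r.
  rewrite !mulr1 tau_mul; congr ((_ * tau xi _ _ _) *: _).
  by rewrite /nsub nactD nactN.
rewrite tensZl tensZr !linearZ /= mul2_tens !A_mul eq_sym (negPf ts) scale0r.
by rewrite (_ : 0 ⊗ _ = 0) ?scaler0 //; apply/ffunP => p; rewrite !ffunE mul0r.
Qed.

Lemma A_comul1 : hcomul A (hone A) = hone A ⊗ hone A.
Proof.
rewrite A_one linear_sum tens_suml /=.
transitivity (\sum_(g : N18) \sum_(s : N18) (bv k (s, 0 : 'Z_2) ⊗ bv k (nsub g s, 0 : 'Z_2))).
  apply: eq_bigr => g _; rewrite A_comul; apply: eq_bigr => s _.
  by rewrite /tau eqxx scale1r.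
rewrite exchange_big; apply: eq_bigr => s _ /=; rewrite tens_sumr.
rewrite (reindex_inj (h := fun v : N18 => nadd v s)) /=; last first.
  by move=> v w; rewrite !naddE => /addIr.
by apply: eq_bigr => v _; rewrite /nsub !naddE noppE addrK.
Qed.

Lemma A_counitM x y :
  hcounit A (hmul A (x ⊗ y)) = (hcounit A x : k) * hcounit A y.
Proof.
rewrite (vecE x) (vecE y) tens_suml !linear_sum mulr_suml.
apply: eq_bigr => -[g u] _ /=; rewrite tens_sumr !linear_sum mulr_sumr.
apply: eq_bigr => -[h v] _ /=; rewrite tensZl tensZr !linearZ /= A_mul linearZ /=.
rewrite [hcounit _ (_%:R *: _)]linearZ /= !A_counit.
case: (g =P nzero) => [->|_]; last by rewrite /= ?mulr0n !scaler0 mul0r.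
have -> : nact nzero u = nzero by rewrite /nact /= oppr0 if_same.
by rewrite eq_sym /GRing.scale /= !mulr1 mulrCA mulrA.
Qed.

Lemma A_counit1 : hcounit A (hone A) = 1.
Proof.
rewrite A_one linear_sum (bigD1 nzero) //= A_counit eqxx big1 ?addr0 // => g g0.
by rewrite A_counit (negPf g0).
Qed.

Lemma tauC s y : tau xi s (nopp s) y = tau xi (nopp s) s y.
Proof.
have := tau_cocycle s (nopp s) s y.
rewrite !naddE !noppE subrr addNr.
by rewrite -[0]/nzero tau0 tau0r mul1r mul1r.
Qed.

Lemma A_antipl x :
  hmul A ((hantip A ⊠ \1)%VF (hcomul A x)) = (hcounit A x : k) *: hone A.
Proof.
have:= @form_ext _ _ _ (hmul A \o (hantip A ⊠ \1) \o hcomul A)%VF (hcounit A) (hone A).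
move=> e; rewrite -e => [|[g y]]; rewrite !comp_lfunE //.
rewrite A_counit A_comul A_one scaler_sumr !linear_sum /=.
rewrite [RHS](reindex_inj (h := fun s => nopp (nact s y))) /=; last first.
  by move=> s t; rewrite !noppE => /oppr_inj/nact_inj.
apply: eq_bigr => s _; rewrite !linearZ /= tensl_tens id_lfunE A_antip tensZl.
rewrite linearZ /= A_mul addNr !scalerA; congr (_ *: _).
rewrite nactN -nact_add subrr /nact /= /nsub.
have -> : (nopp s == nadd g (nopp s)) = (g == nzero).
  by rewrite eq_sym !naddE !noppE -subr_eq0 addrK.
case: eqP => [->|_]; last by rewrite mulr0.
by rewrite mulr1 naddE add0r divff ?tau_neq0.
Qed.

Lemma A_antipr x :
  hmul A ((\1 ⊠ hantip A)%VF (hcomul A x)) = (hcounit A x : k) *: hone A.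
Proof.
have:= @form_ext _ _ _ (hmul A \o (\1 ⊠ hantip A) \o hcomul A)%VF (hcounit A) (hone A).
move=> e; rewrite -e => [|[g y]]; rewrite !comp_lfunE //.
rewrite A_counit A_comul A_one scaler_sumr !linear_sum /=.
apply: eq_bigr => s _; rewrite !linearZ /= tensl_tens id_lfunE A_antip tensZr.
rewrite linearZ /= A_mul subrr !scalerA; congr (_ *: _).
rewrite -nactN (inj_eq (@nact_inj y)) /nsub !naddE !noppE opprD opprK.
have -> : ((s : 'Z_3 * 'Z_3) == - (g : 'Z_3 * 'Z_3) + s) = (g == nzero).
  by rewrite -subr_eq0 opprD opprK addrCA subrr addr0.
case: eqP => [->|_]; last by rewrite mulr0.
by rewrite mulr1 oppr0 !add0r -!noppE tauC divff ?tau_neq0.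
Qed.

Lemma A18_is_hopf : is_hopf A.
Proof.
split; [exact: A_mulA | exact: A_mul1l | exact: A_mul1r | exact: A_comulA
  | exact: A_counitl | exact: A_counitr | exact: A_comulM | exact: A_comul1
  | exact: A_counitM | exact: A_counit1 | exact: A_antipl | exact: A_antipr].
Qed.

End A18Hopf.

(* Main.v *)
Require Import Defs.
From HB Require Import structures.
From mathcomp Require Import all_boot all_order all_algebra ring.
Set Implicit Arguments.
Unset Strict Implicit.
Unset Printing Implicit Defensive.
Import GRing.Theory.
Local Open Scope ring_scope.

(** The Fomin-Kirillov algebra of S_3 has dimension 12, generators x_0, x_1, x_2
    and relations x_l^2 = 0, x_0 x_1 + x_1 x_2 + x_2 x_0 = 0,
    x_1 x_0 + x_2 x_1 + x_0 x_2 = 0.  Over a field that contains a primitive cube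
    root of unity w, put x_l = v_0 + w^l v_1 + w^(2l) v_2; the relations become
      v_0^2 = v_1 v_2 = v_2 v_1 = 0,
      v_1^2 + v_2 v_0 + v_0 v_2 = 0,   v_2^2 + v_1 v_0 + v_0 v_1 = 0.
    This algebra is the Nichols algebra of the span V of the v_j, both over
    A = A_(18,xi) and over its dual, for suitable structures on V.

    A Yetter-Drinfeld module over either Hopf algebra is obtained from the same
    elementary object, a [datum]: a space graded by Z/2 (parity) and by Z/3
    (weight), with an action X of Z/2 and an action W of Z/3.  On the algebra, the
    parity of v_j is 1 and its weight is j, X sends v_j to - v_(-j), and W_b sends
    v_j w to v_(j+b) W_(-b)(w).  The constructions [yd_A] and [yd_D] of modules
    over A and over the dual from data are compatible with tensor products, and
    the two braidings, [yd_A_braiding] and [yd_D_braiding], are inverse to each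
    other.  So there is one algebra, with one coproduct for each of two mutually
    inverse braidings, both determined by the condition that the v_j be primitive.
    In the basis of the twelve words that are not reducible by the relations, all
    structure constants are 0, 1 or -1.  Hence the Hopf algebra axioms and the
    compatibility with the gradings and the actions are identities between signed
    sums of basis tensors, and these are decided by cancellation.  The
    coproducts also show that the primitive elements are those of degree 1:
    a basis word w of another degree has a basis tensor that occurs in the
    coproduct of no other word, and the coefficient of w in a primitive element
    is read off there ([wR_primitive]).

    The rest is general.  The bosonization R # H is a Hopf algebra
    ([bosonization_is_hopf]); as it is spanned by the products (r # 1)(1 # h), its
    coproduct need only be multiplicative on pairs of such factors.  When R is
    graded with R(0) = k, the bosonization is a graded coalgebra with H in degree 0.
    A simple subcoalgebra of a graded coalgebra lies in degree 0
    ([simple_subcoalgebra_deg0]), and H is the sum of its simple subcoalgebras: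
    A of nine group-like elements and one 3 x 3 matrix coalgebra
    ([A_cosemisimple]), the dual of six group-like elements and three 2 x 2
    matrix coalgebras ([D_cosemisimple]).  Hence the coradical is the Hopf
    subalgebra H ([bosonization_dual_chevalley]).  The dimension is
    12 * 18 = 216. *)

(** * Sweedler sums *)

Section Sweedler.
Variable k : fieldType.
Implicit Types (I J K L M : finType).

(** The Sweedler sum of E(t_(1), t_(2)), expanded in the basis so that it makes
    sense for an arbitrary function E; it is independent of the basis when E is
    bilinear ([sw_tens]). *)
Definition sw I J (W : lmodType k) (t : vec k (I * J))
    (E : vec k I -> vec k J -> W) : W :=
  \sum_p (t p : k) *: E (bv k p.1) (bv k p.2).

Lemma eq_sw I J (W : lmodType k) (t : vec k (I * J)) (E F : vec k I -> vec k J -> W) :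
  (forall x y, E x y = F x y) -> sw t E = sw t F.
Proof. by move=> EF; apply: eq_bigr => p _; rewrite EF. Qed.

Lemma sw_lfun I J (U : vectType k) (f : 'Hom(vec k (I * J), U)) t :
  f t = sw t (fun x y => f (x ⊗ y)).
Proof.
rewrite {1}(vecE t) linear_sum; apply: eq_bigr => -[i j] _.
by rewrite linearZ /= tens_bv.
Qed.

Lemma sw_id I J (t : vec k (I * J)) : t = sw t (fun x y => x ⊗ y).
Proof. by rewrite {1}(vecE t); apply: eq_bigr => -[i j] _; rewrite tens_bv. Qed.

(** A predicate rather than a structure on functions, so that it applies to
    functions given by expressions. *)
Definition is_linear (U W : lmodType k) (f : U -> W) : Prop :=
  forall c u v, f (c *: u + v) = c *: f u + f v.

Lemma linear_sumE (U W : lmodType k) (f : U -> W) (A : Type) (r : seq A) P F :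
  is_linear f -> f (\sum_(a <- r | P a) F a) = \sum_(a <- r | P a) f (F a).
Proof.
move=> lf; pose g : {linear U -> W} := HB.pack f (GRing.isLinear.Build _ _ _ _ f lf).
exact: (linear_sum g).
Qed.

Lemma linear_scaleE (U W : lmodType k) (f : U -> W) (a : k) u :
  is_linear f -> f (a *: u) = a *: f u.
Proof.
move=> lf; pose g : {linear U -> W} := HB.pack f (GRing.isLinear.Build _ _ _ _ f lf).
exact: (linearZ_LR g).
Qed.

Lemma sw_linear I J (W : lmodType k) (E : vec k I -> vec k J -> W) :
  is_linear (fun t => sw t E).
Proof.
move=> a s t; rewrite /sw scaler_sumr -big_split; apply: eq_bigr => p _.
by rewrite !ffunE scalerDl scalerA.
Qed.

Lemma sw_morph I J (U W : lmodType k) (f : W -> U) (t : vec k (I * J)) E :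
  is_linear f -> f (sw t E) = sw t (fun x y => f (E x y)).
Proof.
move=> lf; rewrite linear_sumE //; apply: eq_bigr => p _.
by rewrite linear_scaleE.
Qed.

Lemma linear_vecE I (W : lmodType k) (f : vec k I -> W) v : is_linear f ->
  f v = \sum_i (v i : k) *: f (bv k i).
Proof.
move=> lf; rewrite {1}(vecE v) linear_sumE //; apply: eq_bigr => i _.
by rewrite linear_scaleE.
Qed.

Lemma sw_tens I J (W : lmodType k) (v : vec k I) (w : vec k J)
    (E : vec k I -> vec k J -> W) :
  (forall y, is_linear (fun x => E x y)) -> (forall x, is_linear (E x)) ->
  sw (v ⊗ w) E = E v w.
Proof.
move=> El Er; rewrite (linear_vecE v (El w)).
transitivity (\sum_i \sum_j ((v ⊗ w) (i, j) : k) *: E (bv k i) (bv k j)).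
  by rewrite pair_bigA; apply: eq_bigr => -[].
apply: eq_bigr => i _; rewrite (linear_vecE w (Er _)) scaler_sumr.
by apply: eq_bigr => j _; rewrite ffunE scalerA.
Qed.

Lemma sw_sw I J K L (W : lmodType k) (t : vec k (I * J))
    (F : vec k I -> vec k J -> vec k (K * L)) (E : vec k K -> vec k L -> W) :
  sw (sw t F) E = sw t (fun x y => sw (F x y) E).
Proof. by rewrite (sw_morph (f := fun s => sw s E)) //; apply: sw_linear. Qed.

Lemma sw_exchange I J K L (W : lmodType k) (s : vec k (I * J)) (t : vec k (K * L))
    (E : vec k I -> vec k J -> vec k K -> vec k L -> W) :
  sw s (fun a b => sw t (fun c d => E a b c d))
  = sw t (fun c d => sw s (fun a b => E a b c d)).
Proof.
rewrite /sw; under eq_bigr do rewrite scaler_sumr.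
rewrite exchange_big; apply: eq_bigr => p _; rewrite scaler_sumr.
by apply: eq_bigr => q _; rewrite !scalerA mulrC.
Qed.

(** Coassociativity holds under the Sweedler sum for an arbitrary function of
    the three tensor factors: such a sum only evaluates it on basis vectors. *)
Lemma sw_assoc I J K L M (W : lmodType k)
    (c : 'Hom(vec k L, vec k (I * J))) (d : 'Hom(vec k M, vec k (J * K)))
    (s : vec k (L * K)) (t : vec k (I * M))
    (E : vec k I -> vec k J -> vec k K -> W) :
  assoc k I J K ((c ⊠ \1)%VF s) = (\1 ⊠ d)%VF t ->
  sw s (fun x y => sw (c x) (fun a b => E a b y))
  = sw t (fun x y => sw (d y) (fun a b => E x a b)).
Proof.
pose G (u : vec k (I * (J * K))) := \sum_p (u p : k) *:
   E (bv k p.1) (bv k p.2.1) (bv k p.2.2).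
have Gl : is_linear G.
  move=> a u v; rewrite /G scaler_sumr -big_split; apply: eq_bigr => p _.
  by rewrite !ffunE scalerDl scalerA.
move/(congr1 G).
rewrite [(c ⊠ \1)%VF s]sw_lfun [(\1 ⊠ d)%VF t]sw_lfun.
rewrite (sw_morph (f := assoc k I J K)); last by move=> a u v; rewrite linearP.
rewrite !(sw_morph _ _ Gl) => e.
transitivity (sw s (fun x y => G (assoc k I J K ((c ⊠ \1)%VF (x ⊗ y))))).
  apply: eq_bigr => -[i j] _ /=; rewrite tensl_tens id_lfunE.
  congr (_ *: _); rewrite [in RHS](vecE (c (bv k i))) tens_suml linear_sum.
  rewrite (linear_sumE _ _ _ Gl); apply: eq_bigr => -[a b] _.
  rewrite tensZl linearZ /= -[bv k (a, b)]tens_bv assoc_tens !tens_bv (linear_scaleE _ _ Gl).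
  rewrite /G (bigD1 (a, (b, j))) //= big1 ?addr0.
    by rewrite !ffunE eqxx scale1r.
  by move=> p pn; rewrite !ffunE eq_sym (negPf pn) scale0r.
rewrite e; apply: eq_bigr => -[i j] _ /=; rewrite tensl_tens id_lfunE.
congr (_ *: _); rewrite [in LHS](vecE (d (bv k j))) tens_sumr.
rewrite (linear_sumE _ _ _ Gl); apply: eq_bigr => -[a b] _.
rewrite tensZr !tens_bv (linear_scaleE _ _ Gl).
rewrite /G (bigD1 (i, (a, b))) //= big1 ?addr0.
  by rewrite !ffunE eqxx scale1r.
by move=> p pn; rewrite !ffunE eq_sym (negPf pn) scale0r.
Qed.

Lemma tens0l I J (w : vec k J) : (0 : vec k I) ⊗ w = 0.
Proof. by apply/ffunP => p; rewrite !ffunE mul0r. Qed.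

Lemma tens0r I J (v : vec k I) : v ⊗ (0 : vec k J) = 0.
Proof. by apply/ffunP => p; rewrite !ffunE mulr0. Qed.

Lemma tensDl I J (v w : vec k I) (u : vec k J) : (v + w) ⊗ u = v ⊗ u + w ⊗ u.
Proof. by apply/ffunP => p; rewrite !ffunE mulrDl. Qed.

Lemma tensDr I J (u : vec k I) (v w : vec k J) : u ⊗ (v + w) = u ⊗ v + u ⊗ w.
Proof. by apply/ffunP => p; rewrite !ffunE mulrDr. Qed.

Lemma is_linear_id (U : lmodType k) : is_linear (fun u : U => u).
Proof. by []. Qed.

Lemma is_linear_comp (X U W : lmodType k) (f : U -> W) (g : X -> U) :
  is_linear f -> is_linear g -> is_linear (fun x => f (g x)).
Proof. by move=> fl gl a u v; rewrite gl fl. Qed.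

Lemma is_linear_lfun (X : lmodType k) (U W : vectType k) (f : 'Hom(U, W)) (g : X -> U) :
  is_linear g -> is_linear (fun x => f (g x)).
Proof. by move=> gl a u v; rewrite gl linearP. Qed.

Lemma is_linear_tensl (X : lmodType k) I J (g : X -> vec k I) (w : vec k J) :
  is_linear g -> is_linear (fun x => g x ⊗ w).
Proof.
move=> gl a u v; rewrite gl; apply/ffunP => p; rewrite !ffunE mulrDl.
by congr (_ + _); apply/esym/mulrA.
Qed.

Lemma is_linear_tensr (X : lmodType k) I J (g : X -> vec k I) (w : vec k J) :
  is_linear g -> is_linear (fun x => w ⊗ g x).
Proof.
move=> gl a u v; rewrite gl; apply/ffunP => p; rewrite !ffunE mulrDr.
by congr (_ + _); apply: mulrCA.
Qed.

Lemma is_linear_swl (X W : lmodType k) I J (g : X -> vec k (I * J))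
    (E : vec k I -> vec k J -> W) :
  is_linear g -> is_linear (fun x => sw (g x) E).
Proof. by move=> gl a u v; rewrite gl sw_linear. Qed.

Lemma is_linear_swr (X W : lmodType k) I J (t : vec k (I * J))
    (E : X -> vec k I -> vec k J -> W) :
  (forall a b, is_linear (fun x => E x a b)) -> is_linear (fun x => sw t (E x)).
Proof.
move=> El c u v; rewrite /sw scaler_sumr -big_split; apply: eq_bigr => p _.
by rewrite El scalerDr !scalerA mulrC.
Qed.

Lemma is_linear_scaler (X W : lmodType k) c (g : X -> W) :
  is_linear g -> is_linear (fun x => c *: g x).
Proof. by move=> gl a u v; rewrite gl scalerDr !scalerA mulrC. Qed.

Lemma is_linear_scalel (X W : lmodType k) (g : X -> k^o) (w : W) :
  is_linear g -> is_linear (fun x => (g x : k) *: w).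
Proof. by move=> gl a u v; rewrite gl [RHS]addrC scalerDl addrC scalerA. Qed.

Lemma tens_ext I J (W : lmodType k) (f g : vec k (I * J) -> W) :
  is_linear f -> is_linear g -> (forall x y, f (x ⊗ y) = g (x ⊗ y)) -> f =1 g.
Proof.
move=> fl gl fg t; rewrite (sw_id t) !sw_morph //; exact: eq_sw.
Qed.

End Sweedler.

(** Linearity in one variable of an expression built from linear maps, tensor
    products and Sweedler sums follows from its syntax; a function variable of up
    to three arguments is linear by a hypothesis in the context. *)
Ltac lin := intros; cbv beta; lazymatch goal with
  | |- is_linear (fun x => x) => exact: is_linear_id
  | |- is_linear (fun x => @?c x *: @?g x) =>
      lazymatch c with
      | (fun _ => ?a) => refine (is_linear_scaler a (g := g) _)
      | _ => lazymatch g with (fun _ => ?w) =>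
               refine (is_linear_scalel (g := c) w _) end
      end; lin
  | |- is_linear (fun x => @?g x ⊗ @?h x) =>
      lazymatch g with
      | (fun _ => ?v) => refine (is_linear_tensr v (g := h) _)
      | _ => lazymatch h with (fun _ => ?w) =>
               refine (is_linear_tensl (g := g) w _) end
      end; lin
  | |- is_linear (fun x => sw (@?g x) (@?E x)) =>
      lazymatch g with
      | (fun _ => ?t) => refine (is_linear_swr t (E := E) _)
      | _ => lazymatch E with (fun _ => ?F) =>
               refine (is_linear_swl (g := g) F _) end
      end; lin
  | |- is_linear (GRing.scale ?c) => refine (is_linear_scaler c _); exact: is_linear_id
  | |- is_linear (fun x => fun_of_lfun ?f (@?g x)) =>
      refine (is_linear_lfun f (g := g) _); lin
  | |- is_linear (fun_of_lfun ?f) => exact: (is_linear_lfun f (@is_linear_id _ _))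
  | |- is_linear (fun x => ?E (@?f x) (@?g x) (@?h x)) =>
      first [ refine (is_linear_comp (f := fun z => E z _ _) (g := f) _ _); [by eauto | lin]
            | refine (is_linear_comp (f := fun z => E _ z _) (g := g) _ _); [by eauto | lin]
            | refine (is_linear_comp (f := fun z => E _ _ z) (g := h) _ _); [by eauto | lin] ]
  | |- is_linear (fun x => ?E (@?f x) (@?g x)) =>
      first [ refine (is_linear_comp (f := fun z => E z _) (g := f) _ _); [by eauto | lin]
            | refine (is_linear_comp (f := fun z => E _ z) (g := g) _ _); [by eauto | lin] ]
  | |- is_linear (fun x => ?E (@?f x)) =>
      refine (is_linear_comp (f := E) (g := f) _ _); [ by eauto | lin ]
  | |- is_linear _ => by eauto
  end.

(** * Structure maps on pure tensors *)

Section Shuffles.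
Variable k : fieldType.
Variables (A1 A2 A3 A4 A5 : finType).
Variables (a : vec k A1) (b : vec k A2) (c : vec k A3) (d : vec k A4) (e : vec k A5).

Lemma shuffle_a_c_b :
  reidx k (fun p : (A1 * A2) * A3 => ((p.1.1, p.2), p.1.2)) (a ⊗ b ⊗ c)
  = a ⊗ c ⊗ b.
Proof.
apply/ffunP => p.
rewrite (reidxE (t := fun p => ((p.1.1, p.2), p.1.2))) ?ffunE /= 1?mulrAC //.
  by case=> [[]].
by case=> [[]].
Qed.

Lemma shuffle_ac_bd :
  reidx k (fun p : (A1 * A2) * (A3 * A4) => ((p.1.1, p.2.1), (p.1.2, p.2.2)))
    (a ⊗ b ⊗ (c ⊗ d)) = a ⊗ c ⊗ (b ⊗ d).
Proof.
apply/ffunP => p.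
rewrite (reidxE (t := fun p => ((p.1.1, p.2.1), (p.1.2, p.2.2)))) ?ffunE /= 1?mulrACA //.
  by case=> [[? ?] []].
by case=> [[? ?] []].
Qed.

Lemma shuffle_a_bd_c_e :
  reidx k (fun p : (A1 * (A2 * A3)) * (A4 * A5) =>
             ((p.1.1, (p.1.2.1, p.2.1)), (p.1.2.2, p.2.2)))
    (a ⊗ (b ⊗ c) ⊗ (d ⊗ e)) = a ⊗ (b ⊗ d) ⊗ (c ⊗ e).
Proof.
apply/ffunP => p.
rewrite (reidxE (t := fun p => ((p.1.1, (p.1.2.1, p.2.1)), (p.1.2.2, p.2.2)))) ?ffunE /=.
- by rewrite -!mulrA; congr (_ * (_ * _)); rewrite mulrCA.
- by move=> [[? [? ?]] [? ?]].
- by move=> [[? [? ?]] [? ?]].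
Qed.

Lemma shuffle_ad_c_be :
  reidx k (fun p : ((A1 * A2) * A3) * (A4 * A5) =>
             (((p.1.1.1, p.2.1), p.1.2), (p.1.1.2, p.2.2)))
    (a ⊗ b ⊗ c ⊗ (d ⊗ e)) = a ⊗ d ⊗ c ⊗ (b ⊗ e).
Proof.
apply/ffunP => p.
rewrite (reidxE (t := fun p => (((p.1.1.1, p.2.1), p.1.2), (p.1.1.2, p.2.2)))) ?ffunE /=.
- rewrite -!mulrA; congr (_ * _); rewrite mulrCA [RHS]mulrCA.
  by congr (_ * _); exact: mulrCA.
- by move=> [[[? ?] ?] [? ?]].
- by move=> [[[? ?] ?] [? ?]].
Qed.

Lemma shuffle_a_bc_d :
  reidx k (fun p : (A1 * A2) * (A3 * A4) => (p.1.1, ((p.1.2, p.2.1), p.2.2)))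
    (a ⊗ b ⊗ (c ⊗ d)) = a ⊗ (b ⊗ c ⊗ d).
Proof.
apply/ffunP => p.
rewrite (reidxE (t := fun p => ((p.1, p.2.1.1), (p.2.1.2, p.2.2)))) ?ffunE /= ?mulrA //.
  by case=> [[? ?] []].
by case=> [? [[? ?] ?]].
Qed.

Lemma shuffle_ab_cd :
  reidx k (fun p : A1 * ((A2 * A3) * A4) => ((p.1, p.2.1.1), (p.2.1.2, p.2.2)))
    (a ⊗ (b ⊗ c ⊗ d)) = a ⊗ b ⊗ (c ⊗ d).
Proof.
apply/ffunP => p.
rewrite (reidxE (t := fun p => (p.1.1, ((p.1.2, p.2.1), p.2.2)))) ?ffunE /= ?mulrA //.
  by case=> [? [[? ?] ?]].
by case=> [[? ?] []].
Qed.

End Shuffles.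

Section Formulas.
Variables (k : fieldType) (I : finType) (H : hopf k I).
Implicit Types J K : finType.

Lemma mul2E J (R : hopf k J) c x y z w :
  mul2 R c ((x ⊗ y) ⊗ (z ⊗ w))
  = sw (c (y ⊗ z)) (fun u v => hmul R (x ⊗ u) ⊗ hmul R (v ⊗ w)).
Proof.
rewrite /mul2 !comp_lfunE shuffle_a_bc_d !tensl_tens !id_lfunE.
rewrite {1}[c _]sw_id.
set f := hmul R ⊠ hmul R.
rewrite (sw_morph (f := fun t => f (reidx k _ (x ⊗ (t ⊗ w))))); last by lin.
by apply: eq_sw => u v; rewrite shuffle_ab_cd tensl_tens.
Qed.

Lemma yd_braidingE J K (V : yd k I J) (W : yd k I K) v w :
  yd_braiding V W (v ⊗ w) = sw (coact V v) (fun z u => act W (z ⊗ w) ⊗ u).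
Proof.
rewrite /yd_braiding !comp_lfunE tensl_tens id_lfunE {1}[coact V v]sw_id.
rewrite (sw_morph (f := fun t => (act W ⊠ \1)%VF (reidx k _ (t ⊗ w)))); last by lin.
by apply: eq_sw => z u; rewrite shuffle_a_c_b tensl_tens id_lfunE.
Qed.

Lemma yd_tens_actE J K (V : yd k I J) (W : yd k I K) h v w :
  act (yd_tens H V W) (h ⊗ (v ⊗ w))
  = sw (hcomul H h) (fun h1 h2 => act V (h1 ⊗ v) ⊗ act W (h2 ⊗ w)).
Proof.
rewrite /= !comp_lfunE tensl_tens id_lfunE {1}[hcomul H h]sw_id.
rewrite (sw_morph (f := fun t => (act V ⊠ act W)%VF (reidx k _ (t ⊗ (v ⊗ w))))); last by lin.
by apply: eq_sw => z u; rewrite shuffle_ac_bd tensl_tens.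
Qed.

Lemma yd_tens_coactE J K (V : yd k I J) (W : yd k I K) v w :
  coact (yd_tens H V W) (v ⊗ w)
  = sw (coact V v) (fun z v0 => sw (coact W w) (fun y w0 =>
      hmul H (z ⊗ y) ⊗ (v0 ⊗ w0))).
Proof.
rewrite /= !comp_lfunE tensl_tens.
set f := (hmul H ⊠ \1)%VF.
rewrite {1}[coact V v]sw_id (sw_morph (f := fun t => f (reidx k _ (t ⊗ coact W w)))); last by lin.
apply: eq_sw => z u; rewrite {1}[coact W w]sw_id.
rewrite (sw_morph (f := fun t => f (reidx k _ (z ⊗ u ⊗ t)))); last by lin.
by apply: eq_sw => y t; rewrite shuffle_ac_bd tensl_tens id_lfunE.
Qed.

Lemma yd_twistE J (V : yd k I J) h v :
  yd_twist H V (h ⊗ v)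
  = sw (hcomul H h) (fun h' h3 => sw (hcomul H h') (fun h1 h2 =>
      sw (coact V v) (fun z w =>
        hmul H (hmul H (h1 ⊗ z) ⊗ hantip H h3) ⊗ act V (h2 ⊗ w)))).
Proof.
rewrite /yd_twist !comp_lfunE tensl_tens comp_lfunE.
set f := ((hmul H \o _) ⊠ _)%VF.
rewrite {1}[hcomul H h]sw_id (sw_morph (f := fun t => f (reidx k _ ((hcomul H ⊠ \1)%VF t ⊗ coact V v)))); last by lin.
apply: eq_sw => h' h3; rewrite tensl_tens id_lfunE {1}[hcomul H h']sw_id.
rewrite (sw_morph (f := fun t => f (reidx k _ (t ⊗ h3 ⊗ coact V v)))); last by lin.
apply: eq_sw => h1 h2; rewrite {1}[coact V v]sw_id.
rewrite (sw_morph (f := fun t => f (reidx k _ (h1 ⊗ h2 ⊗ h3 ⊗ t)))); last by lin.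
by apply: eq_sw => z w; rewrite shuffle_ad_c_be tensl_tens comp_lfunE tensl_tens.
Qed.

Variables (J : finType) (B : yd k I J) (R : hopf k J).

Lemma bos_mulE r h s f :
  bos_mul H B R ((r ⊗ h) ⊗ (s ⊗ f))
  = sw (hcomul H h) (fun h1 h2 =>
      hmul R (r ⊗ act B (h1 ⊗ s)) ⊗ hmul H (h2 ⊗ f)).
Proof.
rewrite /bos_mul !comp_lfunE !tensl_tens !id_lfunE.
set g := ((hmul R \o _) ⊠ _)%VF.
rewrite {1}[hcomul H h]sw_id (sw_morph (f := fun t => g (reidx k _ ((r ⊗ t) ⊗ (s ⊗ f))))); last by lin.
apply: eq_sw => h1 h2.
by rewrite shuffle_a_bd_c_e tensl_tens comp_lfunE tensl_tens id_lfunE.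
Qed.

Lemma bos_comulE r h :
  bos_comul H B R (r ⊗ h)
  = sw (hcomul R r) (fun r1 r2 => sw (coact B r2) (fun z w =>
      sw (hcomul H h) (fun h1 h2 => (r1 ⊗ hmul H (z ⊗ h1)) ⊗ (w ⊗ h2)))).
Proof.
rewrite /bos_comul !comp_lfunE tensl_tens comp_lfunE.
set g := ((\1 ⊠ hmul H) ⊠ _)%VF.
rewrite {1}[hcomul R r]sw_id (sw_morph (f := fun t => g (reidx k _ ((\1 ⊠ coact B)%VF t ⊗ hcomul H h)))); last by lin.
apply: eq_sw => r1 r2; rewrite tensl_tens id_lfunE {1}[coact B r2]sw_id.
rewrite (sw_morph (f := fun t => g (reidx k _ (r1 ⊗ t ⊗ hcomul H h)))); last by lin.
apply: eq_sw => z w; rewrite {1}[hcomul H h]sw_id.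
rewrite (sw_morph (f := fun t => g (reidx k _ (r1 ⊗ (z ⊗ w) ⊗ t)))); last by lin.
by apply: eq_sw => h1 h2; rewrite shuffle_a_bd_c_e !tensl_tens !id_lfunE.
Qed.

Lemma bos_antipE r h :
  bos_antip H B R (r ⊗ h)
  = sw (coact B r) (fun z w =>
      bos_mul H B R ((hone R ⊗ hantip H (hmul H (z ⊗ h)))
                     ⊗ (hantip R w ⊗ hone H))).
Proof.
rewrite /bos_antip; move: (bos_mul H B R) => m.
rewrite !comp_lfunE tensl_tens id_lfunE {1}[coact B r]sw_id.
set g := ((hantip H \o hmul H) ⊠ hantip R)%VF.
set g' := (lin _ ⊠ lin _)%VF.
rewrite (sw_morph (f := fun t => m (g' (g (reidx k _ (t ⊗ h)))))); last by lin.
apply: eq_sw => z w; rewrite shuffle_a_c_b tensl_tens comp_lfunE tensl_tens.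
congr (m (_ ⊗ _)); rewrite linE.
  by rewrite [in RHS](linear_vecE (f := fun t => hone R ⊗ t)) //; lin.
by rewrite [in RHS](linear_vecE (f := fun t => t ⊗ hone H)) //; lin.
Qed.

End Formulas.

(** * The bosonization is a Hopf algebra *)

Section Forms.
Variable k : fieldType.
Implicit Types I J : finType.

Lemma formlE I J (phi : 'Hom(vec k I, k^o)) (t : vec k (I * J)) :
  forml J phi t = sw t (fun x y => (phi x : k) *: y).
Proof. exact: linE. Qed.

Lemma formrE I J (phi : 'Hom(vec k J, k^o)) (t : vec k (I * J)) :
  formr I phi t = sw t (fun x y => (phi y : k) *: x).
Proof. exact: linE. Qed.

Lemma form_tensE I J (phi : 'Hom(vec k I, k^o)) (psi : 'Hom(vec k J, k^o)) v w :
  lin (fun p : I * J => (phi (bv k p.1) : k) * psi (bv k p.2) : k^o) (v ⊗ w)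
  = (phi v : k) * psi w.
Proof.
have lform (K : finType) (chi : 'Hom(vec k K, k^o)) : is_linear chi by lin.
rewrite linE [phi v](linear_vecE _ (lform _ phi)) [psi w](linear_vecE _ (lform _ psi)) mulr_suml.
transitivity (\sum_i \sum_j ((v ⊗ w) (i, j) : k) *:
   ((phi (bv k i) : k) * psi (bv k j) : k^o)).
  by rewrite pair_bigA; apply: eq_bigr => -[].
apply: eq_bigr => i _; rewrite mulr_sumr; apply: eq_bigr => j _.
by rewrite ffunE; exact: mulrACA.
Qed.

End Forms.

Section HopfSweedler.
Variables (k : fieldType) (I : finType) (H : hopf k I) (c : 'Hom(vec k (I * I), vec k (I * I))).
Hypothesis hH : is_hopf_for c H.
Variable (W : lmodType k).

Lemma comulA_sw (E : vec k I -> vec k I -> vec k I -> W) h :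
  sw (hcomul H h) (fun x y => sw (hcomul H x) (fun a b => E a b y))
  = sw (hcomul H h) (fun x y => sw (hcomul H y) (fun a b => E x a b)).
Proof.
by apply: sw_assoc; have /lfunP/(_ h) := hopf_comulA hH; rewrite !comp_lfunE.
Qed.

Variables (F : vec k I -> W) (Fl : is_linear F).

Lemma counitl_sw h :
  sw (hcomul H h) (fun x y => (hcounit H x : k) *: F y) = F h.
Proof.
rewrite -[in RHS](hopf_counitl hH h) formlE (sw_morph _ _ Fl).
by apply: eq_sw => x y; rewrite linear_scaleE.
Qed.

Lemma counitr_sw h :
  sw (hcomul H h) (fun x y => (hcounit H y : k) *: F x) = F h.
Proof.
rewrite -[in RHS](hopf_counitr hH h) formrE (sw_morph _ _ Fl).
by apply: eq_sw => x y; rewrite linear_scaleE.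
Qed.

Lemma antipl_sw h :
  sw (hcomul H h) (fun x y => F (hmul H (hantip H x ⊗ y)))
  = (hcounit H h : k) *: F (hone H).
Proof.
rewrite -(linear_scaleE _ _ Fl) -(hopf_antipl hH h).
rewrite [(_ ⊠ _)%VF _]sw_lfun !sw_morph //; last by lin.
by apply: eq_sw => x y; rewrite tensl_tens id_lfunE.
Qed.

Lemma antipr_sw h :
  sw (hcomul H h) (fun x y => F (hmul H (x ⊗ hantip H y)))
  = (hcounit H h : k) *: F (hone H).
Proof.
rewrite -(linear_scaleE _ _ Fl) -(hopf_antipr hH h).
rewrite [(_ ⊠ _)%VF _]sw_lfun !sw_morph //; last by lin.
by apply: eq_sw => x y; rewrite tensl_tens id_lfunE.
Qed.

Variables (E : vec k I -> vec k I -> W).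
Hypothesis El : forall y, is_linear (fun x => E x y).
Hypothesis Er : forall x, is_linear (E x).

Lemma comulM_for_sw h g :
  sw (hcomul H (hmul H (h ⊗ g))) E
  = sw (hcomul H h) (fun h1 h2 => sw (hcomul H g) (fun g1 g2 =>
      sw (c (h2 ⊗ g1)) (fun u v => E (hmul H (h1 ⊗ u)) (hmul H (v ⊗ g2))))).
Proof.
rewrite (hopf_comulM hH) {1}[hcomul H h]sw_id.
rewrite (sw_morph (f := fun t => sw (mul2 H c (t ⊗ _)) E)); last by lin.
apply: eq_sw => h1 h2; rewrite {1}[hcomul H g]sw_id.
rewrite (sw_morph (f := fun t => sw (mul2 H c (_ ⊗ t)) E)); last by lin.
apply: eq_sw => g1 g2; rewrite mul2E sw_sw.
by apply: eq_sw => u v; rewrite sw_tens.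
Qed.

End HopfSweedler.

Section Radford.
Variables (k : fieldType) (I J : finType) (H : hopf k I).
Variables (B : yd k I J) (R : hopf k J).
Hypotheses (hH : is_hopf H) (hB : is_yd_hopf H B R).

Let hR := ydh_hopf hB.
Let T := bosonization H B R.

Lemma flipE (K L : finType) (v : vec k K) (w : vec k L) :
  reidx k (fun p : K * L => (p.2, p.1)) (v ⊗ w) = w ⊗ v.
Proof.
apply/ffunP => p; rewrite (reidxE (t := fun p => (p.2, p.1))) ?ffunE /= 1?mulrC //.
  by case.
by case.
Qed.

Section Facts.
Variable W : lmodType k.
Variables (E : vec k I -> vec k J -> W) (E1 : vec k I -> vec k I -> W).
Hypothesis El : forall y, is_linear (fun x => E x y).
Hypothesis Er : forall x, is_linear (E x).
Hypothesis E1l : forall y, is_linear (fun x => E1 x y).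
Hypothesis E1r : forall x, is_linear (E1 x).
Variables (E2 : vec k J -> vec k J -> W).
Hypothesis E2l : forall y, is_linear (fun x => E2 x y).
Hypothesis E2r : forall x, is_linear (E2 x).

Lemma comulM_sw h g :
  sw (hcomul H (hmul H (h ⊗ g))) E1
  = sw (hcomul H h) (fun h1 h2 => sw (hcomul H g) (fun g1 g2 =>
      E1 (hmul H (h1 ⊗ g1)) (hmul H (h2 ⊗ g2)))).
Proof.
rewrite (comulM_for_sw hH) //; apply: eq_sw => h1 h2; apply: eq_sw => g1 g2.
by rewrite flipE sw_tens //; lin.
Qed.

Lemma comulRM_sw r s :
  sw (hcomul R (hmul R (r ⊗ s))) E2
  = sw (hcomul R r) (fun r1 r2 => sw (hcomul R s) (fun s1 s2 =>
      sw (coact B r2) (fun z w =>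
        E2 (hmul R (r1 ⊗ act B (z ⊗ s1))) (hmul R (w ⊗ s2))))).
Proof.
rewrite (comulM_for_sw hR) //; apply: eq_sw => r1 r2; apply: eq_sw => s1 s2.
rewrite yd_braidingE sw_sw; apply: eq_sw => z w; rewrite sw_tens //; lin.
Qed.

Lemma coactA_sw (E3 : vec k I -> vec k I -> vec k J -> W) v :
  sw (coact B v) (fun z w => sw (hcomul H z) (fun a b => E3 a b w))
  = sw (coact B v) (fun z w => sw (coact B w) (fun a b => E3 z a b)).
Proof.
by apply: sw_assoc; have /lfunP/(_ v) := yd_coactA (ydh_yd hB); rewrite !comp_lfunE.
Qed.

Lemma coact_counit_sw (F : vec k J -> W) v : is_linear F ->
  sw (coact B v) (fun z w => (hcounit H z : k) *: F w) = F v.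
Proof.
move=> Fl; rewrite -[in RHS](yd_coact1 (ydh_yd hB) v) formlE (sw_morph _ _ Fl).
by apply: eq_sw => x y; rewrite linear_scaleE.
Qed.

Lemma coact_counitR_sw (F : vec k I -> W) v : is_linear F ->
  sw (coact B v) (fun z w => (hcounit R w : k) *: F z)
  = (hcounit R v : k) *: F (hone H).
Proof.
move=> Fl; rewrite -(linear_scaleE _ _ Fl) -(ydh_counit_coact hB) formrE.
by rewrite sw_morph //; apply: eq_sw => x y; rewrite linear_scaleE.
Qed.

Lemma act_mul h r s : act B (h ⊗ hmul R (r ⊗ s))
  = sw (hcomul H h) (fun h1 h2 => hmul R (act B (h1 ⊗ r) ⊗ act B (h2 ⊗ s))).
Proof.
have [/(_ h (r ⊗ s)) <- _] := ydh_mul hB.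
by rewrite yd_tens_actE sw_morph //; lin.
Qed.

Lemma coact_mul_sw r s : sw (coact B (hmul R (r ⊗ s))) E
  = sw (coact B r) (fun z v => sw (coact B s) (fun y w =>
      E (hmul H (z ⊗ y)) (hmul R (v ⊗ w)))).
Proof.
have [_ /(_ (r ⊗ s)) ->] := ydh_mul hB.
rewrite yd_tens_coactE (sw_morph (f := (\1 ⊠ hmul R)%VF)); last by lin.
rewrite sw_sw; apply: eq_sw => z v.
rewrite (sw_morph (f := (\1 ⊠ hmul R)%VF)); last by lin.
rewrite sw_sw; apply: eq_sw => y w; rewrite tensl_tens id_lfunE sw_tens //.
Qed.

Lemma comul_act_sw h r : sw (hcomul R (act B (h ⊗ r))) E2
  = sw (hcomul H h) (fun h1 h2 => sw (hcomul R r) (fun r1 r2 =>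
      E2 (act B (h1 ⊗ r1)) (act B (h2 ⊗ r2)))).
Proof.
have [/(_ h r) -> _] := ydh_comul hB.
rewrite [hcomul R r in LHS]sw_id.
rewrite (sw_morph (f := fun t => sw (act _ (h ⊗ t)) E2)); last by lin.
rewrite sw_exchange; apply: eq_sw => r1 r2; rewrite yd_tens_actE sw_sw.
by apply: eq_sw => h1 h2; rewrite sw_tens.
Qed.

Lemma coact_comul_sw (E3 : vec k I -> vec k J -> vec k J -> W)
    (E31 : forall x y, is_linear (fun z => E3 z x y))
    (E32 : forall x y, is_linear (fun z => E3 x z y))
    (E33 : forall x y, is_linear (fun z => E3 x y z)) r :
  sw (coact B r) (fun z w => sw (hcomul R w) (E3 z))
  = sw (hcomul R r) (fun r1 r2 => sw (coact B r1) (fun y s =>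
      sw (coact B r2) (fun x t => E3 (hmul H (y ⊗ x)) s t))).
Proof.
have [_ /(_ r) e] := ydh_comul hB.
pose G (t : vec k (I * (J * J))) := sw t (fun z w => sw w (E3 z)).
have Gl : is_linear G by apply: sw_linear.
transitivity (G ((\1 ⊠ hcomul R)%VF (coact B r))).
  rewrite {2}[coact B r]sw_id (sw_morph (f := fun t => G ((\1 ⊠ hcomul R)%VF t))); last first.
    by rewrite /G; lin.
  by apply: eq_sw => z w; rewrite tensl_tens id_lfunE /G sw_tens //; lin.
rewrite -e {1}[hcomul R r]sw_id (sw_morph (f := fun t => G (coact _ t))); last by rewrite /G; lin.
apply: eq_sw => r1 r2; rewrite yd_tens_coactE /G sw_sw.
apply: eq_sw => y s; rewrite sw_sw; apply: eq_sw => x t.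
rewrite sw_tens; [|lin|lin]; rewrite sw_tens //.
Qed.

(** Multiplying the two sides of the Yetter-Drinfeld condition on the right by a
    further component h_(4) cancels the antipode, as S(h_(3)) h_(4) = 1. *)
Lemma yd_compat_sw h v :
  sw (hcomul H h) (fun h1 h2 => sw (coact B (act B (h1 ⊗ v)))
    (fun z w => E (hmul H (z ⊗ h2)) w))
  = sw (hcomul H h) (fun h1 h2 => sw (coact B v)
      (fun z w => E (hmul H (h1 ⊗ z)) (act B (h2 ⊗ w)))).
Proof.
transitivity (sw (hcomul H h) (fun h0 h4 => sw (hcomul H h0) (fun h' h3 =>
   sw (hcomul H h') (fun h1 h2 => sw (coact B v) (fun z w =>
     E (hmul H (hmul H (h1 ⊗ z) ⊗ (hmul H (hantip H h3 ⊗ h4)))) (act B (h2 ⊗ w))))))).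
  apply: eq_sw => h0 h4; rewrite (yd_compat (ydh_yd hB)) yd_twistE.
  rewrite sw_sw; apply: eq_sw => h' h3; rewrite sw_sw; apply: eq_sw => h1 h2.
  rewrite sw_sw; apply: eq_sw => z w; rewrite sw_tens; first by rewrite (hopf_mulA hH).
    by lin.
  by lin.
rewrite (comulA_sw hH (fun h' h3 h4 => sw (hcomul H h') (fun h1 h2 => sw (coact B v) (fun z w =>
     E (hmul H (hmul H (h1 ⊗ z) ⊗ (hmul H (hantip H h3 ⊗ h4)))) (act B (h2 ⊗ w)))))).
pose F h' y := sw (hcomul H h') (fun h1 h2 => sw (coact B v) (fun z w =>
     E (hmul H (hmul H (h1 ⊗ z) ⊗ y)) (act B (h2 ⊗ w)))).
have Fl x : is_linear (F x) by rewrite /F; lin.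
rewrite -[LHS]/(sw (hcomul H h) (fun h' y => sw (hcomul H y) (fun h3 h4 => F h' (hmul H (hantip H h3 ⊗ h4))))).
under eq_sw => h' y do rewrite (antipl_sw hH (Fl h')).
rewrite (counitr_sw hH (F := fun x => F x (hone H))); last by rewrite /F; lin.
by apply: eq_sw => h1 h2; apply: eq_sw => z w; rewrite (hopf_mul1r hH).
Qed.

End Facts.

Lemma mulTE r h s f : hmul T ((r ⊗ h) ⊗ (s ⊗ f))
  = sw (hcomul H h) (fun h1 h2 => hmul R (r ⊗ act B (h1 ⊗ s)) ⊗ hmul H (h2 ⊗ f)).
Proof. exact: bos_mulE. Qed.

Lemma comulTE r h : hcomul T (r ⊗ h)
  = sw (hcomul R r) (fun r1 r2 => sw (coact B r2) (fun z w =>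
      sw (hcomul H h) (fun h1 h2 => (r1 ⊗ hmul H (z ⊗ h1)) ⊗ (w ⊗ h2)))).
Proof. exact: bos_comulE. Qed.

Lemma counitTE r h : hcounit T (r ⊗ h) = (hcounit R r : k) * hcounit H h.
Proof. exact: form_tensE. Qed.

Lemma antipTE r h : hantip T (r ⊗ h)
  = sw (coact B r) (fun z w => hmul T ((hone R ⊗ hantip H (hmul H (z ⊗ h)))
                     ⊗ (hantip R w ⊗ hone H))).
Proof. exact: bos_antipE. Qed.

Lemma act1E r : act B (hone H ⊗ r) = r.
Proof. exact: yd_act1 (ydh_yd hB) r. Qed.

Lemma mulT_A x y z : hmul T (hmul T (x ⊗ y) ⊗ z) = hmul T (x ⊗ hmul T (y ⊗ z)).
Proof.
move: x; apply: tens_ext; [lin | lin |] => r h.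
move: y; apply: tens_ext; [lin | lin |] => s f.
move: z; apply: tens_ext; [lin | lin |] => t g.
rewrite !mulTE (sw_morph (f := fun x => hmul T (x ⊗ (t ⊗ g)))); last by lin.
rewrite (sw_morph (f := fun x => hmul T (r ⊗ h ⊗ x))); last by lin.
under [RHS]eq_sw => f1 f2 do rewrite mulTE.
rewrite [RHS]sw_exchange.
under [LHS]eq_sw => h1 h2 do [rewrite mulTE comulM_sw; [|lin|lin]].
rewrite -(comulA_sw hH (fun h1 h2 h3 => sw (hcomul H f) (fun f1 f2 =>
  hmul R (hmul R (r ⊗ act B (h1 ⊗ s)) ⊗ act B (hmul H (h2 ⊗ f1) ⊗ t))
   ⊗ hmul H (hmul H (h3 ⊗ f2) ⊗ g)))).
apply: eq_sw => h1 h2; rewrite sw_exchange; apply: eq_sw => f1 f2.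
rewrite act_mul.
rewrite (sw_morph (f := fun x => hmul R (r ⊗ x) ⊗ hmul H (h2 ⊗ hmul H (f2 ⊗ g)))); last by lin.
apply: eq_sw => a b.
by rewrite (hopf_mulA hH) (hopf_mulA hR) (yd_actA (ydh_yd hB)).
Qed.

(* From here on, jr and ih in a name stand for the factors r # 1 and 1 # h. *)
Lemma mulT_jr_ih r h : hmul T ((r ⊗ hone H) ⊗ (hone R ⊗ h)) = r ⊗ h.
Proof.
rewrite mulTE (hopf_comul1 hH) sw_tens; [|lin|lin].
by rewrite act1E (hopf_mul1r hR) (hopf_mul1l hH).
Qed.

Lemma mulT_jr h r s : hmul T ((r ⊗ hone H) ⊗ (s ⊗ h)) = hmul R (r ⊗ s) ⊗ h.
Proof.
rewrite mulTE (hopf_comul1 hH) sw_tens; [|lin|lin].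
by rewrite act1E (hopf_mul1l hH).
Qed.

Lemma mulT_ih r h f : hmul T ((r ⊗ h) ⊗ (hone R ⊗ f)) = r ⊗ hmul H (h ⊗ f).
Proof.
rewrite mulTE.
under eq_sw => h1 h2 do rewrite (ydh_one_act hB) tensZr linearZ /= tensZl (hopf_mul1r hR).
by rewrite (counitl_sw hH (F := fun x => r ⊗ hmul H (x ⊗ f))) //; lin.
Qed.

Lemma mulT_1l x : hmul T (hone T ⊗ x) = x.
Proof.
move: x; apply: tens_ext; [lin | lin |] => r h.
by rewrite mulT_jr (hopf_mul1l hR).
Qed.

Lemma mulT_1r x : hmul T (x ⊗ hone T) = x.
Proof.
move: x; apply: tens_ext; [lin | lin |] => r h.
by rewrite mulT_ih (hopf_mul1r hH).
Qed.

Lemma comulT_ih h : hcomul T (hone R ⊗ h)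
  = sw (hcomul H h) (fun h1 h2 => (hone R ⊗ h1) ⊗ (hone R ⊗ h2)).
Proof.
rewrite comulTE (hopf_comul1 hR) sw_tens; [|lin|lin].
rewrite (ydh_one_coact hB) sw_tens; [|lin|lin].
by apply: eq_sw => h1 h2; rewrite (hopf_mul1l hH).
Qed.

Lemma comulT_jr r : hcomul T (r ⊗ hone H)
  = sw (hcomul R r) (fun r1 r2 => sw (coact B r2) (fun z w =>
      (r1 ⊗ z) ⊗ (w ⊗ hone H))).
Proof.
rewrite comulTE; apply: eq_sw => r1 r2; apply: eq_sw => z w.
rewrite (hopf_comul1 hH) sw_tens; [|lin|lin].
by rewrite (hopf_mul1r hH).
Qed.

Notation flip L := (reidx k (fun p : L * L => (p.2, p.1))).
Let P x y := mul2 T (flip (prod J I)) (x ⊗ y).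

Lemma mulTT_E a b c d : P (a ⊗ b) (c ⊗ d) = hmul T (a ⊗ c) ⊗ hmul T (b ⊗ d).
Proof. by rewrite /P mul2E flipE sw_tens //; lin. Qed.

Lemma mulTT_A x y z : P (P x y) z = P x (P y z).
Proof.
rewrite /P.
move: x; apply: tens_ext; [lin | lin |] => a a'.
move: y; apply: tens_ext; [lin | lin |] => b b'.
move: z; apply: tens_ext; [lin | lin |] => c c'.
rewrite -!/(P _ _) !mulTT_E /= !mulT_A //.
Qed.

Definition comulT_mult x y := hcomul T (hmul T (x ⊗ y)) = P (hcomul T x) (hcomul T y).

Lemma comulT_jr_ih r h : comulT_mult (r ⊗ hone H) (hone R ⊗ h).
Proof.
rewrite /comulT_mult mulT_jr_ih comulT_jr comulT_ih comulTE.
rewrite /P (sw_morph (f := fun x => mul2 T _ (x ⊗ _))); last by lin.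
apply: eq_sw => r1 r2.
rewrite (sw_morph (f := fun x => mul2 T _ (x ⊗ _))); last by lin.
apply: eq_sw => z w.
rewrite (sw_morph (f := fun x => mul2 T _ (_ ⊗ x))); last by lin.
apply: eq_sw => h1 h2.
by rewrite -/(P _ _) mulTT_E mulT_ih mulT_jr_ih.
Qed.

Lemma comulT_ih_ih h f : comulT_mult (hone R ⊗ h) (hone R ⊗ f).
Proof.
rewrite /comulT_mult mulT_ih !comulT_ih comulM_sw; [|lin|lin].
rewrite /P (sw_morph (f := fun x => mul2 T _ (x ⊗ _))); last by lin.
apply: eq_sw => h1 h2.
rewrite (sw_morph (f := fun x => mul2 T _ (_ ⊗ x))); last by lin.
apply: eq_sw => f1 f2.
by rewrite -/(P _ _) mulTT_E !mulT_ih.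
Qed.

(** This is where the braiding of R is used: the coproduct of a product in R
    involves r_(-1) acting on s_(1), which is the commutation rule of H with R in
    the smash product. *)
Lemma comulT_jr_jr r s : comulT_mult (r ⊗ hone H) (s ⊗ hone H).
Proof.
rewrite /comulT_mult mulT_jr !comulT_jr comulRM_sw; [|lin|lin].
rewrite /P (sw_morph (f := fun x => mul2 T _ (x ⊗ _))); last by lin.
apply: eq_sw => r1 r2.
rewrite (sw_morph (f := fun x => mul2 T _ (_ ⊗ x))); last by lin.
apply: eq_sw => s1 s2.
transitivity (sw (coact B r2) (fun z w => sw (coact B w) (fun z' w' =>
   sw (coact B s2) (fun y s0 => (hmul R (r1 ⊗ act B (z ⊗ s1)) ⊗ hmul H (z' ⊗ y))
     ⊗ (hmul R (w' ⊗ s0) ⊗ hone H))))).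
  by apply: eq_sw => z w; rewrite coact_mul_sw //; lin.
rewrite -(coactA_sw (fun z z' w' => sw (coact B s2) (fun y s0 =>
   (hmul R (r1 ⊗ act B (z ⊗ s1)) ⊗ hmul H (z' ⊗ y)) ⊗ (hmul R (w' ⊗ s0) ⊗ hone H)))).
rewrite (sw_morph (f := fun x => mul2 T _ (x ⊗ _))); last by lin.
apply: eq_sw => z w; rewrite sw_exchange.
rewrite (sw_morph (f := fun x => mul2 T _ (_ ⊗ x))); last by lin.
apply: eq_sw => y s0.
rewrite -/(P _ _) mulTT_E mulT_jr mulTE.
by rewrite [RHS](sw_morph (f := fun x => x ⊗ _)); last by lin.
Qed.

(** The commutation rule (1 # h)(r # 1) = h_(1) r # h_(2) is respected by the
    coproduct because of the Yetter-Drinfeld condition. *)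
Lemma comulT_ih_jr h r : comulT_mult (hone R ⊗ h) (r ⊗ hone H).
Proof.
rewrite /comulT_mult mulTE sw_morph; last by lin.
rewrite comulT_ih comulT_jr.
under [LHS]eq_sw => h1 h2 do rewrite (hopf_mul1l hR) (hopf_mul1r hH).
transitivity (sw (hcomul H h) (fun h1 h2 => sw (hcomul H h2) (fun h3 h4 =>
  sw (hcomul R r) (fun r1 r2 => sw (hcomul H h3) (fun a b =>
   sw (coact B r2) (fun z w => (act B (h1 ⊗ r1) ⊗ hmul H (a ⊗ z)) ⊗ (act B (b ⊗ w) ⊗ h4))))))).
  transitivity (sw (hcomul H h) (fun h1 h2 => sw (hcomul H h1) (fun a1 a2 =>
     sw (hcomul H h2) (fun b1 b2 => sw (hcomul R r) (fun r1 r2 =>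
       sw (coact B (act B (a2 ⊗ r2))) (fun z w =>
         (act B (a1 ⊗ r1) ⊗ hmul H (z ⊗ b1)) ⊗ (w ⊗ b2))))))).
    apply: eq_sw => h1 h2; rewrite comulTE comul_act_sw; [|lin|lin].
    apply: eq_sw => a1 a2; rewrite [RHS]sw_exchange; apply: eq_sw => r1 r2.
    by rewrite [LHS]sw_exchange.
  rewrite (comulA_sw hH (fun a1 a2 h2 => sw (hcomul H h2) (fun b1 b2 => sw (hcomul R r) (fun r1 r2 =>
       sw (coact B (act B (a2 ⊗ r2))) (fun z w =>
         (act B (a1 ⊗ r1) ⊗ hmul H (z ⊗ b1)) ⊗ (w ⊗ b2)))))).
  apply: eq_sw => h1 h2.
  rewrite -(comulA_sw hH (fun a2 b1 b2 => sw (hcomul R r) (fun r1 r2 =>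
       sw (coact B (act B (a2 ⊗ r2))) (fun z w =>
         (act B (h1 ⊗ r1) ⊗ hmul H (z ⊗ b1)) ⊗ (w ⊗ b2))))).
  apply: eq_sw => h3 h4; rewrite sw_exchange; apply: eq_sw => r1 r2.
  by rewrite (yd_compat_sw (E := fun x y => (act B (h1 ⊗ r1) ⊗ x) ⊗ (y ⊗ h4))) //; lin.
rewrite /P (sw_morph (f := fun x => mul2 T _ (x ⊗ _))); last by lin.
rewrite -(comulA_sw hH (fun h1 h3 h4 => sw (hcomul R r) (fun r1 r2 => sw (hcomul H h3) (fun a b =>
   sw (coact B r2) (fun z w => (act B (h1 ⊗ r1) ⊗ hmul H (a ⊗ z)) ⊗ (act B (b ⊗ w) ⊗ h4)))))).
transitivity (sw (hcomul H h) (fun h0 h4 => sw (hcomul H h0) (fun x b =>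
   sw (hcomul H x) (fun h1 a => sw (hcomul R r) (fun r1 r2 => 
   sw (coact B r2) (fun z w => (act B (h1 ⊗ r1) ⊗ hmul H (a ⊗ z)) ⊗ (act B (b ⊗ w) ⊗ h4))))))).
  apply: eq_sw => h0 h4.
  rewrite (comulA_sw hH (fun h1 a b => sw (hcomul R r) (fun r1 r2 => 
   sw (coact B r2) (fun z w => (act B (h1 ⊗ r1) ⊗ hmul H (a ⊗ z)) ⊗ (act B (b ⊗ w) ⊗ h4))))).
  by apply: eq_sw => h1 h3; rewrite sw_exchange.
rewrite (comulA_sw hH (fun x b h4 => sw (hcomul H x) (fun h1 a => sw (hcomul R r) (fun r1 r2 => 
   sw (coact B r2) (fun z w => (act B (h1 ⊗ r1) ⊗ hmul H (a ⊗ z)) ⊗ (act B (b ⊗ w) ⊗ h4)))))).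
apply: eq_sw => h1 h2.
rewrite (sw_morph (f := fun x => mul2 T _ (_ ⊗ x))); last by lin.
transitivity (sw (hcomul R r) (fun r1 r2 => sw (coact B r2) (fun z w =>
  sw (hcomul H h2) (fun b h4 => sw (hcomul H h1) (fun h0 a =>
     (act B (h0 ⊗ r1) ⊗ hmul H (a ⊗ z)) ⊗ (act B (b ⊗ w) ⊗ h4)))))).
  under eq_sw => b h4 do rewrite sw_exchange.
  rewrite sw_exchange; apply: eq_sw => r1 r2.
  under eq_sw => b h4 do rewrite sw_exchange.
  by rewrite sw_exchange.
apply: eq_sw => r1 r2; rewrite [RHS](sw_morph (f := fun x => mul2 T _ (_ ⊗ x))); last by lin.
apply: eq_sw => z w; rewrite -/(P _ _) mulTT_E !mulTE.
rewrite [RHS](sw_morph (f := fun x => _ ⊗ x)); last by lin.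
apply: eq_sw => b h4; rewrite [RHS](sw_morph (f := fun x => x ⊗ _)); last by lin.
by apply: eq_sw => h0 a; rewrite !(hopf_mul1l hR) !(hopf_mul1r hH).
Qed.

(** A product (r # h)(s # f) is regrouped as (r # 1)(1 # h)(s # 1)(1 # f), whose
    two inner factors are commuted; each step is one of the four cases above. *)
Lemma comulT_M x y : comulT_mult x y.
Proof.
rewrite /comulT_mult /P.
move: x; apply: tens_ext; [lin | lin |] => r h.
move: y; apply: tens_ext; [lin | lin |] => s f.
rewrite -!/(P _ _) -(mulT_jr_ih r h) -(mulT_jr_ih s f) comulT_jr_ih comulT_jr_ih.
rewrite !mulT_A -[hmul T ((hone R ⊗ h) ⊗ _)]mulT_A.
rewrite !mulTT_A -[P (hcomul T (hone R ⊗ h)) _]mulTT_A -comulT_ih_jr.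
rewrite (mulTE (hone R) h s (hone H)).
rewrite (sw_morph (f := fun x => hcomul T (hmul T (_ ⊗ hmul T (x ⊗ _))))); last by lin.
rewrite [in RHS](sw_morph (f := hcomul T)); last by lin.
rewrite [RHS](sw_morph (f := fun x => P (hcomul T (r ⊗ hone H)) (P x (hcomul T (hone R ⊗ f))))); last by rewrite /P; lin.
apply: eq_sw => h1 h2; rewrite (hopf_mul1l hR) (hopf_mul1r hH).
rewrite mulT_ih mulT_jr -(mulT_jr_ih _ (hmul H (h2 ⊗ f))) comulT_jr_ih.
rewrite -mulT_ih comulT_ih_ih -mulT_jr comulT_jr_jr.
by rewrite -(mulT_jr_ih (act B (h1 ⊗ s)) h2) comulT_jr_ih !mulTT_A.
Qed.

(** Coassociativity of R is used for r, that of H for h, and the coaction on the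
    second factor is moved across the coproduct of R, which is a comodule map. *)
Lemma comulT_A : (assoc k _ _ _ \o (hcomul T ⊠ \1) \o hcomul T
                 = (\1 ⊠ hcomul T) \o hcomul T)%VF.
Proof.
apply/lfunP => x; rewrite comp_lfunE comp_lfunE [RHS]comp_lfunE.
move: x; apply: tens_ext; [lin | lin |] => r h.
pose V a b c d e f : vec k ((J * I) * ((J * I) * (J * I))) :=
  (a ⊗ b) ⊗ ((c ⊗ d) ⊗ (e ⊗ f)).
rewrite comulTE.
transitivity (sw (hcomul R r) (fun r1 r2 => sw (hcomul R r1) (fun a b =>
  sw (coact B b) (fun y c => sw (coact B r2) (fun z w => sw (hcomul H h) (fun h1 h2 =>
    sw (hcomul H z) (fun z1 z2 => sw (hcomul H h1) (fun g1 g2 =>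
      V a (hmul H (y ⊗ hmul H (z1 ⊗ g1))) c (hmul H (z2 ⊗ g2)) w h2)))))))).
  rewrite (sw_morph (f := fun x => assoc k _ _ _ ((hcomul T ⊠ \1)%VF x))); last by lin.
  apply: eq_sw => r1 r2.
  under [RHS]eq_sw => a b do rewrite sw_exchange.
  rewrite [RHS]sw_exchange.
  rewrite (sw_morph (f := fun x => assoc k _ _ _ ((hcomul T ⊠ \1)%VF x))); last by lin.
  apply: eq_sw => z w.
  under [RHS]eq_sw => a b do rewrite sw_exchange.
  rewrite [RHS]sw_exchange.
  rewrite (sw_morph (f := fun x => assoc k _ _ _ ((hcomul T ⊠ \1)%VF x))); last by lin.
  apply: eq_sw => h1 h2; rewrite tensl_tens id_lfunE comulTE.
  rewrite (sw_morph (f := fun x => assoc k _ _ _ (x ⊗ _))); last by lin.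
  apply: eq_sw => a b.
  rewrite (sw_morph (f := fun x => assoc k _ _ _ (x ⊗ _))); last by lin.
  apply: eq_sw => y c; rewrite comulM_sw; [|lin|lin].
  rewrite (sw_morph (f := fun x => assoc k _ _ _ (x ⊗ _))); last by lin.
  apply: eq_sw => z1 z2.
  rewrite (sw_morph (f := fun x => assoc k _ _ _ (x ⊗ _))); last by lin.
  by apply: eq_sw => g1 g2; rewrite assoc_tens.
rewrite (comulA_sw hR (fun a b r2 => sw (coact B b) (fun y c => sw (coact B r2) (fun z w => sw (hcomul H h) (fun h1 h2 =>
    sw (hcomul H z) (fun z1 z2 => sw (hcomul H h1) (fun g1 g2 =>
      V a (hmul H (y ⊗ hmul H (z1 ⊗ g1))) c (hmul H (z2 ⊗ g2)) w h2))))))).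
rewrite (sw_morph (f := (\1 ⊠ hcomul T)%VF)); last by lin.
apply: eq_sw => a r2.
transitivity (sw (hcomul R r2) (fun b d => sw (coact B b) (fun y c =>
  sw (coact B d) (fun z e => sw (coact B e) (fun z2 w => sw (hcomul H h) (fun h1 h2 =>
    sw (hcomul H h2) (fun g2 g3 =>
      V a (hmul H (y ⊗ hmul H (z ⊗ h1))) c (hmul H (z2 ⊗ g2)) w g3))))))).
  apply: eq_sw => b d; apply: eq_sw => y c.
  rewrite -(coactA_sw (fun z z2 w => sw (hcomul H h) (fun h1 h2 =>
    sw (hcomul H h2) (fun g2 g3 =>
      V a (hmul H (y ⊗ hmul H (z ⊗ h1))) c (hmul H (z2 ⊗ g2)) w g3)))).
  apply: eq_sw => z w; rewrite sw_exchange; apply: eq_sw => z1 z2.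
  by rewrite (comulA_sw hH (fun g1 g2 h2 => 
      V a (hmul H (y ⊗ hmul H (z1 ⊗ g1))) c (hmul H (z2 ⊗ g2)) w h2)).
transitivity (sw (coact B r2) (fun z r0 => sw (hcomul R r0) (fun c d =>
   sw (coact B d) (fun z2 w => sw (hcomul H h) (fun h1 h2 =>
    sw (hcomul H h2) (fun g2 g3 =>
      V a (hmul H (z ⊗ h1)) c (hmul H (z2 ⊗ g2)) w g3)))))).
  rewrite (coact_comul_sw (E3 := fun z c d => sw (coact B d) (fun z2 w => sw (hcomul H h) (fun h1 h2 =>
    sw (hcomul H h2) (fun g2 g3 =>
      V a (hmul H (z ⊗ h1)) c (hmul H (z2 ⊗ g2)) w g3))))); try by rewrite /V; lin.
  apply: eq_sw => b d; apply: eq_sw => y c; apply: eq_sw => z e; apply: eq_sw => z2 w.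
  apply: eq_sw => h1 h2; apply: eq_sw => g2 g3.
  by rewrite (hopf_mulA hH).
rewrite (sw_morph (f := (\1 ⊠ hcomul T)%VF)); last by lin.
apply: eq_sw => z r0.
rewrite (sw_morph (f := (\1 ⊠ hcomul T)%VF)); last by lin.
under eq_sw => c d do rewrite sw_exchange.
rewrite sw_exchange; apply: eq_sw => h1 h2.
rewrite tensl_tens id_lfunE comulTE.
rewrite (sw_morph (f := fun x => _ ⊗ x)); last by lin.
apply: eq_sw => c d.
rewrite (sw_morph (f := fun x => _ ⊗ x)); last by lin.
apply: eq_sw => z2 w.
by rewrite (sw_morph (f := fun x => _ ⊗ x)); last by lin.
Qed.

Lemma counitT_l x : forml _ (hcounit T) (hcomul T x) = x.
Proof.
move: x; apply: tens_ext; [lin | lin |] => r h; rewrite comulTE formlE sw_sw.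
under eq_sw => r1 r2 do rewrite sw_sw.
under eq_sw => r1 r2 do under eq_sw => z w do rewrite sw_sw.
transitivity (sw (hcomul R r) (fun r1 r2 => sw (coact B r2) (fun z w =>
   sw (hcomul H h) (fun h1 h2 => (hcounit H h1 : k) *: ((hcounit H z : k) *:
       ((hcounit R r1 : k) *: (w ⊗ h2))))))).
  apply: eq_sw => r1 r2; apply: eq_sw => z w; apply: eq_sw => h1 h2.
  rewrite sw_tens; [|lin|lin].
  rewrite counitTE (hopf_counitM hH) !scalerA; congr (_ *: _).
  by rewrite [RHS]mulrC; congr (_ * _); exact: mulrC.
under eq_sw => r1 r2 do under eq_sw => z w do
  [rewrite (counitl_sw hH (F := fun x => (hcounit H z : k) *: ((hcounit R r1 : k) *: (w ⊗ x)))); [|lin]].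
under eq_sw => r1 r2 do
  [rewrite (coact_counit_sw (F := fun x => (hcounit R r1 : k) *: (x ⊗ h))); [|lin]].
by rewrite (counitl_sw hR (F := fun x => x ⊗ h)) //; lin.
Qed.

Lemma counitT_r x : formr _ (hcounit T) (hcomul T x) = x.
Proof.
move: x; apply: tens_ext; [lin | lin |] => r h; rewrite comulTE formrE sw_sw.
under eq_sw => r1 r2 do rewrite sw_sw.
under eq_sw => r1 r2 do under eq_sw => z w do rewrite sw_sw.
transitivity (sw (hcomul R r) (fun r1 r2 => sw (coact B r2) (fun z w =>
   sw (hcomul H h) (fun h1 h2 => (hcounit H h2 : k) *: ((hcounit R w : k) *:
       (r1 ⊗ hmul H (z ⊗ h1))))))).
  apply: eq_sw => r1 r2; apply: eq_sw => z w; apply: eq_sw => h1 h2.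
  rewrite sw_tens; [|lin|lin].
  by rewrite counitTE !scalerA mulrC.
under eq_sw => r1 r2 do under eq_sw => z w do
  [rewrite (counitr_sw hH (F := fun x => (hcounit R w : k) *: (r1 ⊗ hmul H (z ⊗ x)))); [|lin]].
under eq_sw => r1 r2 do
  [rewrite (coact_counitR_sw (F := fun x => (r1 ⊗ hmul H (x ⊗ h)))); [|lin]].
rewrite (counitr_sw hR (F := fun x => x ⊗ hmul H (hone H ⊗ h))); last by lin.
by rewrite (hopf_mul1l hH).
Qed.

Lemma comulT_1 : hcomul T (hone T) = hone T ⊗ hone T.
Proof. by rewrite comulT_ih (hopf_comul1 hH) sw_tens //; lin. Qed.

Lemma counitT_1 : hcounit T (hone T) = 1.
Proof. by rewrite counitTE (hopf_counit1 hR) (hopf_counit1 hH) mulr1. Qed.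

Lemma counitT_M x y : hcounit T (hmul T (x ⊗ y)) = (hcounit T x : k) * hcounit T y.
Proof.
rewrite -[RHS]/((hcounit T x : k) *: (hcounit T y : k^o)).
move: x; apply: tens_ext; [lin | lin |] => r h.
move: y; apply: tens_ext; [lin | lin |] => s f.
rewrite mulTE sw_morph; last by lin.
transitivity (sw (hcomul H h) (fun h1 h2 => (hcounit H h1 : k) *:
  ((hcounit R r : k) *: ((hcounit R s : k) *: (hcounit H (hmul H (h2 ⊗ f)) : k^o))))).
  apply: eq_sw => h1 h2; rewrite counitTE (hopf_counitM hR) (ydh_counit_act hB).
  by rewrite [X in X * _]mulrCA -!mulrA.
rewrite (counitl_sw hH (F := fun x => (hcounit R r : k) *: ((hcounit R s : k) *: (hcounit H (hmul H (x ⊗ f)) : k^o)))); last by lin.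
rewrite (hopf_counitM hH) !counitTE -[RHS]/((_ * _) * (_ * _)) mulrACA.
by rewrite -mulrA.
Qed.

Lemma antipT_l x : hmul T ((hantip T ⊠ \1)%VF (hcomul T x)) = (hcounit T x : k) *: hone T.
Proof.
move: x; apply: tens_ext; [lin | lin |] => r h.
rewrite comulTE (sw_morph (f := fun x => hmul T ((hantip T ⊠ \1)%VF x))); last by lin.
transitivity (sw (hcomul R r) (fun r1 r2 => sw (coact B r1) (fun y s =>
  sw (coact B r2) (fun z w => sw (hcomul H h) (fun h1 h2 =>
   hmul T ((hone R ⊗ hantip H (hmul H (hmul H (y ⊗ z) ⊗ h1))) ⊗ (hmul R (hantip R s ⊗ w) ⊗ h2))))))).
  apply: eq_sw => r1 r2; rewrite [RHS]sw_exchange.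
  rewrite (sw_morph (f := fun x => hmul T ((hantip T ⊠ \1)%VF x))); last by lin.
  apply: eq_sw => z w; rewrite [RHS]sw_exchange.
  rewrite (sw_morph (f := fun x => hmul T ((hantip T ⊠ \1)%VF x))); last by lin.
  apply: eq_sw => h1 h2; rewrite tensl_tens id_lfunE antipTE.
  rewrite (sw_morph (f := fun x => hmul T (x ⊗ _))); last by lin.
  by apply: eq_sw => y s; rewrite mulT_A mulT_jr (hopf_mulA hH).
rewrite -(coact_comul_sw (E3 := fun z s w => sw (hcomul H h) (fun h1 h2 =>
   hmul T ((hone R ⊗ hantip H (hmul H (z ⊗ h1))) ⊗ (hmul R (hantip R s ⊗ w) ⊗ h2))))); try by lin.
under eq_sw => z w do
  [rewrite (antipl_sw hR (F := fun x => sw (hcomul H h) (fun h1 h2 =>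
   hmul T ((hone R ⊗ hantip H (hmul H (z ⊗ h1))) ⊗ (x ⊗ h2))))); [|lin]].
rewrite (coact_counitR_sw (F := fun z => sw (hcomul H h) (fun h1 h2 =>
   hmul T ((hone R ⊗ hantip H (hmul H (z ⊗ h1))) ⊗ (hone R ⊗ h2))))); last by lin.
under eq_sw => h1 h2 do rewrite mulT_ih (hopf_mul1l hH).
rewrite (antipl_sw hH (F := fun x => hone R ⊗ x)); last by lin.
by rewrite scalerA counitTE.
Qed.

Lemma antipT_r x : hmul T ((\1 ⊠ hantip T)%VF (hcomul T x)) = (hcounit T x : k) *: hone T.
Proof.
move: x; apply: tens_ext; [lin | lin |] => r h.
rewrite comulTE (sw_morph (f := fun x => hmul T ((\1 ⊠ hantip T)%VF x))); last by lin.
transitivity (sw (hcomul R r) (fun r1 r2 => sw (coact B r2) (fun z w =>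
  sw (hcomul H (hmul H (z ⊗ h))) (fun h1 h2 =>
   hmul T ((r1 ⊗ hmul H (h1 ⊗ hantip H h2)) ⊗ (hantip R w ⊗ hone H)))))).
  apply: eq_sw => r1 r2.
  rewrite (sw_morph (f := fun x => hmul T ((\1 ⊠ hantip T)%VF x))); last by lin.
  under [RHS]eq_sw => z w do (rewrite comulM_sw; [|lin|lin]).
  rewrite (coactA_sw (fun z1 z2 w => sw (hcomul H h) (fun g1 g2 => 
     hmul T ((r1 ⊗ hmul H (hmul H (z1 ⊗ g1) ⊗ hantip H (hmul H (z2 ⊗ g2)))) ⊗ (hantip R w ⊗ hone H))))).
  apply: eq_sw => z w; rewrite [RHS]sw_exchange.
  rewrite (sw_morph (f := fun x => hmul T ((\1 ⊠ hantip T)%VF x))); last by lin.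
  apply: eq_sw => h1 h2; rewrite tensl_tens id_lfunE antipTE.
  rewrite (sw_morph (f := fun x => hmul T (_ ⊗ x))); last by lin.
  by apply: eq_sw => y s; rewrite -mulT_A mulT_ih.
under eq_sw => r1 r2 do under eq_sw => z w do
  [rewrite (antipr_sw hH (F := fun x => hmul T ((r1 ⊗ x) ⊗ (hantip R w ⊗ hone H)))) ?(hopf_counitM hH) ?mulT_jr; [|lin]].
transitivity (sw (hcomul R r) (fun r1 r2 => sw (coact B r2) (fun z w =>
  (hcounit H z : k) *: ((hcounit H h : k) *: (hmul R (r1 ⊗ hantip R w) ⊗ hone H))))).
  by apply: eq_sw => r1 r2; apply: eq_sw => z w; rewrite scalerA.
under eq_sw => r1 r2 do
  [rewrite (coact_counit_sw (F := fun w => (hcounit H h : k) *: (hmul R (r1 ⊗ hantip R w) ⊗ hone H))); [|lin]].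
rewrite (antipr_sw hR (F := fun x => (hcounit H h : k) *: (x ⊗ hone H))); last by lin.
by rewrite scalerA counitTE.
Qed.

(** Radford's theorem. *)
Theorem bosonization_is_hopf : is_hopf (bosonization H B R).
Proof.
split; [exact: mulT_A | exact: mulT_1l | exact: mulT_1r | exact: comulT_A
  | exact: counitT_l | exact: counitT_r | exact: comulT_M | exact: comulT_1
  | exact: counitT_M | exact: counitT_1 | exact: antipT_l | exact: antipT_r].
Qed.

End Radford.

(** * The dual of a Hopf algebra *)

Section Pairing.
Variable k : fieldType.
Implicit Types I J : finType.

(** The value at v of a functional f given on the dual basis. *)
Definition pr I (f v : vec k I) : k^o := \sum_i (f i : k) * v i.

Lemma pr_linearl I (v : vec k I) : is_linear (fun f => pr f v).
Proof.
move=> a f g; rewrite /pr scaler_sumr -big_split; apply: eq_bigr => i _.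
by rewrite !ffunE mulrDl; congr (_ + _); apply/esym/mulrA.
Qed.

Lemma pr_linearr I (f : vec k I) : is_linear (pr f).
Proof.
move=> a v w; rewrite /pr scaler_sumr -big_split; apply: eq_bigr => i _.
by rewrite !ffunE mulrDr; congr (_ + _); apply: mulrCA.
Qed.

#[local] Hint Resolve pr_linearl pr_linearr : core.

Lemma pr_bv I (f : vec k I) i : pr f (bv k i) = f i.
Proof.
rewrite /pr (bigD1 i) //= ffunE eqxx mulr1 big1 ?addr0 // => j ji.
by rewrite ffunE eq_sym (negPf ji) mulr0.
Qed.

Lemma pr_inj I (f g : vec k I) : pr f =1 pr g -> f = g.
Proof. by move=> fg; apply/ffunP => i; rewrite -!pr_bv fg. Qed.

Lemma pr_tens I J (f v : vec k I) (g w : vec k J) :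
  pr (f ⊗ g) (v ⊗ w) = (pr f v : k) * pr g w.
Proof.
rewrite /pr mulr_suml.
transitivity (\sum_i \sum_j ((f ⊗ g) (i, j) : k) * (v ⊗ w) (i, j)).
  by rewrite pair_bigA; apply: eq_bigr => -[].
apply: eq_bigr => i _; rewrite mulr_sumr; apply: eq_bigr => j _.
by rewrite !ffunE /= mulrACA.
Qed.

Lemma pr_inj2 I J (s t : vec k (I * J)) :
  (forall v w, pr s (v ⊗ w) = pr t (v ⊗ w)) -> s = t.
Proof. by move=> st; apply: pr_inj; apply: tens_ext => //; lin. Qed.

Lemma pr_transp I J (F : 'Hom(vec k I, vec k J)) f v :
  pr (transp F f) v = pr f (F v).
Proof.
rewrite [LHS](linear_vecE v) // [F v](linear_vecE (f := F)); last by lin.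
rewrite [RHS](linear_sumE _ _ _ (pr_linearr f)); apply: eq_bigr => i _.
rewrite (linear_scaleE _ _ (pr_linearr f)); congr (_ *: _).
rewrite pr_bv /transp linE sum_ffunE; apply: eq_bigr => j _.
by rewrite !ffunE.
Qed.

Lemma pr_tensl I J I' J' (F : 'Hom(vec k I, vec k I')) F'
    (G : 'Hom(vec k J, vec k J')) G' :
  (forall f v, pr (F f) v = pr f (F' v)) -> (forall f v, pr (G f) v = pr f (G' v)) ->
  forall t v w, pr ((F ⊠ G)%VF t) (v ⊗ w) = pr t (F' v ⊗ G' w).
Proof.
move=> FF GG t v w; move: t; apply: tens_ext; [lin | lin |] => f g.
by rewrite tensl_tens !pr_tens FF GG.
Qed.

End Pairing.

#[local] Hint Resolve pr_linearl pr_linearr : core.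

Section Dual.
Variables (k : fieldType) (I : finType) (H : hopf k I).
Hypothesis hH : is_hopf H.
Let D := hopf_dual H.

Lemma dual_mulE x y v : pr (hmul D (x ⊗ y)) v
  = sw (hcomul H v) (fun a b => (pr x a : k) *: pr y b).
Proof.
rewrite pr_transp {1}[hcomul H v]sw_id sw_morph //.
by apply: eq_sw => a b; rewrite pr_tens.
Qed.

Lemma dual_comulE x a b : pr (hcomul D x) (a ⊗ b) = pr x (hmul H (a ⊗ b)).
Proof. exact: pr_transp. Qed.

Lemma dual_oneE v : pr (hone D) v = hcounit H v.
Proof.
rewrite [RHS](linear_vecE (f := hcounit H)); last by lin.
by apply: eq_bigr => i _; rewrite ffunE; exact: mulrC.
Qed.

Lemma dual_counitE x : hcounit D x = pr x (hone H).
Proof. exact: linE. Qed.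

Lemma dual_antipE x v : pr (hantip D x) v = pr x (hantip H v).
Proof. exact: pr_transp. Qed.

Lemma dual_mul2E s t a b :
  pr (mul2 D (reidx k (fun p : I * I => (p.2, p.1))) (s ⊗ t)) (a ⊗ b)
  = sw (hcomul H a) (fun a1 a2 => sw (hcomul H b) (fun b1 b2 =>
      (pr s (a1 ⊗ b1) : k) *: pr t (a2 ⊗ b2))).
Proof.
move: s; apply: tens_ext; [lin | lin |] => x y.
move: t; apply: tens_ext; [lin | lin |] => z w.
rewrite mul2_tens pr_tens !dual_mulE.
rewrite -[LHS]/(_ *: (_ : k^o)) (sw_morph (f := fun c : k^o => (c : k) *: _)); last by lin.
apply: eq_sw => a1 a2; rewrite sw_morph; last by lin.
apply: eq_sw => b1 b2; rewrite !pr_tens; exact: mulrACA.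
Qed.

(** Paired with an arbitrary vector, each axiom of the dual is the axiom of H with
    the arrows reversed. *)
Theorem dual_is_hopf : is_hopf (hopf_dual H).
Proof.
split.
- move=> x y z; apply: pr_inj => v; rewrite !dual_mulE.
  under eq_sw => a b do [rewrite dual_mulE (sw_morph (f := fun c : k^o => (c : k) *: _)); [|lin]].
  under [RHS]eq_sw => a b do [rewrite dual_mulE sw_morph; [|lin]].
  rewrite (comulA_sw hH (fun a b c => (((pr x a : k) *: pr y b) : k) *: pr z c)).
  by apply: eq_sw => a b; apply: eq_sw => c d; rewrite scalerA.
- move=> x; apply: pr_inj => v; rewrite dual_mulE.
  under eq_sw => a b do rewrite dual_oneE.
  by rewrite (counitl_sw hH (F := pr x)).
- move=> x; apply: pr_inj => v; rewrite dual_mulE.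
  under eq_sw => a b do rewrite dual_oneE [_ *: _]mulrC.
  by rewrite (counitr_sw hH (F := pr x)).
- apply/lfunP => x; rewrite comp_lfunE comp_lfunE [RHS]comp_lfunE.
  apply: pr_inj2 => a t; move: t; apply: tens_ext; [lin | lin |] => b c.
  rewrite (@pr_tensl _ _ _ _ _ _ \1%VF _ (hmul H)); first last.
  + move=> f w; exact: pr_transp.
  + by move=> f w; rewrite !id_lfunE.
  transitivity (pr ((hcomul D ⊠ \1)%VF (hcomul D x)) (a ⊗ b ⊗ c)).
    move: {x}((hcomul D ⊠ \1)%VF (hcomul D x)).
    apply: tens_ext; [lin | lin |] => xy z; move: xy; apply: tens_ext; [lin | lin |] => x y.
    by rewrite assoc_tens !pr_tens mulrA.
  rewrite (@pr_tensl _ _ _ _ _ _ (hmul H) _ \1%VF); first last.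
  + by move=> f w; rewrite !id_lfunE.
  + move=> f w; exact: pr_transp.
  by rewrite !dual_comulE !id_lfunE (hopf_mulA hH).
- move=> x; apply: pr_inj => v; rewrite formlE.
  rewrite (sw_morph (f := fun f => pr f v)) //.
  transitivity (pr (hcomul D x) (hone H ⊗ v)).
    move: (hcomul D x) => t; rewrite [in RHS](sw_id t) (sw_morph (f := fun f => pr f _)) //.
    by apply: eq_sw => a b; rewrite pr_tens dual_counitE (linear_scaleE _ _ (pr_linearl v)).
  by rewrite dual_comulE (hopf_mul1l hH).
- move=> x; apply: pr_inj => v; rewrite formrE.
  rewrite (sw_morph (f := fun f => pr f v)) //.
  transitivity (pr (hcomul D x) (v ⊗ hone H)).
    move: (hcomul D x) => t; rewrite [in RHS](sw_id t) (sw_morph (f := fun f => pr f _)) //.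
    apply: eq_sw => a b; rewrite pr_tens dual_counitE (linear_scaleE _ _ (pr_linearl v)).
    exact: mulrC.
  by rewrite dual_comulE (hopf_mul1r hH).
- move=> x y; apply: pr_inj2 => a b.
  rewrite dual_comulE dual_mulE dual_mul2E (comulM_sw hH); [|lin|lin].
  by apply: eq_sw => a1 a2; apply: eq_sw => b1 b2; rewrite !dual_comulE.
- apply: pr_inj2 => a b; rewrite dual_comulE pr_tens !dual_oneE.
  exact: (hopf_counitM hH).
- move=> x y; rewrite !dual_counitE dual_mulE (hopf_comul1 hH) sw_tens //; lin.
- by rewrite dual_counitE dual_oneE (hopf_counit1 hH).
- move=> x; apply: pr_inj => v; rewrite pr_transp.
  rewrite dual_counitE (linear_scaleE _ _ (pr_linearl v)) dual_oneE.
  rewrite {1}[hcomul H v]sw_id sw_morph //.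
  transitivity (sw (hcomul H v) (fun a b => pr x (hmul H (hantip H a ⊗ b)))).
    apply: eq_sw => a b; rewrite (@pr_tensl _ _ _ _ _ _ (hantip H) _ \1%VF) ?dual_comulE ?id_lfunE //.
    + by move=> f w; rewrite dual_antipE.
    + by move=> f w; rewrite !id_lfunE.
  by rewrite (antipl_sw hH (pr_linearr x)); exact: mulrC.
- move=> x; apply: pr_inj => v; rewrite pr_transp.
  rewrite dual_counitE (linear_scaleE _ _ (pr_linearl v)) dual_oneE.
  rewrite {1}[hcomul H v]sw_id sw_morph //.
  transitivity (sw (hcomul H v) (fun a b => pr x (hmul H (a ⊗ hantip H b)))).
    apply: eq_sw => a b; rewrite (@pr_tensl _ _ _ _ _ _ \1%VF _ (hantip H)) ?dual_comulE ?id_lfunE //.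
    + by move=> f w; rewrite !id_lfunE.
    + by move=> f w; rewrite dual_antipE.
  by rewrite (antipr_sw hH (pr_linearr x)); exact: mulrC.
Qed.

End Dual.

(** * Subspaces of tensor products and gradings of the basis *)

Section Subspaces.
Variable k : fieldType.
Implicit Types I J : finType.

Definition coordf I (i : I) : 'Hom(vec k I, k^o) := lin (fun j => (i == j)%:R : k^o).

Lemma coordfE I (i : I) v : coordf i v = v i.
Proof.
rewrite /coordf linE (bigD1 i) //= eqxx big1 ?addr0; first exact: mulr1.
by move=> j ji; rewrite eq_sym (negPf ji); exact: mulr0.
Qed.

Lemma memv_tens I J (A : {vspace vec k I}) (B : {vspace vec k J}) u w :
  u \in A -> w \in B -> u ⊗ w \in tensv A B.
Proof.
move=> /coord_vbasis -> /coord_vbasis ->.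
rewrite tens_suml memv_suml // => i _; rewrite tens_sumr memv_suml // => j _.
rewrite tensZl tensZr !memvZ // memv_span //; apply/allpairsP.
exists ((vbasis A)`_i, (vbasis B)`_j); split => //.
  by apply: mem_nth; rewrite size_tuple.
by apply: mem_nth; rewrite size_tuple.
Qed.

Lemma tensv_ind I J (W : vectType k) (F : 'Hom(vec k (I * J), W))
    (A : {vspace vec k I}) (B : {vspace vec k J}) (U : {vspace W}) :
  (forall u w, u \in A -> w \in B -> F (u ⊗ w) \in U) -> (F @: tensv A B <= U)%VS.
Proof.
move=> FU; rewrite limg_span; apply/span_subvP => _ /mapP[_ /allpairsP[[u w] /= [uA wB ->]] ->].
by apply: FU; apply: vbasis_mem.
Qed.

Lemma forml_tens I J (phi : 'Hom(vec k I, k^o)) v (w : vec k J) :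
  forml J phi (v ⊗ w) = (phi v : k) *: w.
Proof. by rewrite formlE sw_tens //; lin. Qed.

Lemma formr_tens I J (psi : 'Hom(vec k J, k^o)) (v : vec k I) w :
  formr I psi (v ⊗ w) = (psi w : k) *: v.
Proof. by rewrite formrE sw_tens //; lin. Qed.

Lemma forml_coordf I J (i : I) (t : vec k (I * J)) j : forml J (coordf i) t j = t (i, j).
Proof.
rewrite formlE sum_ffunE (bigD1 (i, j)) //= big1 ?addr0 => [|[i' j'] ne].
  by rewrite coordfE !ffunE !eqxx scale1r; exact: mulr1.
rewrite coordfE !ffunE; case: eqP => [ii|_]; last by rewrite scale0r; exact: mulr0.
case: eqP => [jj|_]; last by rewrite scaler0; exact: mulr0.
by rewrite -ii -jj eqxx in ne.
Qed.

(** A tensor lies in A ⊗ B as soon as all its slices do: when t is the sum of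
    the a_i ⊗ b_i for a basis b_i of B, the a_i are slices.  This is what makes
    an intersection of subcoalgebras a subcoalgebra. *)
Lemma memv_tensP I J (A : {vspace vec k I}) (B : {vspace vec k J}) t :
  t \in tensv A B <->
  (forall phi, forml J phi t \in B) /\ (forall psi, formr I psi t \in A).
Proof.
split=> [tAB | [tB tA]].
  split=> phi.
    have /subvP : (forml J phi @: tensv A B <= B)%VS.
      by apply: tensv_ind => u w _ wB; rewrite forml_tens memvZ.
    by apply; apply: memv_img.
  have /subvP : (formr I phi @: tensv A B <= A)%VS.
    by apply: tensv_ind => u w uA _; rewrite formr_tens memvZ.
  by apply; apply: memv_img.
pose psi j : 'Hom(vec k J, k^o) := lin (fun y => coord (vbasis B) j (bv k y) : k^o).
have psiE j v : psi j v = coord (vbasis B) j v.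
  rewrite /psi linE {2}(vecE v) linear_sum; apply: eq_bigr => i _.
  by rewrite linearZ.
have -> : t = \sum_j formr I (psi j) t ⊗ (vbasis B)`_j.
  rewrite -[LHS](_ : \sum_i bv k i ⊗ forml J (coordf i) t = t); last first.
    apply/ffunP => -[i j]; rewrite sum_ffunE (bigD1 i) //= big1 ?addr0 => [|i' ne].
      by rewrite ffunE forml_coordf ffunE eqxx mul1r.
    by rewrite !ffunE (negPf ne) mul0r.
  have frE j : formr I (psi j) t = \sum_i (psi j (forml J (coordf i) t) : k) *: bv k i.
    rewrite formrE /sw.
    transitivity (\sum_i \sum_l (t (i, l) : k) *: ((psi j (bv k l) : k) *: bv k i)).
      by rewrite pair_bigA; apply: eq_bigr => -[].
    apply: eq_bigr => i _; rewrite [psi j _](linear_vecE (f := psi j)); last by lin.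
    rewrite scaler_suml; apply: eq_bigr => l _.
    by rewrite forml_coordf scalerA.
  transitivity (\sum_i \sum_j (psi j (forml J (coordf i) t) : k) *: (bv k i ⊗ (vbasis B)`_j)).
    apply: eq_bigr => i _; rewrite {1}(coord_vbasis (tB (coordf i))) tens_sumr.
    by apply: eq_bigr => j _; rewrite tensZr psiE.
  rewrite exchange_big; apply: eq_bigr => j _; rewrite frE tens_suml.
  by apply: eq_bigr => i _; rewrite tensZl.
apply: memv_suml => j _; apply: memv_tens => //.
by apply: vbasis_mem; apply: mem_nth; rewrite size_tuple.
Qed.

Definition cspan I (P : pred I) : {vspace vec k I} :=
  <<[seq bv k i | i <- enum P]>>%VS.

Lemma memv_cspan I (P : pred I) v : v \in cspan P <-> forall i, v i != 0 -> P i.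
Proof.
split=> [vP i | vP].
  rewrite -coordfE; apply: contraR => nPi.
  have /subvP/(_ _ (memv_img (coordf i) vP)) : (coordf i @: cspan P <= 0)%VS.
    rewrite limg_span; apply/span_subvP => _ /mapP[_ /mapP[j Pj ->] ->].
    rewrite memv0 coordfE ffunE; case: (j =P i) => [ij|_]; last by rewrite eqxx.
    by move: Pj; rewrite mem_enum ij unfold_in (negPf nPi).
  by rewrite memv0.
rewrite (vecE v) memv_suml // => i _; have [->|vi] := eqVneq (v i) 0.
  by rewrite scale0r mem0v.
rewrite memvZ // memv_span //; apply/mapP; exists i => //.
by rewrite mem_enum; apply: vP.
Qed.

Lemma bv_cspan I (P : pred I) i : P i -> bv k i \in cspan P.
Proof.
move=> Pi; apply/memv_cspan => j; rewrite ffunE; case: (i =P j) => [<- //|_].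
by rewrite eqxx.
Qed.

Lemma tensv_cspan I J (P : pred I) (Q : pred J) :
  tensv (cspan P) (cspan Q) = cspan (fun p => P p.1 && Q p.2).
Proof.
apply/eqP; rewrite eqEsubv; apply/andP; split; last first.
  apply/span_subvP => x /mapP[[i j]]; rewrite mem_enum => /andP[/= Pi Qj] ->.
  by rewrite -tens_bv; apply: memv_tens; apply: bv_cspan.
rewrite -[X in (X <= _)%VS]lim1g; apply: tensv_ind => u w /memv_cspan uP /memv_cspan wQ.
rewrite id_lfunE; apply/memv_cspan => -[i j]; rewrite ffunE mulf_eq0 negb_or.
by case/andP => /uP -> /wQ ->.
Qed.

Lemma cspanT I : cspan (fun _ : I => true) = fullv.
Proof. by apply/eqP; rewrite eqEsubv subvf; apply/subvP => v _; apply/memv_cspan. Qed.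

Lemma limg_cspan I (W : vectType k) (F : 'Hom(vec k I, W)) (P : pred I) (U : {vspace W}) :
  (forall i, P i -> F (bv k i) \in U) -> (F @: cspan P <= U)%VS.
Proof.
move=> FU; rewrite limg_span; apply/span_subvP => _ /mapP[_ /mapP[i iP ->] ->].
by apply: FU; rewrite mem_enum in iP.
Qed.

End Subspaces.

Section Grading.
Variable k : fieldType.
Implicit Types I J : finType.

Definition gr I (d : I -> nat) n := cspan k (fun i => d i == n).
Arguments gr {I} d n.

Definition bideg I J (d : I -> nat) (e : J -> nat) (p : I * J) := (d p.1 + e p.2)%N.

Lemma gr_directv I (d : I -> nat) n : directv (\sum_(i < n) gr d i)%VS.
Proof.
apply/directv_sum_independent => u uP su i _; apply/ffunP => j; rewrite ffunE.
apply/eqP; apply: contraT => uij; move/ffunP/(_ j): su.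
rewrite sum_ffunE ffunE (bigD1 i) //= big1 ?addr0 => [/eqP|l li].
  by rewrite (negPf uij).
have /memv_cspan/(_ j uij)/eqP dj := uP i isT.
apply/eqP; apply: contraT => ulj; have /memv_cspan/(_ j ulj)/eqP dl := uP l isT.
by move: li; rewrite -val_eqE /= -dl dj ?eqxx.
Qed.

Lemma gr_full I (d : I -> nat) n : (forall i, (d i < n)%N) -> (\sum_(i < n) gr d i)%VS = fullv.
Proof.
move=> dn; apply/eqP; rewrite eqEsubv subvf -cspanT; apply/span_subvP => _ /mapP[i _ ->].
apply: (subvP (sumv_sup (Ordinal (dn i)) _ (subvv _)) _) => //.
exact: bv_cspan.
Qed.

End Grading.

Arguments gr {k I} d n.

(** * Simple subcoalgebras of a graded coalgebra *)

Section Coradical.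
Variables (k : fieldType) (I : finType) (H : hopf k I).

Lemma subcoalgebra_formr (C : {vspace vec k I}) x psi :
  subcoalgebra H C -> x \in C -> formr I psi (hcomul H x) \in C.
Proof.
move=> /subvP subC /(memv_img (hcomul H))/subC/memv_tensP[_]; exact.
Qed.

Lemma subcoalgebra_forml (C : {vspace vec k I}) x phi :
  subcoalgebra H C -> x \in C -> forml I phi (hcomul H x) \in C.
Proof.
move=> /subvP subC /(memv_img (hcomul H))/subC/memv_tensP[]; by move=> + _; exact.
Qed.

Lemma subcoalgebra_cap (C D : {vspace vec k I}) :
  subcoalgebra H C -> subcoalgebra H D -> subcoalgebra H (C :&: D)%VS.
Proof.
move=> subC subD; apply/subvP => y /memv_imgP[x]; rewrite memv_cap => /andP[xC xD] ->.
apply/memv_tensP; split=> phi; rewrite memv_cap.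
  by rewrite !subcoalgebra_forml.
by rewrite !subcoalgebra_formr.
Qed.

(** If D has a nonzero element of degree 0 (the case n = 0 below), then by
    simplicity D is equal to its intersection with the subcoalgebra of degree 0.
    Otherwise let x be a nonzero element of D of least degree.  A coordinate
    functional of positive degree, applied to the left factor of the coproduct of
    x, gives an element of D of smaller degree, that is 0.  Hence the left
    factors have degree 0, and so has x, by the counit axiom: a contradiction. *)
Lemma simple_subcoalgebra_deg0 (d : I -> nat) (D : {vspace vec k I}) :
  (forall x, formr I (hcounit H) (hcomul H x) = x) ->
  (forall i, hcomul H (bv k i) \in gr (bideg d d) (d i)) ->
  simple_subcoalgebra H D -> (D <= gr d 0%N)%VS.
Proof.
move=> counitr homH [subD /eqP D0 simpleD].
pose F n := cspan k (fun i => (d i <= n)%N).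
have comul_supp n x p : x \in F n -> hcomul H x p != 0 -> (d p.1 + d p.2 <= n)%N.
  move=> /memv_cspan xF; rewrite [hcomul H x](linear_vecE (f := hcomul H)); last by lin.
  rewrite sum_ffunE => nz; rewrite leqNgt; apply: contra nz => np.
  rewrite big1 // => i _; rewrite ffunE.
  have [->|/xF di] := eqVneq (x i) 0; first by rewrite scale0r.
  have [->|/(proj1 (memv_cspan _ _) (homH i))/eqP e] := eqVneq (hcomul H (bv k i) p) 0.
    by rewrite scaler0.
  by move: np; rewrite -/(bideg d d p) e ltnNge di.
have exF : exists n, (D :&: F n != 0)%VS.
  exists (\max_i d i)%N; apply: contra D0; rewrite -!subv0 => /(subv_trans _); apply.
  rewrite subv_cap subvv; apply/subvP => x _; apply/memv_cspan => i _.
  exact: leq_bigmax.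
have subF0 : subcoalgebra H (F 0%N).
  rewrite /subcoalgebra tensv_cspan; apply/subvP => _ /memv_imgP[x xF ->].
  apply/memv_cspan => p /(comul_supp _ _ _ xF).
  by rewrite leqn0 addn_eq0 !leqn0.
have F0E : F 0%N = gr d 0%N.
  by apply/eqP; rewrite eqEsubv; apply/andP; split; apply/subvP => x /memv_cspan xd;
    apply/memv_cspan => i /xd; rewrite leqn0.
have [[|n] Dn minn] := ex_minnP exF.
  have [e|e] := simpleD _ (subcoalgebra_cap subD subF0) (capvSl _ _).
    by rewrite e eqxx in Dn.
  by rewrite -F0E -{1}e capvSr.
case/eqP: D0; apply/eqP; rewrite -subv0; apply: contraT => _.
have /eqP capn : (D :&: F n == 0)%VS.
  by apply: contraT => /minn; rewrite ltnn.
have xDF := memv_pick (D :&: F n.+1)%VS.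
have : vpick (D :&: F n.+1)%VS != 0 by rewrite vpick0.
move: (vpick _) xDF => x; rewrite memv_cap => /andP[xD xF] /negP[].
rewrite -memv0 -capn memv_cap xD /=.
apply/memv_cspan => i; rewrite -{1}(counitr x) formrE => nz.
rewrite leqNgt; apply: contra nz => di; rewrite sum_ffunE big1 // => -[i' j] _ /=.
rewrite !ffunE; have [ii|_] := eqVneq i' i; last by rewrite !scaler0.
have : forml I (coordf k i) (hcomul H x) \in (D :&: F n)%VS.
  rewrite memv_cap subcoalgebra_forml //; apply/memv_cspan => l.
  rewrite forml_coordf => /(comul_supp _ _ _ xF) /= dl.
  by rewrite -ltnS (leq_trans _ dl) // -addn1 addnC leq_add2r (leq_ltn_trans _ di).
rewrite capn memv0 => /eqP/ffunP/(_ j); rewrite forml_coordf ffunE ii => ->.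
by rewrite scale0r.
Qed.

End Coradical.

(** * Comatrix coalgebras *)

Section Comatrix.
Variables (k : fieldType) (I : finType) (H : hopf k I).

(** The family c spans a matrix coalgebra; the functionals phi witness that it is
    linearly independent. *)
Definition comatrix (X : finType) (c : X -> X -> vec k I) : Prop :=
  [/\ exists x : X, true,
      forall i j, hcomul H (c i j) = \sum_l c i l ⊗ c l j &
      exists phi : X -> X -> 'Hom(vec k I, k^o),
        forall a b i j, phi a b (c i j) = ((a == i) && (b == j))%:R].

Definition entries (X : finType) (c : X -> X -> vec k I) : seq (vec k I) :=
  [seq c p.1 p.2 | p <- enum {: X * X}].

(** If x has a nonzero coordinate at c_(a,d), then evaluating the left factor of
    the coproduct at c_(a,b), and after a second coproduct the right factor at
    c_(b',d), gives a nonzero multiple of c_(b,b'), for all b and b'. *)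
Lemma comatrix_simple (X : finType) (c : X -> X -> vec k I) : comatrix c ->
  simple_subcoalgebra H <<entries c>>%VS.
Proof.
move=> [[x0 _] Dc [phi phic]]; set C := span _.
have cC i j : c i j \in C.
  by apply: memv_span; apply/mapP; exists (i, j); rewrite ?mem_enum.
have CE x : x \in C -> x = \sum_i \sum_j (phi i j x : k) *: c i j.
  pose f x := \sum_i \sum_j (phi i j x : k) *: c i j.
  have fl : is_linear f.
    move=> a u v; rewrite /f scaler_sumr -big_split; apply: eq_bigr => i _.
    rewrite scaler_sumr -big_split; apply: eq_bigr => j _.
    by rewrite linearP scalerDl scalerA.
  move=> xC; rewrite -/(f x); rewrite (coord_span xC) linear_sumE //.
  apply: eq_bigr => i _; rewrite linear_scaleE //; congr (_ *: _).
  have /mapP[[a b] _ ->] : (entries c)`_i \in entries c by apply: mem_nth; rewrite size_map -cardE.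
  rewrite /f /= (bigD1 a) //= [X in _ + X]big1 ?addr0 => [|a' aa].
    rewrite (bigD1 b) //= big1 ?addr0 => [|b' bb]; first by rewrite phic !eqxx scale1r.
    by rewrite phic (negPf bb) andbF scale0r.
  by apply: big1 => b' _; rewrite phic (negPf aa) scale0r.
split.
- apply/subvP => _ /memv_imgP[x /CE -> ->].
  rewrite linear_sum memv_suml // => i _; rewrite linear_sum memv_suml // => j _.
  by rewrite linearZ memvZ //= Dc memv_suml // => l _; apply: memv_tens.
- move=> C0; have := phic x0 x0 x0 x0; have := cC x0 x0; rewrite C0 memv0 => /eqP ->.
  by rewrite linear0 !eqxx => /esym/eqP; rewrite oner_eq0.
- move=> D subD DC; have [->|] := eqVneq D 0%VS; first by left.
  rewrite -vpick0 => nz; right; apply/eqP; rewrite eqEsubv DC; apply/span_subvP.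
  move=> _ /mapP[[b b'] _ ->] /=; move: (vpick D) (memv_pick D) nz => x xD nz.
  have [[a d] nzad] : exists p, phi p.1 p.2 x != 0.
    apply/existsP; apply: contraNT nz; rewrite negb_exists => /forallP nz.
    rewrite (CE x (subvP DC _ xD)) big1 // => i _; apply: big1 => j _.
    by have /negPn/eqP -> := nz (i, j); rewrite scale0r.
  have yD := subcoalgebra_forml (phi a b) subD xD.
  have zD := subcoalgebra_formr (phi b' d) subD yD.
  suff zE : formr I (phi b' d) (hcomul H (forml I (phi a b) (hcomul H x)))
      = (phi a d x : k) *: c b b'.
    by move: zD; rewrite zE -[c b b' in X in _ -> X](scalerK nzad) => zD; apply: memvZ.
  have yE : forml I (phi a b) (hcomul H x) = \sum_j (phi a j x : k) *: c b j.
    rewrite {1}(CE x (subvP DC _ xD)) !linear_sum (bigD1 a) //= [X in _ + X]big1 ?addr0.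
      rewrite !linear_sum; apply: eq_bigr => j _; rewrite !linearZ /= Dc linear_sum.
      rewrite (bigD1 b) //= big1 ?addr0 => [|l lb]; rewrite forml_tens phic.
        by rewrite !eqxx scale1r.
      by rewrite eq_sym (negPf lb) andbF scale0r.
    move=> i ia; rewrite !linear_sum big1 // => j _; rewrite !linearZ /= Dc linear_sum big1 ?scaler0 //.
    by move=> l _; rewrite /= forml_tens phic eq_sym (negPf ia) scale0r.
  rewrite yE !linear_sum (bigD1 d) //= big1 ?addr0 => [|j jd]; rewrite !linearZ /= Dc linear_sum.
    congr (_ *: _); rewrite (bigD1 b') //= big1 ?addr0 => [|l lb]; rewrite formr_tens phic.
      by rewrite !eqxx scale1r.
    by rewrite eq_sym (negPf lb) scale0r.
  rewrite big1 ?scaler0 // => l _; rewrite /= formr_tens phic [d == j]eq_sym (negPf jd) andbF.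
  by rewrite scale0r.
Qed.

(** Every matrix coalgebra being simple, this says that the simple subcoalgebras
    of H span it.  Over an algebraically closed field all simple coalgebras are of
    this form, so that the definition is the usual one there. *)
Definition cosemisimple : Prop := forall W : {vspace vec k I},
  (forall (X : finType) (c : X -> X -> vec k I), comatrix c -> forall i j, c i j \in W) ->
  W = fullv.

End Comatrix.

Lemma comatrix_push (k : fieldType) (I J : finType) (H : hopf k I) (T : hopf k J)
    (f : 'Hom(vec k I, vec k J)) (g : 'Hom(vec k J, vec k I))
    (X : finType) (c : X -> X -> vec k I) :
  (forall h, g (f h) = h) -> (forall h, hcomul T (f h) = (f ⊠ f)%VF (hcomul H h)) ->
  comatrix H c -> comatrix T (fun i j => f (c i j)).
Proof.
move=> fK fD [X0 Dc [phi phic]]; split=> // [i j|].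
  rewrite fD Dc linear_sum; apply: eq_bigr => l _; exact: tensl_tens.
by exists (fun a b => phi a b \o g)%VF => a b i j; rewrite comp_lfunE fK phic.
Qed.

(** * The dual Chevalley property of a graded bosonization *)

Section GradedBosonization.
Variables (k : fieldType) (I J : finType) (H : hopf k I).
Variables (B : yd k I J) (R : hopf k J) (d : J -> nat).

(** The axioms of a grading, on the basis. *)
Record homogeneous : Prop := Homogeneous {
  homog_act : forall g j, act B (bv k (g, j)) \in gr d (d j);
  homog_coact : forall j, coact B (bv k j) \in gr (fun p => d p.2) (d j);
  homog_mul : forall i j, hmul R (bv k (i, j)) \in gr d (d i + d j)%N;
  homog_one : hone R \in gr d 0%N;
  homog_comul : forall i, hcomul R (bv k i) \in gr (bideg d d) (d i);
  homog_counit : forall i, (0 < d i)%N -> hcounit R (bv k i) = 0;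
  homog_antip : forall i, hantip R (bv k i) \in gr d (d i) }.

Hypothesis hd : homogeneous.

Lemma homogeneous_is_grading : is_grading B R (gr d).
Proof.
have tensT (K : finType) n : tensv fullv (gr d n) = gr (fun p : K * J => d p.2) n.
  by rewrite -cspanT tensv_cspan; apply/eqP; rewrite eqEsubv; apply/andP; split;
    apply/subvP => x /memv_cspan xP; apply/memv_cspan.
split.
- exists (\max_i d i).+1; split=> [||i ni]; first 1 last.
  + exact: gr_directv.
  + apply/eqP; rewrite -subv0; apply/span_subvP => x /mapP[j]; rewrite mem_enum => /eqP dj.
    by move: ni; rewrite -dj ltnNge leq_bigmax.
  + by apply: gr_full => i; rewrite ltnS leq_bigmax.
- move=> n; rewrite tensT; apply: limg_cspan => -[g j] /eqP /= <-; exact: homog_act.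
- move=> n; rewrite tensT; apply: limg_cspan => j /eqP /= <-; exact: homog_coact.
- move=> m n; rewrite tensv_cspan; apply: limg_cspan => -[i j] /andP[/eqP <- /eqP <-].
  exact: homog_mul.
- exact: homog_one.
- move=> n; apply: limg_cspan => j /eqP dj; have := homog_comul hd j.
  rewrite dj => /memv_cspan Dj; rewrite (vecE (hcomul R _)) memv_suml // => -[a b] _.
  have [->|/Dj/eqP ab] := eqVneq (hcomul R (bv k j) (a, b)) 0; first by rewrite scale0r mem0v.
  rewrite memvZ // -tens_bv; have an : (d a < n.+1)%N by rewrite ltnS -ab leq_addr.
  apply: (subvP (sumv_sup (Ordinal an) _ (subvv _)) _) => //.
  by apply: memv_tens; apply: bv_cspan => //=; rewrite -ab /bideg /= addKn.
- move=> n x n0 /memv_cspan xn; rewrite (linear_vecE (f := hcounit R)); last by lin.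
  rewrite big1 // => i _; have [->|/xn/eqP di] := eqVneq (x i) 0; first by rewrite scale0r.
  by rewrite homog_counit ?scaler0 ?di.
- by move=> n; apply: limg_cspan => j /eqP <-; exact: homog_antip.
Qed.

Hypotheses (hH : is_hopf H) (hB : is_yd_hopf H B R).
Variable r0 : J.
Hypotheses (one_r0 : hone R = bv k r0) (deg0 : forall j, d j = 0%N -> j = r0).

Let T := bosonization H B R.
Let dT (p : J * I) := d p.1.

Lemma sw_gr (A C : finType) (W : vectType k) (U : {vspace W}) (e : A * C -> nat) n (t : vec k (A * C)) E :
  t \in gr e n -> (forall i j, e (i, j) = n -> E (bv k i) (bv k j) \in U) -> sw t E \in U.
Proof.
move=> /memv_cspan tn EU; rewrite memv_suml // => -[i j] _ /=.
have [->|/tn/eqP eij] := eqVneq (t (i, j)) 0; first by rewrite scale0r mem0v.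
by rewrite memvZ // EU.
Qed.

Lemma comulT_homog p : hcomul T (bv k p) \in gr (bideg dT dT) (dT p).
Proof.
case: p => r h; rewrite -tens_bv comulTE.
apply: (sw_gr (homog_comul hd r)) => r1 r2 dr.
apply: (sw_gr (homog_coact hd r2)) => z w dw.
rewrite memv_suml // => -[h1 h2] _; rewrite memvZ //.
apply/memv_cspan => -[[a b] [a' b']]; rewrite !ffunE !mulf_eq0 !negb_or /=.
rewrite /bideg /dT /=.
case: (r1 =P a) => [<-|_]; last by rewrite eqxx.
case: (w =P a') => [<-|_]; last by rewrite eqxx !andbF.
by move=> _; rewrite -dr /bideg /= -dw.
Qed.

Lemma antipR1 : hantip R (hone R) = hone R.
Proof.
have hR := ydh_hopf hB; have := hopf_antipl hR (hone R).
rewrite (hopf_comul1 hR) tensl_tens id_lfunE (hopf_mul1r hR) => ->.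
by rewrite (hopf_counit1 hR) scale1r.
Qed.

(** The coradical is the copy of H in degree 0: it contains the simple
    subcoalgebras by a degree argument, and it is contained in their sum because
    the matrix coalgebras of H remain matrix coalgebras in the bosonization. *)
Theorem bosonization_dual_chevalley : cosemisimple H -> dual_chevalley T.
Proof.
move=> ssH; have hT := bosonization_is_hopf hH hB.
pose i : 'Hom(vec k I, vec k (J * I)) := lin (fun g => hone R ⊗ bv k g).
have iE h : i h = hone R ⊗ h.
  rewrite /i linE [RHS](linear_vecE (f := fun t => hone R ⊗ t)) //; lin.
have iC h : i h \in limg i by apply: memv_img; apply: memvf.
have CP x : x \in limg i -> exists h, x = i h by case/memv_imgP => h _ ->; exists h.
have iD h : hcomul T (i h) = (i ⊠ i)%VF (hcomul H h).
  rewrite iE (comulT_ih hH hB) [(i ⊠ i)%VF _]sw_lfun.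
  by apply: eq_sw => a b; rewrite tensl_tens !iE.
have subC : subcoalgebra T (limg i).
  apply/subvP => _ /memv_imgP[_ /CP[h ->] ->]; rewrite iD [(i ⊠ i)%VF _]sw_lfun.
  by rewrite memv_suml // => p _; rewrite memvZ // tensl_tens memv_tens.
exists (limg i); split; split.
- move=> D /(simple_subcoalgebra_deg0 (hopf_counitr hT) comulT_homog) /subv_trans; apply.
  apply/span_subvP => x /mapP[[r h]]; rewrite mem_enum => /eqP/deg0 /= -> ->.
  by rewrite -tens_bv -one_r0 -iE.
- move=> W simpleW; have : (i @^-1: W)%VS = fullv.
    apply: ssH => X c cc a b; rewrite -memv_preim.
    pose g : 'Hom(vec k (J * I), vec k I) := forml I (hcounit R).
    have gK h : g (i h) = h.
      by rewrite iE /g forml_tens (hopf_counit1 (ydh_hopf hB)) scale1r.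
    have /comatrix_simple/simpleW/subvP := comatrix_push gK iD cc; apply.
    by apply: memv_span; apply/mapP; exists (a, b); rewrite ?mem_enum.
  by move=> e; apply/subvP => x /CP[h ->]; rewrite memv_preim e memvf.
- by have := iC (hone H); rewrite iE.
- apply: tensv_ind => _ _ /CP[h ->] /CP[f ->]; rewrite !iE.
  by rewrite (mulT_ih hH hB) -iE.
- exact: subC.
- apply/subvP => _ /memv_imgP[_ /CP[h ->] ->]; rewrite iE antipTE.
  rewrite (ydh_one_coact hB) sw_tens; [|lin|lin].
  by rewrite (hopf_mul1l hH) antipR1 (mulT_1r hH hB) -iE.
Qed.

End GradedBosonization.

(** * The Yetter-Drinfeld condition without the antipode *)

Section FreeCompat.
Variables (k : fieldType) (I J : finType) (H : hopf k I) (hH : is_hopf H) (V : yd k I J).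

(** The form of the Yetter-Drinfeld condition without the antipode,
    h_(1) v_(-1) ⊗ h_(2) v_(0) = (h_(1) v)_(-1) h_(2) ⊗ (h_(1) v)_(0),
    is easier to check on a basis; multiplying by S(h_(3)) gives the other one. *)
Lemma yd_compat_of_free :
  (forall h v,
    sw (hcomul H h) (fun h1 h2 => sw (coact V (act V (h1 ⊗ v)))
      (fun z w => hmul H (z ⊗ h2) ⊗ w))
    = sw (hcomul H h) (fun h1 h2 => sw (coact V v)
      (fun z w => hmul H (h1 ⊗ z) ⊗ act V (h2 ⊗ w)))) ->
  forall h v, coact V (act V (h ⊗ v)) = yd_twist H V (h ⊗ v).
Proof.
move=> free h v; rewrite yd_twistE.
pose G x t : vec k (I * J) := sw t (fun z w => hmul H (z ⊗ x) ⊗ w).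
have Gl x : is_linear (G x) by rewrite /G; lin.
transitivity (sw (hcomul H h) (fun h' h3 => sw (hcomul H h') (fun h1 h2 =>
   sw (coact V (act V (h1 ⊗ v))) (fun z w => hmul H (z ⊗ hmul H (h2 ⊗ hantip H h3)) ⊗ w)))).
  rewrite (comulA_sw hH (fun h1 h2 h3 => sw (coact V (act V (h1 ⊗ v)))
    (fun z w => hmul H (z ⊗ hmul H (h2 ⊗ hantip H h3)) ⊗ w))).
  transitivity (sw (hcomul H h) (fun h1 x => (hcounit H x : k) *: coact V (act V (h1 ⊗ v)))).
    by rewrite (counitr_sw hH (F := fun x => coact V (act V (x ⊗ v)))) //; lin.
  apply: eq_sw => h1 x.
  rewrite (antipr_sw hH (F := fun y => sw (coact V (act V (h1 ⊗ v))) (fun z w => hmul H (z ⊗ y) ⊗ w))); last by lin.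
  congr (_ *: _); rewrite {1}[coact V _]sw_id; apply: eq_sw => z w.
  by rewrite (hopf_mul1r hH).
apply: eq_sw => h' h3.
have := congr1 (G (hantip H h3)) (free h' v).
rewrite !(sw_morph _ _ (Gl _)) => e.
transitivity (sw (hcomul H h') (fun x y =>
       G (hantip H h3) (sw (coact V (act V (x ⊗ v))) (fun z w : vec k _ => hmul H (z ⊗ y) ⊗ w)))).
  apply: eq_sw => h1 h2; rewrite (sw_morph _ _ (Gl _)); apply: eq_sw => z w.
  by rewrite /G sw_tens; [rewrite (hopf_mulA hH) | lin | lin].
rewrite e; apply: eq_sw => h1 h2; rewrite (sw_morph _ _ (Gl _)); apply: eq_sw => z w.
by rewrite /G sw_tens //; lin.
Qed.

End FreeCompat.

(** * Signs and characters *)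

Section Signs.

Definition sg (y : 'Z_2) (b : 'Z_3) : 'Z_3 := if y == 0 then b else - b.
(** The product n b, with n read as the integer 0 or 1. *)
Definition sh (n : 'Z_2) (b : 'Z_3) : 'Z_3 := if n == 0 then 0 else b.

Lemma Z2P (y : 'Z_2) : y = 0 \/ y = 1.
Proof. by case: y => [[|[|//]] ?]; [left | right]; apply: val_inj. Qed.

Lemma Z2D11 : 1 + 1 = 0 :> 'Z_2. Proof. exact: val_inj. Qed.
Lemma Z2N (y : 'Z_2) : - y = y. Proof. by case: (Z2P y) => ->; apply: val_inj. Qed.
Lemma Z3D (b : 'Z_3) : b + b = - b.
Proof. by apply/eqP; rewrite eq_sym -subr_eq0 -opprD oppr_eq0; case: b => [[|[|[|//]]] ?]; apply/eqP/val_inj. Qed.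

Lemma sg0 b : sg 0 b = b. Proof. by []. Qed.
Lemma sg1 b : sg 1 b = - b. Proof. by []. Qed.
Lemma sgK y : involutive (sg y).
Proof. by move=> b; case: (Z2P y) => ->; rewrite !(sg0, sg1) ?opprK. Qed.
Lemma sgD y b c : sg y (b + c) = sg y b + sg y c.
Proof. by case: (Z2P y) => ->; rewrite !(sg0, sg1) ?opprD. Qed.
Lemma sg00 y : sg y 0 = 0. Proof. by rewrite /sg oppr0 if_same. Qed.
Lemma sgN y b : sg y (- b) = - sg y b.
Proof. by rewrite /sg; case: ifP. Qed.
Lemma sgA y z b : sg (y + z) b = sg y (sg z b).
Proof. by case: (Z2P y) => ->; case: (Z2P z) => ->; rewrite ?(add0r, addr0) ?Z2D11 !(sg0, sg1) ?opprK. Qed.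
Lemma sh0 b : sh 0 b = 0. Proof. by []. Qed.
Lemma sh1 b : sh 1 b = b. Proof. by []. Qed.
Lemma sh00 n : sh n 0 = 0. Proof. by rewrite /sh if_same. Qed.
Lemma sg_sh y n b : sg y (sh n b) = sh n (sg y b).
Proof. by rewrite /sh; case: ifP => // _; rewrite sg00. Qed.
Lemma shD n m b : sh (n + m) b = sh n b + sh m (sg n b).
Proof.
case: (Z2P n) => ->; case: (Z2P m) => ->;
  by rewrite ?(add0r, addr0) ?Z2D11 !(sg0, sg1, sh0, sh1) ?(add0r, addr0) ?subrr.
Qed.
Lemma sg_sub n b : sg n b = b + sh n b.
Proof. by case: (Z2P n) => ->; rewrite !(sg0, sg1, sh0, sh1) ?addr0 ?Z3D. Qed.

Lemma nactE g y : nact g y = (g.1, sg y g.2).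
Proof. by rewrite /nact /sg; case: ifP => // _; case: g. Qed.

Lemma nsubK (g s : N18) : nadd s (nadd g (nopp s)) = g.
Proof. by rewrite !naddE noppE addrC subrK. Qed.

Lemma nsub_eq (g s t : N18) : (nadd g (nopp s) == t) = (g == nadd s t).
Proof. by rewrite !naddE noppE subr_eq addrC. Qed.

End Signs.

Section Chi.
Variables (k : fieldType) (xi : k) (xi3 : xi ^+ 3 = 1).

Definition chi (a : 'Z_3) : k := xi ^+ a.

Lemma chi0 : chi 0 = 1. Proof. by []. Qed.
Lemma chiD a b : chi (a + b) = chi a * chi b.
Proof. by rewrite /chi -exprD; apply: xiE => //; rewrite modn_mod. Qed.
Lemma chiM (a b : 'Z_3) : xi ^+ (a * b)%N = chi (a * b).
Proof. by rewrite /chi; apply: xiE => //; rewrite modn_mod. Qed.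

Lemma tauE s t y : tau xi s t y = chi (sh y (s.2 * t.1)).
Proof. by rewrite /tau /sh; case: ifP => // _; rewrite chiM. Qed.

End Chi.

Section CspanExt.
Variables (k : fieldType) (I : finType) (W : lmodType k).

Lemma cspan_ext (P : pred I) (f g : vec k I -> W) : is_linear f -> is_linear g ->
  (forall i, P i -> f (bv k i) = g (bv k i)) -> forall v, v \in cspan k P -> f v = g v.
Proof.
move=> fl gl fg v /memv_cspan vP; rewrite (linear_vecE v fl) (linear_vecE v gl).
apply: eq_bigr => i _; have [->|/vP/fg -> //] := eqVneq (v i) 0.
by rewrite !scale0r.
Qed.

Lemma vec_ext (f g : vec k I -> W) : is_linear f -> is_linear g ->
  (forall i, f (bv k i) = g (bv k i)) -> f =1 g.
Proof.
by move=> fl gl fg v; rewrite (linear_vecE v fl) (linear_vecE v gl); apply: eq_bigr => i _; rewrite fg.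
Qed.

End CspanExt.

(** * Yetter-Drinfeld data *)

(** With the laws below, this is a Yetter-Drinfeld module over the group algebra
    of S_3: a basis vector of parity n and weight w has degree r^w s^n, where r is
    a rotation and s a reflection, X is the action of s and W_b that of r^(-b).
    Only the tensor product [dtens] is not that of S_3. *)
Record datum (k : fieldType) (J : finType) := Datum {
  par : J -> 'Z_2;
  wt : J -> 'Z_3;
  dX : 'Z_2 -> 'Hom(vec k J, vec k J);
  dW : 'Z_3 -> 'Hom(vec k J, vec k J) }.

Arguments datum k J%_type_scope.

Definition dcomp (k : fieldType) (J : finType) (D : datum k J) n w : {vspace vec k J} :=
  cspan k (fun j => (par D j == n) && (wt D j == w)).

Record datum_laws (k : fieldType) (J : finType) (D : datum k J) : Prop := DatumLaws {
  dX0 : forall v, dX D 0 v = v;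
  dXD : forall y z v, dX D (y + z) v = dX D y (dX D z v);
  dW0 : forall v, dW D 0 v = v;
  dWD : forall a b v, dW D (a + b) v = dW D a (dW D b v);
  dXW : forall y b v, dX D y (dW D b v) = dW D (sg y b) (dX D y v);
  dX_comp : forall y j, dX D y (bv k j) \in dcomp D (par D j) (sg y (wt D j));
  dW_comp : forall b j, dW D b (bv k j) \in dcomp D (par D j) (wt D j + sh (par D j) b) }.

Section Data.
Variables (k : fieldType) (J K : finType) (D : datum k J) (E : datum k K).

(** The common form of the tensor products over A and over its dual
    ([yd_A_tens], [yd_D_tens]); the sign change of b after an odd factor comes from
    the action of x on N. *)
Definition dtens : datum k (J * K) := Datum
  (fun p => par D p.1 + par E p.2) (fun p => wt D p.1 + wt E p.2)
  (fun y => dX D y ⊠ dX E y)%VF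
  (fun b => lin (fun p => dW D b (bv k p.1) ⊗ dW E (sg (par D p.1) b) (bv k p.2))).

Record dmorph (f : 'Hom(vec k J, vec k K)) : Prop := Dmorph {
  dmorph_comp : forall j, f (bv k j) \in dcomp E (par D j) (wt D j);
  dmorph_X : forall y j, f (dX D y (bv k j)) = dX E y (f (bv k j));
  dmorph_W : forall b j, f (dW D b (bv k j)) = dW E b (f (bv k j)) }.

End Data.

(** * Modules over A *)

Section OverA.
Variables (k : fieldType) (xi : k) (xi3 : xi ^+ 3 = 1).
Notation A := (A18 xi).

Lemma A_comulE g y : hcomul A (bv k (g, y)) =
  \sum_s chi xi (sh y (s.2 * (g.1 - s.1))) *: (bv k (s, y) ⊗ bv k (nadd g (nopp s), y)).
Proof. by rewrite A_comul; apply: eq_bigr => s _; rewrite tauE. Qed.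

(** The element e_g of k^N acts as the projection onto the vectors of weight j,
    for g = b^j, and as 0 when g is not a power of b; the group element x acts as
    X.  The coaction is dual to this, with parity for the x-component, W for the
    b-component of N and the character a^i |-> xi^(i w) for its a-component. *)
Definition yd_A (J : finType) (D : datum k J) : yd k A18_basis J :=
  {| act := lin (fun p : A18_basis * J =>
       (p.1.1 == (0, sg p.1.2 (wt D p.2)))%:R *: dX D p.1.2 (bv k p.2));
     coact := lin (fun j : J => \sum_(r : N18)
       chi xi (r.1 * wt D j) *: (bv k (r, par D j) ⊗ dW D r.2 (bv k j))) |}.

Section Formulas.
Variables (J : finType) (D : datum k J).

Lemma actA_E g y n w v : v \in dcomp D n w ->
  act (yd_A D) (bv k (g, y) ⊗ v) = (g == (0, sg y w))%:R *: dX D y v.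
Proof.
apply: (cspan_ext (f := fun v => act (yd_A D) (bv k (g, y) ⊗ v))
  (g := fun v => (g == (0, sg y w))%:R *: dX D y v)); [lin | lin |] => j /andP[_ /eqP <-].
by rewrite tens_bv lin_bv.
Qed.

Lemma coactA_E n w v : v \in dcomp D n w ->
  coact (yd_A D) v = \sum_r chi xi (r.1 * w) *: (bv k (r, n) ⊗ dW D r.2 v).
Proof.
apply: (cspan_ext (f := coact (yd_A D))
  (g := fun v => \sum_r chi xi (r.1 * w) *: (bv k (r, n) ⊗ dW D r.2 v))); first by lin.
  move=> c u t; rewrite scaler_sumr -big_split; apply: eq_bigr => r _ /=.
  have l : is_linear (fun t => chi xi (r.1 * w) *: (bv k (r, n) ⊗ dW D r.2 t)) by lin.
  exact: l.
by move=> j /andP[/eqP <- /eqP <-]; rewrite lin_bv.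
Qed.

Lemma comp_bv j : bv k j \in dcomp D (par D j) (wt D j).
Proof. by apply: bv_cspan; rewrite !eqxx. Qed.

End Formulas.

#[local] Opaque A18 yd_A.

Section YD.
Variables (J : finType) (D : datum k J) (lD : datum_laws D).

Lemma dX_comp_v y n w v : v \in dcomp D n w -> dX D y v \in dcomp D n (sg y w).
Proof.
move=> vD; suff /subvP : (dX D y @: dcomp D n w <= dcomp D n (sg y w))%VS by apply; exact: memv_img.
apply: limg_cspan => j /andP[/eqP <- /eqP <-]; exact: (dX_comp lD).
Qed.

Lemma dW_comp_v b n w v : v \in dcomp D n w -> dW D b v \in dcomp D n (w + sh n b).
Proof.
move=> vD; suff /subvP : (dW D b @: dcomp D n w <= dcomp D n (w + sh n b)%R)%VS by apply; exact: memv_img.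
apply: limg_cspan => j /andP[/eqP <- /eqP <-]; exact: (dW_comp lD).
Qed.

Let hA := A18_is_hopf xi3.

Lemma actA_actA g y h z j :
  act (yd_A D) (bv k (g, y) ⊗ act (yd_A D) (bv k (h, z) ⊗ bv k j))
  = act (yd_A D) (hmul A (bv k (g, y) ⊗ bv k (h, z)) ⊗ bv k j).
Proof.
have vj := comp_bv D j; have Xj := dX_comp_v z vj.
rewrite (A_mul xi) tensZl linearZ /= !(actA_E _ _ vj) tensZr linearZ /= (actA_E _ _ Xj).
rewrite !scalerA -!natrM !mulnb (dXD lD) sgA; congr (_%:R *: _); congr nat_of_bool.
case: (g =P (0, _)) => [->|_]; last by rewrite !andbF.
by rewrite !andbT nactE /= sgK eq_sym.
Qed.

Lemma coactA_coassoc : (assoc k _ _ _ \o (hcomul A ⊠ \1) \o coact (yd_A D)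
               = (\1 ⊠ coact (yd_A D)) \o coact (yd_A D))%VF.
Proof.
apply: hom_ext => j; rewrite !comp_lfunE (coactA_E (comp_bv D j)).
move: (bv k j) (comp_bv D j) => v; move: (par D j) (wt D j) => n w vD.
rewrite !linear_sum /=.
transitivity (\sum_(s : N18) \sum_(r : N18)
   (chi xi (r.1 * w) * chi xi (sh n (s.2 * (r.1 - s.1)))) *:
     (bv k (s, n) ⊗ (bv k (nadd r (nopp s), n) ⊗ dW D r.2 v))).
  rewrite exchange_big; apply: eq_bigr => r _; rewrite !linearZ /= tensl_tens id_lfunE A_comulE.
  rewrite tens_suml linear_sum scaler_sumr; apply: eq_bigr => s _ /=.
  by rewrite tensZl linearZ /= assoc_tens scalerA.
apply: eq_bigr => s _; rewrite !linearZ /= tensl_tens id_lfunE (coactA_E (dW_comp_v s.2 vD)).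
rewrite tens_sumr scaler_sumr (reindex_inj (h := nadd s)) /=; last first.
  by move=> v1 v2; rewrite !naddE => /addrI.
apply: eq_bigr => t _; rewrite tensZr scalerA -!(chiD xi3) addrC.
have -> : nadd (nadd s t) (nopp s) = t by rewrite !naddE noppE addrAC subrr add0r.
rewrite [dW D _ v](_ : _ = dW D t.2 (dW D s.2 v)); last by rewrite -(dWD lD) addrC.
congr (chi _ _ *: _); rewrite /= addrAC subrr add0r.
rewrite mulrDl mulrDr addrC -addrA; congr (_ + (_ + _)).
by case: (Z2P n) => ->; rewrite !(sh0, sh1) ?mulr0 // mulrC.
Qed.

(** Both sides are supported on s = (0, wt (X_y v)) and on r = s y respectively,
    and what is left is an identity between exponents of xi modulo 3. *)
Lemma coactA_compat g y j :
    sw (hcomul A (bv k (g, y))) (fun h1 h2 => sw (coact (yd_A D) (act (yd_A D) (h1 ⊗ bv k j)))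
      (fun z w => hmul A (z ⊗ h2) ⊗ w))
    = sw (hcomul A (bv k (g, y))) (fun h1 h2 => sw (coact (yd_A D) (bv k j))
      (fun z w => hmul A (h1 ⊗ z) ⊗ act (yd_A D) (h2 ⊗ w))).
Proof.
move: (bv k j) (comp_bv D j) => v; move: (par D j) (wt D j) => n w vD.
have Xv := dX_comp_v y vD.
rewrite A_comulE ![sw (\sum_s _) _](linear_sumE _ _ _ (sw_linear _)).
pose e : N18 := (0, sg y w).
transitivity (\sum_(s : N18) \sum_(r : N18)
   (chi xi (sh y (s.2 * (g.1 - s.1))) * ((s == e)%:R * (chi xi (r.1 * sg y w)
     * (nact r n == nadd g (nopp s))%:R))) *: (bv k (r, n + y) ⊗ dW D r.2 (dX D y v))).
  apply: eq_bigr => s _; rewrite (linear_scaleE _ _ (sw_linear _)).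
  rewrite sw_tens; [|lin|lin].
  rewrite (actA_E _ _ vD) linearZ /= (linear_scaleE _ _ (sw_linear _)) (coactA_E Xv).
  rewrite (linear_sumE _ _ _ (sw_linear _)) !scaler_sumr; apply: eq_bigr => r _.
  rewrite (linear_scaleE _ _ (sw_linear _)) sw_tens; [|lin|lin].
  by rewrite (A_mul xi) tensZl !scalerA -!mulrA.
rewrite (bigD1 e) //= [X in _ + X]big1 ?addr0 => [|s /negPf se]; last first.
  by rewrite se big1 // => r _; rewrite mul0r mulr0 scale0r.
apply: eq_bigr => s _; rewrite (linear_scaleE _ _ (sw_linear _)).
rewrite sw_tens; [|lin|lin].
rewrite (coactA_E vD) (linear_sumE _ _ _ (sw_linear _)).
rewrite (bigD1 (nact s y)) //= big1 ?addr0 => [|r rs]; last first.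
  rewrite (linear_scaleE _ _ (sw_linear _)) sw_tens; [|lin|lin].
  by rewrite (A_mul xi) eq_sym (negPf rs) scale0r tens0l ?scaler0.
rewrite (linear_scaleE _ _ (sw_linear _)) sw_tens; [|lin|lin].
rewrite (A_mul xi) [nact s y == _]eqxx scale1r (nactE s y) /= (actA_E _ _ (dW_comp_v _ vD)) tensZr !scalerA.
rewrite (dXW lD) sgK [y + n]addrC eqxx mul1r -!mulrA.
have -> : (nact s n == nadd g (nopp e)) = (nadd g (nopp s) == (0, sg y (w + sh n (sg y s.2)))).
  rewrite nsub_eq [LHS]eq_sym nsub_eq; congr (_ == _); rewrite nactE /e /nadd /=.
  by rewrite addr0 add0r sgD sg_sh sgK (sg_sub n) addrCA.
case: eqP => [ge|_]; last by rewrite !mulr0.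
rewrite !mulr1; congr (_ *: _); rewrite -!(chiD xi3); congr (chi _ _).
have {}ge : g = nadd s (0, sg y (w + sh n (sg y s.2))) by rewrite -ge nsubK.
rewrite ge /e /nadd /= addr0 subrr mulr0 sh00 add0r subr0.
case: (Z2P y) => ->; rewrite !(sh0, sh1, sg0, sg1) ?add0r //.
by rewrite mulrN mulNr mulrC -opprD Z3D opprK.
Qed.

Lemma yd_A_is_yd : is_yd A (yd_A D).
Proof.
split.
- move=> g h v; move: g; apply: vec_ext; [lin | lin |] => -[g y].
  move: h; apply: vec_ext; [lin | lin |] => -[h z].
  by move: v; apply: vec_ext; [lin | lin |] => j; exact: actA_actA.
- apply: vec_ext; [lin | lin |] => j; rewrite A_one tens_suml linear_sum.
  rewrite (bigD1 (0, wt D j)) //= big1 ?addr0 => [|g g0];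
    rewrite (actA_E _ _ (comp_bv D j)) sg0.
    by rewrite eqxx scale1r (dX0 lD).
  by rewrite (negPf g0) scale0r.
- exact: coactA_coassoc.
- apply: vec_ext; [lin | lin |] => j; rewrite (coactA_E (comp_bv D j)) linear_sum.
  rewrite (bigD1 nzero) //= big1 ?addr0 => [|g g0];
    rewrite linearZ /= forml_tens A_counit.
    by rewrite mul0r chi0 eqxx !scale1r (dW0 lD).
  by rewrite (negPf g0) scale0r scaler0.
- apply: (yd_compat_of_free hA) => h v.
  move: h; apply: vec_ext; [lin | lin |] => -[g y].
  move: v; apply: vec_ext; [|lin|] => [|j]; last exact: coactA_compat.
  by apply: is_linear_swr => a b; lin.
Qed.

End YD.

Section YDMorphisms.
Variables (J K : finType) (D : datum k J) (E : datum k K).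

Lemma yd_A_morphism (f : 'Hom(vec k J, vec k K)) :
  dmorph D E f -> yd_morphism (yd_A D) (yd_A E) f.
Proof.
move=> [fc fX fW]; split=> [h v|].
  move: h; apply: vec_ext; [lin | lin |] => -[g y].
  move: v; apply: vec_ext; [lin | lin |] => j.
  by rewrite (actA_E _ _ (comp_bv D j)) (actA_E _ _ (fc j)) linearZ /= fX.
apply: vec_ext; [lin | lin |] => j.
rewrite (coactA_E (comp_bv D j)) (coactA_E (fc j)) linear_sum; apply: eq_bigr => r _.
by rewrite linearZ /= tensl_tens id_lfunE fW.
Qed.

Lemma yd_A_tens : yd_tens A (yd_A D) (yd_A E) = yd_A (dtens D E).
Proof.
have comp_ij i j : bv k (i, j) \in dcomp (dtens D E) (par D i + par E j) (wt D i + wt E j).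
  exact: comp_bv.
have eact : act (yd_tens A (yd_A D) (yd_A E)) = act (yd_A (dtens D E)).
  apply: hom_ext => -[[g y] [i j]].
  rewrite -(tens_bv _ (g, y) (i, j)) (actA_E _ _ (comp_ij i j)) -(tens_bv _ i j) yd_tens_actE.
  rewrite A_comulE (linear_sumE _ _ _ (sw_linear _)).
  rewrite (bigD1 (0, sg y (wt D i))) //= big1 ?addr0 => [|s s0];
    rewrite (linear_scaleE _ _ (sw_linear _)) sw_tens; try by lin.
    rewrite (actA_E _ _ (comp_bv D i)) (actA_E _ _ (comp_bv E j)) eqxx scale1r.
    rewrite tensZr scalerA tensl_tens nsub_eq /nadd /= addr0 -sgD; case: eqP => [->|_].
      by rewrite subr0 mulr0 sh00 chi0 mul1r.
    by rewrite mulr0.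
  by rewrite (actA_E _ _ (comp_bv D i)) (negPf s0) scale0r tens0l ?scaler0.
have ecoact : coact (yd_tens A (yd_A D) (yd_A E)) = coact (yd_A (dtens D E)).
  apply: hom_ext => -[i j]; rewrite (coactA_E (comp_ij i j)) -(tens_bv _ i j) yd_tens_coactE.
  rewrite (coactA_E (comp_bv D i)) (linear_sumE _ _ _ (sw_linear _)); apply: eq_bigr => r _.
  rewrite (linear_scaleE _ _ (sw_linear _)) sw_tens; [|lin|lin].
  rewrite (coactA_E (comp_bv E j)) (linear_sumE _ _ _ (sw_linear _)).
  rewrite (bigD1 (nact r (par D i))) //= big1 ?addr0 => [|s sr];
    rewrite (linear_scaleE _ _ (sw_linear _)) sw_tens; try by lin.
    rewrite (A_mul xi) eqxx scale1r scalerA (nactE r) /= -(chiD xi3) -mulrDr tens_bv.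
    by rewrite [in RHS]lin_bv.
  by rewrite (A_mul xi) eq_sym (negPf sr) scale0r tens0l ?scaler0.
by case: (yd_tens _ _ _) (yd_A (dtens D E)) eact ecoact => a c [b d] /= -> ->.
Qed.

Lemma yd_A_braiding i j :
  yd_braiding (yd_A D) (yd_A E) (bv k i ⊗ bv k j)
  = dX E (par D i) (bv k j) ⊗ dW D (sg (par D i) (wt E j)) (bv k i).
Proof.
rewrite yd_braidingE (coactA_E (comp_bv D i)) (linear_sumE _ _ _ (sw_linear _)).
rewrite (bigD1 (0, sg (par D i) (wt E j))) //= big1 ?addr0 => [|s s0];
  rewrite (linear_scaleE _ _ (sw_linear _)) sw_tens; try by lin.
  by rewrite (actA_E _ _ (comp_bv E j)) mul0r chi0 eqxx !scale1r.
by rewrite (actA_E _ _ (comp_bv E j)) (negPf s0) scale0r tens0l ?scaler0.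
Qed.

End YDMorphisms.

End OverA.

(** * Modules over the dual of A *)

Section OverDual.
Variables (k : fieldType) (xi : k) (xi3 : xi ^+ 3 = 1).
Notation A := (A18 xi).
Notation Ad := (hopf_dual (A18 xi)).

Lemma transp_bv (I J : finType) (F : 'Hom(vec k I, vec k J)) j i :
  transp F (bv k j) i = F (bv k i) j.
Proof. by rewrite lin_bv ffunE. Qed.

Lemma D_mul s y t z : hmul Ad (bv k (s, y) ⊗ bv k (t, z))
  = (y == z)%:R *: (chi xi (sh y (s.2 * t.1)) *: bv k (nadd s t, y)).
Proof.
rewrite tens_bv; apply/ffunP => -[u x]; rewrite transp_bv lin_bv /= sum_ffunE.
rewrite !ffunE xpair_eqE; have [<-|ne] := eqVneq (nadd s t) u.
  rewrite (bigD1 (s, t)) //= big1 ?addr0 => [|[s' t'] /andP[_ ne]].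
    rewrite !ffunE /= !xpair_eqE !eqxx /= tauE // [y == x]eq_sym.
    have [->|_] := eqVneq x y; last by rewrite !mul0r !scaler0.
    by have [->|_] := eqVneq y z; rewrite ?mulr1 ?scale1r ?mulr0 ?scaler0 ?scale0r.
  rewrite !ffunE /= !xpair_eqE; move: ne; rewrite xpair_eqE.
  by case: (s' =P s); case: (t' =P t) => //= _ _ _; rewrite ?mul0r ?mulr0 scaler0.
rewrite big1 ?scaler0 // => -[s' t'] /= e; rewrite !ffunE /= !xpair_eqE.
case: (s' =P s) => [es|_]; last by rewrite mul0r scaler0.
case: (t' =P t) => [et|_]; last by rewrite mulr0 scaler0.
by rewrite -es -et e in ne.
Qed.

Lemma D_comul g y : hcomul Ad (bv k (g, y)) =
  \sum_z (bv k (g, z) ⊗ bv k (nact g z, y - z)).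
Proof.
apply/ffunP => -[[a z] [b x]]; rewrite transp_bv -tens_bv (A_mul xi) sum_ffunE !ffunE.
rewrite (bigD1 z) //= big1 ?addr0 => [|z' /negPf ne]; last first.
  by rewrite !ffunE /= xpair_eqE ne andbF mul0r.
rewrite !ffunE /= !xpair_eqE eqxx andbT [a == g]eq_sym.
have [->|_] := eqVneq g a; last by rewrite mul0r scaler0.
rewrite mul1r /= subr_eq [x + z]addrC [y == _]eq_sym.
by case: (_ == b); case: (_ == y); rewrite ?scale1r ?scale0r.
Qed.

Lemma D_one : hone Ad = \sum_y bv k (nzero, y).
Proof.
apply/ffunP => -[g y]; rewrite ffunE A_counit sum_ffunE (bigD1 y) //=.
rewrite big1 ?addr0 => [|z /negPf zy]; rewrite ffunE xpair_eqE ?zy ?andbF //.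
by rewrite eqxx andbT eq_sym.
Qed.

Lemma D_counit g y : hcounit Ad (bv k (g, y)) = (y == 0)%:R.
Proof.
rewrite lin_bv A_one sum_ffunE (bigD1 g) //= big1 ?addr0 => [|h /negPf hg]; rewrite ffunE xpair_eqE.
  by rewrite eqxx eq_sym.
by rewrite hg.
Qed.

(** The roles are exchanged: parity and W, with a character of N depending on the
    weight, give the action, and the weight and X give the coaction.  The term
    [sh] makes the character compatible with the shift of the weight by W. *)
Definition yd_D (J : finType) (D : datum k J) : yd k A18_basis J :=
  {| act := lin (fun p : A18_basis * J => (p.1.2 == par D p.2)%:R *:
       (chi xi (- (p.1.1.1 * (wt D p.2 + sh (par D p.2) p.1.1.2))) *: dW D p.1.1.2 (bv k p.2)));
     coact := lin (fun j : J => \sum_(y : 'Z_2)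
       (bv k ((0, - wt D j) : N18, y) ⊗ dX D y (bv k j))) |}.

Section Formulas.
Variables (J : finType) (D : datum k J).

Lemma actD_E (g : N18) y n w v : v \in dcomp D n w ->
  act (yd_D D) (bv k (g, y) ⊗ v)
  = (y == n)%:R *: (chi xi (- (g.1 * (w + sh n g.2))) *: dW D g.2 v).
Proof.
apply: (cspan_ext (f := fun v => act (yd_D D) (bv k (g, y) ⊗ v))
  (g := fun v => (y == n)%:R *: (chi xi (- (g.1 * (w + sh n g.2))) *: dW D g.2 v))); [lin | lin |].
by move=> j /andP[/eqP <- /eqP <-]; rewrite tens_bv lin_bv.
Qed.

Lemma coactD_E n w v : v \in dcomp D n w ->
  coact (yd_D D) v = \sum_y (bv k ((0, - w) : N18, y) ⊗ dX D y v).
Proof.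
apply: (cspan_ext (f := coact (yd_D D))
  (g := fun v => \sum_y (bv k ((0, - w) : N18, y) ⊗ dX D y v))); first by lin.
  move=> c u t; rewrite scaler_sumr -big_split; apply: eq_bigr => r _ /=.
  have l : is_linear (fun t => bv k ((0, - w) : N18, r) ⊗ dX D r t) by lin.
  exact: l.
by move=> j /andP[_ /eqP <-]; rewrite lin_bv.
Qed.

End Formulas.

#[local] Opaque A18 yd_D hopf_dual.

Section YD.
Variables (J : finType) (D : datum k J) (lD : datum_laws D).

Let hD := dual_is_hopf (A18_is_hopf xi3).

Lemma actD_actD g y h z j :
  act (yd_D D) (bv k (g, y) ⊗ act (yd_D D) (bv k (h, z) ⊗ bv k j))
  = act (yd_D D) (hmul Ad (bv k (g, y) ⊗ bv k (h, z)) ⊗ bv k j).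
Proof.
move: (bv k j) (comp_bv D j) => v; move: (par D j) (wt D j) => n w vD.
have Wv := dW_comp_v lD h.2 vD.
rewrite D_mul !tensZl !linearZ /= !(actD_E _ _ vD) !tensZr !linearZ /= (actD_E _ _ Wv).
rewrite -(dWD lD) !scalerA.
case: (z =P n) => [->|]; last first.
  case: (y =P z) => [<- /eqP/negPf ->|_ _]; by rewrite ?(mul0r, mulr0) ?scale0r.
case: (y =P n) => [->|_]; last by rewrite ?(mul0r, mulr0) !scale0r.
rewrite !mul1r !mulr1 -!(chiD xi3); congr (chi _ _ *: _).
rewrite /nadd /=; case: (Z2P n) => ->; rewrite !(sh0, sh1) ?addr0 ?add0r.
  by rewrite mulrDl opprD addrC.
ring.
Qed.

Lemma coactD_coassoc : (assoc k _ _ _ \o (hcomul Ad ⊠ \1) \o coact (yd_D D)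
               = (\1 ⊠ coact (yd_D D)) \o coact (yd_D D))%VF.
Proof.
apply: hom_ext => j; rewrite !comp_lfunE (coactD_E (comp_bv D j)).
move: (bv k j) (comp_bv D j) => v; move: (par D j) (wt D j) => n w vD.
rewrite !linear_sum /=.
transitivity (\sum_(z : 'Z_2) \sum_(y : 'Z_2) (bv k ((0, - w) : N18, z)
   ⊗ (bv k ((0, - sg z w) : N18, y - z) ⊗ dX D y v))).
  rewrite exchange_big; apply: eq_bigr => y _; rewrite tensl_tens id_lfunE D_comul.
  rewrite tens_suml linear_sum; apply: eq_bigr => z _ /=.
  by rewrite assoc_tens nactE /= sgN.
apply: eq_bigr => z _; rewrite tensl_tens id_lfunE (coactD_E (dX_comp_v lD z vD)).
rewrite tens_sumr (reindex_inj (addIr z)) /=; apply: eq_bigr => x _.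
by rewrite addrK (dXD lD).
Qed.

Lemma coactD_compat g y j :
    sw (hcomul Ad (bv k (g, y))) (fun h1 h2 => sw (coact (yd_D D) (act (yd_D D) (h1 ⊗ bv k j)))
      (fun z w => hmul Ad (z ⊗ h2) ⊗ w))
    = sw (hcomul Ad (bv k (g, y))) (fun h1 h2 => sw (coact (yd_D D) (bv k j))
      (fun z w => hmul Ad (h1 ⊗ z) ⊗ act (yd_D D) (h2 ⊗ w))).
Proof.
move: (bv k j) (comp_bv D j) => v; move: (par D j) (wt D j) => n w vD.
rewrite D_comul ![sw (\sum_s _) _](linear_sumE _ _ _ (sw_linear _)).
rewrite (bigD1 n) //= [X in _ + X]big1 ?addr0 => [|z /negPf zn]; last first.
  rewrite sw_tens; [|lin|lin].
  by rewrite (actD_E _ _ vD) zn scale0r linear0 /sw big1 // => p _; rewrite ffunE scale0r.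
rewrite sw_tens; [|lin|lin].
rewrite (actD_E _ _ vD) eqxx scale1r linearZ /= (linear_scaleE _ _ (sw_linear _)).
rewrite (coactD_E (dW_comp_v lD g.2 vD)) (linear_sumE _ _ _ (sw_linear _)).
rewrite (bigD1 (y - n)) //= big1 ?addr0 => [|x /negPf xn]; last first.
  by rewrite sw_tens; [rewrite D_mul xn scale0r tens0l | lin | lin].
rewrite [RHS](bigD1 (y - n)) //= big1 ?addr0 => [|x /negPf xn]; last first.
  rewrite sw_tens; [|lin|lin].
  rewrite (coactD_E vD) (linear_sumE _ _ _ (sw_linear _)) big1 // => t _.
  rewrite sw_tens; [|lin|lin].
  rewrite (actD_E _ _ (dX_comp_v lD t vD)) [y - x == n]subr_eq addrC -subr_eq eq_sym xn.
  by rewrite scale0r tens0r.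
do 2![rewrite sw_tens; [|lin|lin]].
rewrite (coactD_E vD) (linear_sumE _ _ _ (sw_linear _)).
rewrite (bigD1 (y - n)) //= big1 ?addr0 => [|t /negPf tn]; last first.
  by rewrite sw_tens; [rewrite D_mul eq_sym tn scale0r tens0l | lin | lin].
rewrite !sw_tens; try by lin.
have yn : y - (y - n) = n by rewrite opprB addrC subrK.
rewrite !D_mul (actD_E _ _ (dX_comp_v lD _ vD)) yn !eqxx !scale1r.
set x := y - n; rewrite !tensZl tensZr !scalerA (dXW lD) -!(chiD xi3) !nactE /=.
congr (chi _ _ *: (bv _ (_, _) ⊗ _)).
  rewrite mulr0 sh00 add0r; case: (Z2P x) => ->; rewrite !(sh0, sh1, sg0, sg1) ?addr0 //.
  rewrite mulNr [_ * g.1]mulrC -opprD Z3D opprK.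
  by case: (Z2P n) => ->; rewrite !(sh0, sh1); ring.
rewrite /nadd /= addr0 add0r; congr (_, _).
by rewrite (sg_sub n) opprD; ring.
Qed.

Lemma yd_D_is_yd : is_yd Ad (yd_D D).
Proof.
split.
- move=> g h v; move: g; apply: vec_ext; [lin | lin |] => -[g y].
  move: h; apply: vec_ext; [lin | lin |] => -[h z].
  by move: v; apply: vec_ext; [lin | lin |] => j; exact: actD_actD.
- apply: vec_ext; [lin | lin |] => j; rewrite D_one tens_suml linear_sum.
  rewrite (bigD1 (par D j)) //= big1 ?addr0 => [|y /negPf yj];
    rewrite (actD_E _ _ (comp_bv D j)).
    by rewrite mul0r oppr0 chi0 eqxx !scale1r (dW0 lD).
  by rewrite yj scale0r.
- exact: coactD_coassoc.
- apply: vec_ext; [lin | lin |] => j; rewrite (coactD_E (comp_bv D j)) linear_sum.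
  rewrite (bigD1 0) //= big1 ?addr0 => [|y /negPf y0]; rewrite forml_tens D_counit.
    by rewrite eqxx scale1r (dX0 lD).
  by rewrite y0 scale0r.
- apply: (yd_compat_of_free hD) => h v.
  move: h; apply: vec_ext; [lin | lin |] => -[g y].
  move: v; apply: vec_ext; [|lin|] => [|j]; last exact: coactD_compat.
  by apply: is_linear_swr => a b; lin.
Qed.

End YD.

Section YDMorphisms.
Variables (J K : finType) (D : datum k J) (E : datum k K).

Lemma yd_D_morphism (f : 'Hom(vec k J, vec k K)) :
  dmorph D E f -> yd_morphism (yd_D D) (yd_D E) f.
Proof.
move=> [fc fX fW]; split=> [h v|].
  move: h; apply: vec_ext; [lin | lin |] => -[g y].
  move: v; apply: vec_ext; [lin | lin |] => j.
  by rewrite (actD_E _ _ (comp_bv D j)) (actD_E _ _ (fc j)) [f _]linearZ /= [f _]linearZ /= fW.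
apply: vec_ext; [lin | lin |] => j.
rewrite (coactD_E (comp_bv D j)) (coactD_E (fc j)) linear_sum; apply: eq_bigr => r _.
by rewrite /= tensl_tens id_lfunE fX.
Qed.

Lemma yd_D_tens : yd_tens Ad (yd_D D) (yd_D E) = yd_D (dtens D E).
Proof.
have comp_ij i j : bv k (i, j) \in dcomp (dtens D E) (par D i + par E j) (wt D i + wt E j).
  exact: comp_bv.
have eact : act (yd_tens Ad (yd_D D) (yd_D E)) = act (yd_D (dtens D E)).
  apply: hom_ext => -[[g y] [i j]].
  rewrite -(tens_bv _ (g, y) (i, j)) (actD_E _ _ (comp_ij i j)) -(tens_bv _ i j) yd_tens_actE.
  rewrite D_comul (linear_sumE _ _ _ (sw_linear _)).
  rewrite (bigD1 (par D i)) //= big1 ?addr0 => [|z /negPf zi]; rewrite sw_tens; try by lin.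
    rewrite (actD_E _ _ (comp_bv D i)) (actD_E _ _ (comp_bv E j)) eqxx scale1r.
    rewrite [y - _ == _]subr_eq [par E j + _]addrC !tensZr tensZl !scalerA [in RHS]tens_bv [in RHS]lin_bv /=.
    rewrite (nactE g) /= shD; congr (_ *: _); rewrite -mulrA -!(chiD xi3).
    by congr (_ * chi _ _); ring.
  by rewrite (actD_E g z (comp_bv D i)) zi scale0r tens0l.
have ecoact : coact (yd_tens Ad (yd_D D) (yd_D E)) = coact (yd_D (dtens D E)).
  apply: hom_ext => -[i j]; rewrite (coactD_E (comp_ij i j)) -(tens_bv _ i j) yd_tens_coactE.
  rewrite (coactD_E (comp_bv D i)) (linear_sumE _ _ _ (sw_linear _)); apply: eq_bigr => y _.
  rewrite sw_tens; [|lin|lin].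
  rewrite (coactD_E (comp_bv E j)) (linear_sumE _ _ _ (sw_linear _)).
  rewrite (bigD1 y) //= big1 ?addr0 => [|z zy]; rewrite sw_tens; try by lin.
    rewrite D_mul eqxx scale1r mulr0 sh00 chi0 scale1r tensl_tens /nadd /=.
    by rewrite addr0 -opprD.
  by rewrite D_mul eq_sym (negPf zy) scale0r tens0l.
by case: (yd_tens _ _ _) (yd_D (dtens D E)) eact ecoact => a c [b d] /= -> ->.
Qed.

(** This is the inverse of the braiding over A: on
    W_(- wt i) j ⊗ X_(par j) i the latter gives back i ⊗ j, as X_n X_n = 1. *)
Lemma yd_D_braiding i j :
  yd_braiding (yd_D D) (yd_D E) (bv k i ⊗ bv k j)
  = dW E (- wt D i) (bv k j) ⊗ dX D (par E j) (bv k i).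
Proof.
rewrite yd_braidingE (coactD_E (comp_bv D i)) (linear_sumE _ _ _ (sw_linear _)).
rewrite (bigD1 (par E j)) //= big1 ?addr0 => [|y /negPf yj]; rewrite sw_tens; try by lin.
  by rewrite (actD_E _ _ (comp_bv E j)) mul0r oppr0 chi0 eqxx !scale1r.
by rewrite (actD_E _ _ (comp_bv E j)) yj scale0r tens0l.
Qed.

End YDMorphisms.

End OverDual.

(** * Hopf algebras with compatible data *)

(** The structure maps are morphisms of data.  The Hopf algebra axioms proper are
    not included, as they depend on which of the two braidings is used. *)
Record datum_hopf (k : fieldType) (J : finType) (D : datum k J) (R : hopf k J) : Prop :=
  DatumHopf {
  dh_laws : datum_laws D;
  dh_mul : dmorph (dtens D D) D (hmul R);
  dh_comul : dmorph D (dtens D D) (hcomul R);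
  dh_antip : dmorph D D (hantip R);
  dh_one : hone R \in dcomp D 0 0;
  dh_one_X : forall y, dX D y (hone R) = hone R;
  dh_one_W : forall b, dW D b (hone R) = hone R;
  dh_counit : forall j, hcounit R (bv k j) != 0 -> par D j = 0 /\ wt D j = 0;
  dh_counit_X : forall y j, hcounit R (dX D y (bv k j)) = hcounit R (bv k j);
  dh_counit_W : forall b j, hcounit R (dW D b (bv k j)) = hcounit R (bv k j) }.

Section DatumHopf.
Variables (k : fieldType) (xi : k) (xi3 : xi ^+ 3 = 1).
Variables (J : finType) (D : datum k J) (R : hopf k J) (dR : datum_hopf D R).
Notation A := (A18 xi).
Notation Ad := (hopf_dual (A18 xi)).

Lemma yd_A_hopf : is_hopf_for (yd_braiding (yd_A xi D) (yd_A xi D)) R ->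
  is_yd_hopf A (yd_A xi D) R.
Proof.
move=> hR; have [lD mD cD sD oD oX oW eD eX eW] := dR; split => //.
- exact: yd_A_is_yd.
- by rewrite yd_A_tens //; exact: yd_A_morphism.
- move=> h; have l1 : is_linear (fun h => (hcounit A h : k) *: hone R) by lin.
  move: h; apply: vec_ext => [|//|[g y]]; first by lin.
  by rewrite (actA_E _ _ _ oD) sg00 oX (A_counit xi).
- rewrite (coactA_E _ oD) (A_one xi) tens_suml; apply: eq_bigr => r _.
  by rewrite mulr0 chi0 scale1r oW.
- by rewrite yd_A_tens //; exact: yd_A_morphism.
- move=> h x; rewrite -[RHS]/(_ *: (_ : k^o)).
  move: h; apply: vec_ext; [lin | lin |] => -[g y].
  move: x; apply: vec_ext; [lin | lin |] => j.
  rewrite (actA_E _ _ _ (comp_bv D j)) linearZ /= eX (A_counit xi).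
  have [-> |/eD[_ ->]] := eqVneq (hcounit R (bv k j)) 0; first by rewrite !scaler0.
  by rewrite sg00.
- move=> x; have l1 : is_linear (fun x => (hcounit R x : k) *: hone A) by lin.
  move: x; apply: vec_ext => [|//|j]; first by lin.
  rewrite (coactA_E _ (comp_bv D j)) linear_sum (A_one xi) scaler_sumr; apply: eq_bigr => r _.
  rewrite linearZ /= formr_tens eW scalerA.
  have [-> |/eD[-> ->]] := eqVneq (hcounit R (bv k j)) 0; first by rewrite mulr0 !scale0r.
  by rewrite mulr0 chi0 mul1r.
- exact: yd_A_morphism.
Qed.

Lemma yd_D_hopf : is_hopf_for (yd_braiding (yd_D xi D) (yd_D xi D)) R ->
  is_yd_hopf Ad (yd_D xi D) R.
Proof.
move=> hR; have [lD mD cD sD oD oX oW eD eX eW] := dR; split => //.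
- exact: yd_D_is_yd.
- by rewrite yd_D_tens //; exact: yd_D_morphism.
- move=> h; have l1 : is_linear (fun h => (hcounit Ad h : k) *: hone R) by lin.
  move: h; apply: vec_ext => [|//|[g y]]; first by lin.
  by rewrite (actD_E _ _ _ oD) add0r sh0 mulr0 oppr0 chi0 scale1r oW (D_counit xi).
- rewrite (coactD_E _ oD) (D_one xi) tens_suml; apply: eq_bigr => r _.
  by rewrite oppr0 oX.
- by rewrite yd_D_tens //; exact: yd_D_morphism.
- move=> h x; rewrite -[RHS]/(_ *: (_ : k^o)).
  move: h; apply: vec_ext; [lin | lin |] => -[g y].
  move: x; apply: vec_ext; [lin | lin |] => j.
  rewrite (actD_E _ _ _ (comp_bv D j)) linearZ /= [hcounit R (chi _ _ *: _)]linearZ /= eW (D_counit xi).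
  have [-> |/eD[-> ->]] := eqVneq (hcounit R (bv k j)) 0; first by rewrite !scaler0.
  by rewrite add0r sh0 mulr0 oppr0 chi0 scale1r.
- move=> x; have l1 : is_linear (fun x => (hcounit R x : k) *: hone Ad) by lin.
  move: x; apply: vec_ext => [|//|j]; first by lin.
  rewrite (coactD_E _ (comp_bv D j)) linear_sum (D_one xi) scaler_sumr; apply: eq_bigr => r _.
  rewrite /= formr_tens eX.
  have [-> |/eD[_ ->]] := eqVneq (hcounit R (bv k j)) 0; first by rewrite !scale0r.
  by rewrite oppr0.
- exact: yd_D_morphism.
Qed.

End DatumHopf.

(** * Signed formal sums *)

(** A list of signed basis elements (true is the sign -1).  All the structure
    constants below are 0 or ±1, so identities between linear maps are decided
    by cancelling terms of opposite sign. *)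
Definition fsum (T : Type) := seq (bool * T).

Section Fsum.
Variable k : fieldType.
Implicit Types T U V : finType.

Definition ev T (s : fsum T) : vec k T := \sum_(p <- s) (-1) ^+ p.1 *: bv k p.2.

Definition fneg (T : Type) (b : bool) (s : fsum T) : fsum T := [seq (b (+) p.1, p.2) | p <- s].

Definition fbind (T U : Type) (s : fsum T) (f : T -> fsum U) : fsum U :=
  flatten [seq fneg p.1 (f p.2) | p <- s].

Definition ftens (T U : Type) (s : fsum T) (t : fsum U) : fsum (T * U) :=
  fbind s (fun a => [seq (p.1, (a, p.2)) | p <- t]).

(** The number n bounds the length of s and makes the recursion structural. *)
Fixpoint cancels (T : eqType) n (s : fsum T) : bool :=
  if s is (b, t) :: s' then
    if n is n'.+1 then ((~~ b, t) \in s') && cancels n' (rem (~~ b, t) s') else false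
  else true.

Definition feq (T : eqType) (s t : fsum T) : bool :=
  let u := s ++ fneg true t in cancels (size u) u.

Lemma ev_cat T (s t : fsum T) : ev (s ++ t) = ev s + ev t.
Proof. by rewrite /ev big_cat. Qed.

Lemma ev_neg T b (s : fsum T) : ev (fneg b s) = (-1) ^+ b *: ev s.
Proof.
rewrite /ev big_map scaler_sumr; apply: eq_bigr => p _ /=.
by rewrite signr_addb scalerA.
Qed.

Lemma ev_bind T U (s : fsum T) (f : T -> fsum U) :
  ev (fbind s f) = \sum_(p <- s) (-1) ^+ p.1 *: ev (f p.2).
Proof.
rewrite /fbind; elim: s => [|p s IHs]; rewrite ?big_nil /=; first by rewrite /ev big_nil.
by rewrite ev_cat ev_neg IHs big_cons.
Qed.

Lemma ev_lin T (W : vectType k) (F : 'Hom(vec k T, W)) (s : fsum T) :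
  F (ev s) = \sum_(p <- s) (-1) ^+ p.1 *: F (bv k p.2).
Proof. by rewrite linear_sum; apply: eq_bigr => p _; rewrite linearZ. Qed.

Lemma ev_bindE T U (F : 'Hom(vec k T, vec k U)) f s :
  (forall t, F (bv k t) = ev (f t)) -> F (ev s) = ev (fbind s f).
Proof. by move=> Ff; rewrite ev_bind ev_lin //; apply: eq_bigr => p _; rewrite Ff. Qed.

Lemma ev_map T U (h : T -> U) s :
  reidx k h (ev s) = ev [seq (p.1, h p.2) | p <- s].
Proof. by rewrite ev_lin /ev big_map; apply: eq_bigr => p _; rewrite reidx_bv. Qed.

Lemma ev1 T (t : T) : ev [:: (false, t)] = bv k t.
Proof. by rewrite /ev big_seq1 scale1r. Qed.

Lemma ev_tens T U (s : fsum T) (t : fsum U) : ev (ftens s t) = ev s ⊗ ev t.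
Proof.
rewrite ev_bind [ev s]/ev tens_suml; apply: eq_bigr => p _.
rewrite tensZl; congr (_ *: _); rewrite /ev big_map tens_sumr.
by apply: eq_bigr => q _; rewrite tensZr tens_bv.
Qed.

Lemma ev_linl T U (W : vectType k) (F : 'Hom(vec k (T * U), W)) (s : fsum T) w :
  F (ev s ⊗ w) = \sum_(p <- s) (-1) ^+ p.1 *: F (bv k p.2 ⊗ w).
Proof.
rewrite /ev tens_suml linear_sum; apply: eq_bigr => p _.
by rewrite tensZl linearZ.
Qed.

Lemma ev_linr T U (W : vectType k) (F : 'Hom(vec k (T * U), W)) v (s : fsum U) :
  F (v ⊗ ev s) = \sum_(p <- s) (-1) ^+ p.1 *: F (v ⊗ bv k p.2).
Proof.
rewrite /ev tens_sumr linear_sum; apply: eq_bigr => p _.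
by rewrite tensZr linearZ.
Qed.

Lemma cancels_ev T n (s : fsum T) : cancels n s -> ev s = 0.
Proof.
elim: n s => [|n IHn] [|[b t] s] //=; try by rewrite /ev big_nil.
case/andP => bs /IHn; rewrite /ev big_cons (perm_big _ (perm_to_rem bs)) big_cons /= => ->.
by rewrite addr0 -scalerDl; case: b {bs} => /=; rewrite expr1 expr0 ?subrr ?addNr scale0r.
Qed.

Lemma feq_ev T (s t : fsum T) : feq s t -> ev s = ev t.
Proof.
by move/cancels_ev/eqP; rewrite ev_cat ev_neg expr1 scaleN1r subr_eq0 => /eqP.
Qed.

Definition tab T U (f : T -> fsum U) : 'Hom(vec k T, vec k U) := lin (fun t => ev (f t)).

Lemma tab_bv T U (f : T -> fsum U) t : tab f (bv k t) = ev (f t).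
Proof. exact: lin_bv. Qed.

Lemma tab_ev T U (f : T -> fsum U) s : tab f (ev s) = ev (fbind s f).
Proof. exact/ev_bindE/tab_bv. Qed.

Lemma ev_gr T (d : T -> nat) n s : all (fun p => d p.2 == n) s -> ev s \in gr d n.
Proof.
move/allP => sn; rewrite /ev big_seq memv_suml // => p ps.
by rewrite memvZ // bv_cspan // sn.
Qed.

End Fsum.

Arguments ev {k T} s.
Arguments tab {k T U} f.

(** * The twelve-dimensional algebra *)

(** The words, by their indices, that form a basis of the quotient of the free
    algebra on v0, v1, v2 by the relations
      v0 v0 = v1 v2 = v2 v1 = 0, v1 v1 + v2 v0 + v0 v2 = 0, v2 v2 + v1 v0 + v0 v1 = 0.
    The empty word e is the unit. *)
Inductive word := e | v0 | v1 | v2 | v01 | v10 | v02 | v20 | v010 | v020 | v102 | v0102.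

Definition words := [:: e; v0; v1; v2; v01; v10; v02; v20; v010; v020; v102; v0102].

Definition word_code (w : word) : nat :=
  match w with
  | e => 0 | v0 => 1 | v1 => 2 | v2 => 3 | v01 => 4 | v10 => 5 | v02 => 6 | v20 => 7
  | v010 => 8 | v020 => 9 | v102 => 10 | v0102 => 11
  end.

Lemma word_codeK : cancel word_code (nth e words). Proof. by case. Qed.

HB.instance Definition _ := Countable.copy word (can_type word_codeK).

Lemma words_enum : Finite.axiom words. Proof. by case. Qed.

HB.instance Definition _ := isFinite.Build word words_enum.

Lemma mem_words w : w \in words. Proof. by case: w. Qed.

Definition pos (T : Type) (t : T) : bool * T := (false, t).
Definition neg (T : Type) (t : T) : bool * T := (true, t).

Definition letters (w : word) : seq nat :=
  match w with
  | e => [::] | v0 => [:: 0] | v1 => [:: 1] | v2 => [:: 2]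
  | v01 => [:: 0; 1] | v10 => [:: 1; 0] | v02 => [:: 0; 2] | v20 => [:: 2; 0]
  | v010 => [:: 0; 1; 0] | v020 => [:: 0; 2; 0] | v102 => [:: 1; 0; 2]
  | v0102 => [:: 0; 1; 0; 2]
  end%N.

Definition wdeg (w : word) : nat := size (letters w).

(** Left multiplication by the generators.  The entries are consequences of the
    relations, for instance v1 v1 v0 = - v2 v0 v0 - v0 v2 v0 = - v0 v2 v0.  All
    other tables are computed from this one, and that they define the
    structures claimed is established by the checks below. *)
Definition lmul (a : nat) (w : word) : fsum word :=
  match a, w with
  | 0, e => [:: pos v0] | 0, v1 => [:: pos v01] | 0, v2 => [:: pos v02]
  | 0, v10 => [:: pos v010] | 0, v20 => [:: pos v020] | 0, v102 => [:: pos v0102]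
  | 1, e => [:: pos v1] | 1, v0 => [:: pos v10] | 1, v1 => [:: neg v20; neg v02]
  | 1, v01 => [:: pos v020] | 1, v10 => [:: neg v020] | 1, v02 => [:: pos v102]
  | 1, v020 => [:: neg v0102]
  | 2, e => [:: pos v2] | 2, v0 => [:: pos v20] | 2, v2 => [:: neg v10; neg v01]
  | 2, v01 => [:: pos v102] | 2, v02 => [:: pos v010] | 2, v20 => [:: neg v010]
  | 2, v010 => [:: neg v0102]
  | _, _ => [::]
  end%N.

Definition reduce (T : eqType) (s : fsum T) : fsum T :=
  foldr (fun p u => if (~~ p.1, p.2) \in u then rem (~~ p.1, p.2) u else p :: u) [::] s.

Definition gen (a : nat) : word := nth v0 [:: v0; v1; v2] a.

Definition tabulate (T : Type) (f : word -> T) : seq T := map f words.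
Definition entry (T : Type) (x0 : T) (t : seq T) (w : word) : T := nth x0 t (word_code w).

Definition mul_table := Eval vm_compute in
  tabulate (fun x => tabulate (fun y =>
    reduce (foldr (fun a s => fbind s (lmul a)) [:: pos y] (letters x)))).
Definition wmul (x y : word) : fsum word := entry [::] (entry [::] mul_table x) y.

(** The reflection is the algebra automorphism that sends v_a to - v_(-a). *)
Definition refl_table := Eval vm_compute in
  tabulate (fun x =>
    reduce (foldr (fun a s => fneg true (fbind s (lmul ((3 - a) %% 3)))) [:: pos e] (letters x))).
Definition wX (y : 'Z_2) (x : word) : fsum word :=
  if y == 0 then [:: pos x] else entry [::] refl_table x.

(** By the definition of the tensor product of data, the rotation shifts the letters
    of a word alternately by b and - b. *)
Fixpoint rotate (b : nat) (l : seq nat) : fsum word :=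
  if l is a :: l' then fbind (rotate (3 - b) l') (lmul ((a + b) %% 3)) else [:: pos e].
Definition rot_table := Eval vm_compute in
  [seq tabulate (fun x => reduce (rotate b (letters x))) | b <- [:: 0; 1; 2]%N].
Definition wW (b : 'Z_3) (x : word) : fsum word := entry [::] (nth [::] rot_table b) x.

Definition wpar (x : word) : 'Z_2 := inZp (wdeg x).
Definition wwt (x : word) : 'Z_3 := inZp (sumn (letters x)).

Definition braidA (x y : word) : fsum (word * word) :=
  ftens (wX (wpar x) y) (wW (sg (wpar x) (wwt y)) x).
Definition braidD (x y : word) : fsum (word * word) :=
  ftens (wW (- wwt x) y) (wX (wpar y) x).

Section Braided.
Variable braid : word -> word -> fsum (word * word).

Definition bmul2 (p q : word * word) : fsum (word * word) :=
  fbind (braid p.2 q.1) (fun r => ftens (wmul p.1 r.1) (wmul r.2 q.2)).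

(** The coproduct is the multiplicative one, for the braided product, with the
    generators primitive.  The antipode satisfies S(x y) = S(y') S(x') when the
    braiding sends x ⊗ y to y' ⊗ x'; the number n bounds the recursion. *)
Fixpoint bcomul (l : seq nat) : fsum (word * word) :=
  if l is a :: l' then
    fbind [:: pos (gen a, e); pos (e, gen a)] (fun p => fbind (bcomul l') (bmul2 p))
  else [:: pos (e, e)].

Fixpoint bantip (n : nat) (l : seq nat) : fsum word :=
  if n isn't n'.+1 then [::] else
  match l with
  | [::] => [:: pos e]
  | [:: a] => [:: neg (gen a)]
  | a :: l' => fbind (foldr (fun b s => fbind s (lmul b)) [:: pos e] l') (fun w =>
      fbind (braid (gen a) w) (fun r => fbind (bantip n' (letters r.1)) (fun x =>
        fbind (bantip n' (letters r.2)) (wmul x))))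
  end.

End Braided.

(** The tables are evaluated once, and later computations only look up entries. *)
Definition comulA_table := Eval vm_compute in
  tabulate (fun x => reduce (bcomul braidA (letters x))).
Definition comulD_table := Eval vm_compute in
  tabulate (fun x => reduce (bcomul braidD (letters x))).
Definition antipA_table := Eval vm_compute in
  tabulate (fun x => reduce (bantip braidA 5 (letters x))).
Definition antipD_table := Eval vm_compute in
  tabulate (fun x => reduce (bantip braidD 5 (letters x))).

Definition wcomul (t : seq (fsum (word * word))) (x : word) := entry [::] t x.
Definition wantip (t : seq (fsum word)) (x : word) := entry [::] t x.

Definition all1 (P : word -> bool) : bool := all P words.
Definition all2w (P : word -> word -> bool) : bool := all1 (fun x => all1 (P x)).

Lemma all1P P : all1 P -> forall x, P x.
Proof. by move/allP => + x; apply; exact: mem_words. Qed.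

Lemma all2wP P : all2w P -> forall x y, P x y.
Proof. by move=> /all1P + x => /(_ x)/all1P. Qed.

(** * Verification of the structure constants *)

Definition mulA_check := all2w (fun x y => all1 (fun z =>
  feq (fbind (wmul x y) (wmul^~ z)) (fbind (wmul y z) (wmul x)))).
Definition unit_check := all1 (fun x =>
  (wmul e x == [:: pos x]) && (wmul x e == [:: pos x])).
Definition counitM_check := all2w (fun x y =>
  (x == e) && (y == e) || all (fun p => p.2 != e) (wmul x y)).

Definition typed (d : nat) (n : 'Z_2) (w : 'Z_3) : pred (bool * word) := fun p =>
  [&& wdeg p.2 == d, wpar p.2 == n & wwt p.2 == w].

Definition Z2s : seq 'Z_2 := [:: 0; 1].
Definition Z3s : seq 'Z_3 := [:: 0; 1; - 1].

Lemma mem_Z2s y : y \in Z2s.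
Proof. by case: (Z2P y) => ->. Qed.
Lemma mem_Z3s b : b \in Z3s.
Proof. by case: b => [[|[|[|//]]] ?]. Qed.

Definition grading_check := all1 (fun x =>
  all (fun y => all (typed (wdeg x) (wpar x) (sg y (wwt x))) (wX y x)) Z2s &&
  all (fun b => all (typed (wdeg x) (wpar x) (wwt x + sh (wpar x) b)) (wW b x)) Z3s).

Definition actions_check := all1 (fun x =>
  [&& wX 0 x == [:: pos x], wW 0 x == [:: pos x],
      all (fun y => all (fun z => feq (wX (y + z) x) (fbind (wX z x) (wX y))) Z2s) Z2s,
      all (fun b => all (fun c => feq (wW (b + c) x) (fbind (wW c x) (wW b))) Z3s) Z3s &
      all (fun y => all (fun b =>
        feq (fbind (wW b x) (wX y)) (fbind (wX y x) (wW (sg y b)))) Z3s) Z2s]).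

Definition mul_check := all2w (fun x y =>
  [&& all (typed (wdeg x + wdeg y) (wpar x + wpar y) (wwt x + wwt y)) (wmul x y),
      all (fun z => feq (fbind (wmul x y) (wX z))
        (fbind (wX z x) (fun a => fbind (wX z y) (wmul a)))) Z2s &
      all (fun b => feq (fbind (wmul x y) (wW b))
        (fbind (wW b x) (fun a => fbind (wW (sg (wpar x) b) y) (wmul a)))) Z3s]).

Section Checks.
Variables (comul : word -> fsum (word * word)) (antip : word -> fsum word).
Variable braid : word -> word -> fsum (word * word).

Definition assoc_fsum (s : fsum ((word * word) * word)) : fsum (word * (word * word)) :=
  [seq (p.1, (p.2.1.1, (p.2.1.2, p.2.2))) | p <- s].

Definition wcounit (x : word) : bool := x == e.

Definition hopf_check := [&& comul e == [:: pos (e, e)],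
  all1 (fun x =>
   [&& feq (assoc_fsum (fbind (comul x) (fun p => ftens (comul p.1) [:: pos p.2])))
           (fbind (comul x) (fun p => ftens [:: pos p.1] (comul p.2))),
       feq (fbind (comul x) (fun p => if wcounit p.1 then [:: pos p.2] else [::])) [:: pos x],
       feq (fbind (comul x) (fun p => if wcounit p.2 then [:: pos p.1] else [::])) [:: pos x],
       feq (fbind (comul x) (fun p => fbind (antip p.1) (wmul^~ p.2)))
           (if wcounit x then [:: pos e] else [::]) &
       feq (fbind (comul x) (fun p => fbind (antip p.2) (wmul p.1)))
           (if wcounit x then [:: pos e] else [::])]) &
  all2w (fun x y => feq (fbind (wmul x y) comul)
       (fbind (comul x) (fun p => fbind (comul y) (bmul2 braid p))))].

Definition comul_check := all1 (fun x =>
  [&& all (fun p => [&& wdeg p.2.1 + wdeg p.2.2 == wdeg x,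
          wpar p.2.1 + wpar p.2.2 == wpar x & wwt p.2.1 + wwt p.2.2 == wwt x]) (comul x),
      all (typed (wdeg x) (wpar x) (wwt x)) (antip x),
      all (fun y => feq (fbind (wX y x) comul)
         (fbind (comul x) (fun p => ftens (wX y p.1) (wX y p.2))) &&
         feq (fbind (wX y x) antip) (fbind (antip x) (wX y))) Z2s &
      all (fun b => feq (fbind (wW b x) comul)
         (fbind (comul x) (fun p => ftens (wW b p.1) (wW (sg (wpar p.1) b) p.2))) &&
         feq (fbind (wW b x) antip) (fbind (antip x) (wW b))) Z3s]).

Lemma wdeg_eq0 x : (wdeg x == 0%N) = (x == e).
Proof. by case: x. Qed.

Section Realization.
Variable k : fieldType.

Definition wR : hopf k word :=
  {| hmul := tab (fun p => wmul p.1 p.2);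
     hone := bv k e;
     hcomul := tab comul;
     hcounit := lin (fun x => (wcounit x)%:R : k^o);
     hantip := tab antip |}.

Definition wD : datum k word := Datum wpar wwt (fun y => tab (wX y)) (fun b => tab (wW b)).

Lemma wmulE x y : hmul wR (bv k x ⊗ bv k y) = ev (wmul x y).
Proof. by rewrite tens_bv tab_bv. Qed.

Lemma wmul_evl s y : hmul wR (ev s ⊗ bv k y) = ev (fbind s (wmul^~ y)).
Proof. by rewrite ev_bind ev_linl; apply: eq_bigr => p _; rewrite wmulE. Qed.

Lemma wmul_evr x s : hmul wR (bv k x ⊗ ev s) = ev (fbind s (wmul x)).
Proof. by rewrite ev_bind ev_linr; apply: eq_bigr => p _; rewrite wmulE. Qed.

Lemma wcomulE x : hcomul wR (bv k x) = ev (comul x).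
Proof. exact: tab_bv. Qed.
Lemma wantipE x : hantip wR (bv k x) = ev (antip x).
Proof. exact: tab_bv. Qed.
Lemma wcounitE x : hcounit wR (bv k x) = (wcounit x)%:R.
Proof. exact: lin_bv. Qed.

Lemma sw_ev (I J : finType) (W : lmodType k) (s : fsum (I * J)) (E : vec k I -> vec k J -> W) :
  sw (ev s) E = \sum_(p <- s) (-1) ^+ p.1 *: E (bv k p.2.1) (bv k p.2.2).
Proof.
rewrite /ev (linear_sumE _ _ _ (sw_linear E)); apply: eq_bigr => -[b [i j]] _ /=.
rewrite (linear_scaleE _ _ (sw_linear E)) /sw (bigD1 (i, j)) //= big1 ?addr0.
  by rewrite ffunE eqxx scale1r.
by move=> p /negPf pn; rewrite ffunE eq_sym pn scale0r.
Qed.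

Lemma wmul2E (c : 'End(vec k (word * word))) p q : (forall x y, c (bv k x ⊗ bv k y) = ev (braid x y)) ->
  mul2 wR c (bv k p ⊗ bv k q) = ev (bmul2 braid p q).
Proof.
case: p q => [p1 p2] [q1 q2] cE; rewrite -!tens_bv mul2E cE sw_ev ev_bind /=.
by apply: eq_bigr => r _; rewrite ev_tens !wmulE.
Qed.

Definition algebra_check :=
  [&& mulA_check && unit_check, counitM_check, grading_check, actions_check & mul_check].

Lemma algebra_checked : algebra_check.
Proof. by vm_compute. Qed.

Lemma wR_hopf (c : 'End(vec k (word * word))) : hopf_check -> (forall x y, c (bv k x ⊗ bv k y) = ev (braid x y)) ->
  is_hopf_for c wR.
Proof.
have /and5P[/andP[/all2wP mA /all1P m1] /all2wP eM _ _ _] := algebra_checked.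
move=> /and3P[/eqP D1 /all1P Dx /all2wP DM] cE.
split.
- move=> x y z; move: x; apply: vec_ext; [lin | lin |] => x.
  move: y; apply: vec_ext; [lin | lin |] => y; move: z; apply: vec_ext; [lin | lin |] => z.
  by rewrite !wmulE wmul_evl wmul_evr; apply: feq_ev; exact: (all1P (mA x y) z).
- apply: vec_ext; [lin | lin |] => x; rewrite wmulE.
  by have /andP[/eqP -> _] := m1 x; rewrite ev1.
- apply: vec_ext; [lin | lin |] => x; rewrite wmulE.
  by have /andP[_ /eqP ->] := m1 x; rewrite ev1.
- apply: hom_ext => x; have /and5P[/(feq_ev k) cA _ _ _ _] := Dx x.
  rewrite comp_lfunE comp_lfunE [RHS]comp_lfunE wcomulE.
  rewrite (ev_bindE (F := (\1 ⊠ hcomul wR)%VF) (f := fun p => ftens [:: pos p.1] (comul p.2))); last first.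
    by move=> [a b]; rewrite -tens_bv tensl_tens id_lfunE wcomulE ev_tens ev1.
  rewrite -cA.
  rewrite (ev_bindE (F := (hcomul wR ⊠ \1)%VF) (f := fun p => ftens (comul p.1) [:: pos p.2])); last first.
    by move=> [a b]; rewrite -tens_bv tensl_tens id_lfunE wcomulE ev_tens ev1.
  exact: ev_map.
- apply: vec_ext; [lin | lin |] => x; have /and5P[_ /(feq_ev k) cA _ _ _] := Dx x.
  rewrite wcomulE -[RHS]ev1 -cA; apply: ev_bindE => -[a b].
  rewrite -tens_bv forml_tens wcounitE; case: (wcounit a); rewrite ?ev1 ?scale1r //.
  by rewrite scale0r /ev big_nil.
- apply: vec_ext; [lin | lin |] => x; have /and5P[_ _ /(feq_ev k) cA _ _] := Dx x.
  rewrite wcomulE -[RHS]ev1 -cA; apply: ev_bindE => -[a b].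
  rewrite -tens_bv formr_tens wcounitE; case: (wcounit b); rewrite ?ev1 ?scale1r //.
  by rewrite scale0r /ev big_nil.
- move=> x y; move: x; apply: vec_ext; [lin | lin |] => x.
  move: y; apply: vec_ext; [lin | lin |] => y.
  rewrite wmulE !wcomulE (ev_bindE (f := comul)); last exact: wcomulE.
  rewrite (feq_ev k (DM x y)) ev_bind ev_linl; apply: eq_bigr => p _.
  rewrite ev_bind ev_linr; congr (_ *: _).
  by apply: eq_bigr => q _; rewrite wmul2E.
- by rewrite wcomulE D1 ev1 -tens_bv.
- move=> x y; rewrite -[RHS]/(_ *: (_ : k^o)).
  move: x; apply: vec_ext; [lin | lin |] => x; move: y; apply: vec_ext; [lin | lin |] => y.
  rewrite wmulE !wcounitE ev_lin /wcounit; have /orP[/andP[/eqP -> /eqP ->]|/allP xy] := eM x y.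
    have /andP[/eqP -> _] := m1 e; rewrite big_seq1 wcounitE /wcounit eqxx.
    by rewrite !scale1r.
  rewrite big_seq big1 => [|p /xy/negPf pe]; last by rewrite wcounitE /wcounit pe scaler0.
  have [xe|_] := eqVneq x e; last by rewrite scale0r.
  have [ye|_] := eqVneq y e; last by rewrite scaler0.
  have := m1 e; move: xy; rewrite xe ye => xy /andP[/eqP e1 _].
  by have := xy (pos e); rewrite e1 inE eqxx => /(_ isT).
- by rewrite wcounitE.
- move=> x; have l : is_linear (fun x => (hcounit wR x : k) *: hone wR) by lin.
  move: x; apply: vec_ext => [|//|x]; first by lin.
  have /and5P[_ _ _ /(feq_ev k) cA _] := Dx x.
  rewrite wcomulE wcounitE ev_lin linear_sum.
  transitivity (ev (if wcounit x then [:: pos e] else [::]) : vec k word).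
    rewrite -cA ev_bind; apply: eq_bigr => -[b [x1 x2]] _ /=.
    by rewrite linearZ /= -tens_bv tensl_tens wantipE id_lfunE wmul_evl.
  by case: (wcounit x); rewrite ?ev1 ?scale1r // scale0r /ev big_nil.
- move=> x; have l : is_linear (fun x => (hcounit wR x : k) *: hone wR) by lin.
  move: x; apply: vec_ext => [|//|x]; first by lin.
  have /and5P[_ _ _ _ /(feq_ev k) cA] := Dx x.
  rewrite wcomulE wcounitE ev_lin linear_sum.
  transitivity (ev (if wcounit x then [:: pos e] else [::]) : vec k word).
    rewrite -cA ev_bind; apply: eq_bigr => -[b [x1 x2]] _ /=.
    by rewrite linearZ /= -tens_bv tensl_tens wantipE id_lfunE wmul_evr.
  by case: (wcounit x); rewrite ?ev1 ?scale1r // scale0r /ev big_nil.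
Qed.

Lemma typed_homog s d n w : all (typed d n w) s -> ev s \in dcomp wD n w.
Proof.
move/allP => sn; rewrite /ev big_seq memv_suml // => p ps.
by rewrite memvZ // bv_cspan //; have /and3P[_ -> ->] := sn _ ps.
Qed.

Lemma typed_gr s d n w : all (typed d n w) s -> (ev s : vec k word) \in gr wdeg d.
Proof.
by move=> st; apply: ev_gr; apply: sub_all st => p /and3P[].
Qed.

Lemma wXE y x : dX wD y (bv k x) = ev (wX y x).
Proof. exact: tab_bv. Qed.
Lemma wWE b x : dW wD b (bv k x) = ev (wW b x).
Proof. exact: tab_bv. Qed.
Lemma wX_ev y s : dX wD y (ev s) = ev (fbind s (wX y)).
Proof. exact: tab_ev. Qed.
Lemma wW_ev b s : dW wD b (ev s) = ev (fbind s (wW b)).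
Proof. exact: tab_ev. Qed.

Lemma wX_typed y x : all (typed (wdeg x) (wpar x) (sg y (wwt x))) (wX y x).
Proof.
have /and5P[_ _ /all1P gc _ _] := algebra_checked.
by have /andP[/allP + _] := gc x; apply; exact: mem_Z2s.
Qed.

Lemma wW_typed b x : all (typed (wdeg x) (wpar x) (wwt x + sh (wpar x) b)) (wW b x).
Proof.
have /and5P[_ _ /all1P gc _ _] := algebra_checked.
by have /andP[_ /allP + ] := gc x; apply; exact: mem_Z3s.
Qed.

Lemma wD_laws : datum_laws wD.
Proof.
have /and5P[_ _ _ /all1P ac _] := algebra_checked.
split=> [|y z||b c|y b|y x|b x].
- apply: vec_ext; [lin | lin |] => x; have /and5P[/eqP x0 _ _ _ _] := ac x.
  by rewrite wXE x0 ev1.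
- apply: vec_ext; [lin | lin |] => x; have /and5P[_ _ /allP xD _ _] := ac x.
  rewrite !wXE wX_ev; apply: feq_ev.
  by have /allP := xD y (mem_Z2s _); apply; exact: mem_Z2s.
- apply: vec_ext; [lin | lin |] => x; have /and5P[_ /eqP x0 _ _ _] := ac x.
  by rewrite wWE x0 ev1.
- apply: vec_ext; [lin | lin |] => x; have /and5P[_ _ _ /allP xD _] := ac x.
  rewrite !wWE wW_ev; apply: feq_ev.
  by have /allP := xD b (mem_Z3s _); apply; exact: mem_Z3s.
- apply: vec_ext; [lin | lin |] => x; have /and5P[_ _ _ _ /allP xD] := ac x.
  rewrite wWE wXE wX_ev wW_ev; apply: feq_ev.
  by have /allP := xD y (mem_Z2s _); apply; exact: mem_Z3s.
- by rewrite wXE; apply: typed_homog (wX_typed y x).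
- by rewrite wWE; apply: typed_homog (wW_typed b x).
Qed.

Lemma dtens_XE y p : dX (dtens wD wD) y (bv k p) = ev (ftens (wX y p.1) (wX y p.2)).
Proof. by case: p => p q; rewrite -tens_bv tensl_tens !wXE ev_tens. Qed.
Lemma dtens_WE b p :
  dW (dtens wD wD) b (bv k p) = ev (ftens (wW b p.1) (wW (sg (wpar p.1) b) p.2)).
Proof. by rewrite lin_bv !wWE ev_tens. Qed.

Lemma hmul_ftens s t : hmul wR (ev (ftens s t)) = ev (fbind s (fun a => fbind t (wmul a))).
Proof.
rewrite ev_tens ev_linl ev_bind; apply: eq_bigr => p _.
by rewrite wmul_evr.
Qed.

Lemma wR_datum : hopf_check -> comul_check -> datum_hopf wD wR.
Proof.
have /and5P[/andP[_ /all1P m1] _ _ /all1P ac /all2wP mc] := algebra_checked.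
move=> /and3P[/eqP D1 _ _] /all1P cc.
have Xe y : wX y e = [:: pos e] by case: (Z2P y) => ->; vm_compute.
have We b : wW b e = [:: pos e] by have := mem_Z3s b; rewrite !inE => /or3P[] /eqP ->; vm_compute.
have eps_typed d n w s : all (typed d n w) s -> (0 < d)%N -> hcounit wR (ev s) = 0.
  move=> /allP st d0; rewrite ev_lin big_seq big1 // => p /st /and3P[/eqP pd _ _].
  by rewrite wcounitE /wcounit -wdeg_eq0 pd eqn0Ngt d0 scaler0.
split.
- exact: wD_laws.
- split=> [[x y]|z [x y]|b [x y]]; have /and3P[mt /allP mX /allP mW] := mc x y.
  + by rewrite -tens_bv wmulE; apply: typed_homog mt.
  + rewrite dtens_XE hmul_ftens -tens_bv wmulE wX_ev; apply/esym/feq_ev.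
    exact: mX (mem_Z2s z).
  + rewrite dtens_WE hmul_ftens -tens_bv wmulE wW_ev; apply/esym/feq_ev.
    exact: mW (mem_Z3s b).
- split=> [x|y x|b x]; have /and4P[/allP ct _ /allP cX /allP cW] := cc x.
  + rewrite wcomulE /ev big_seq memv_suml // => p ps; rewrite memvZ // bv_cspan //.
    by have /and3P[_ -> ->] := ct p ps.
  + rewrite wXE (ev_bindE (f := comul)); last exact: wcomulE.
    have /andP[/(feq_ev k) -> _] := cX y (mem_Z2s y).
    by rewrite wcomulE; apply/esym/ev_bindE => p; exact: dtens_XE.
  + rewrite wWE (ev_bindE (f := comul)); last exact: wcomulE.
    have /andP[/(feq_ev k) -> _] := cW b (mem_Z3s b).
    by rewrite wcomulE; apply/esym/ev_bindE => p; exact: dtens_WE.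
- split=> [x|y x|b x]; have /and4P[_ ct /allP cX /allP cW] := cc x.
  + by rewrite wantipE; apply: typed_homog ct.
  + rewrite wXE (ev_bindE (f := antip)); last exact: wantipE.
    by have /andP[_ /(feq_ev k) ->] := cX y (mem_Z2s y); rewrite wantipE wX_ev.
  + rewrite wWE (ev_bindE (f := antip)); last exact: wantipE.
    by have /andP[_ /(feq_ev k) ->] := cW b (mem_Z3s b); rewrite wantipE wW_ev.
- by apply: bv_cspan; vm_compute.
- by move=> y; rewrite wXE Xe ev1.
- by move=> b; rewrite wWE We ev1.
- move=> x; rewrite wcounitE; have [->|/negPf xe] := eqVneq x e; last by rewrite /wcounit xe eqxx.
  by move=> _; split; apply/eqP; vm_compute.
- move=> y x; rewrite wXE; have [->|xe] := eqVneq x e; first by rewrite Xe ev1.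
  by rewrite (eps_typed _ _ _ _ (wX_typed y x)) ?wcounitE /wcounit ?(negPf xe) // lt0n wdeg_eq0.
- move=> b x; rewrite wWE; have [->|xe] := eqVneq x e; first by rewrite We ev1.
  by rewrite (eps_typed _ _ _ _ (wW_typed b x)) ?wcounitE /wcounit ?(negPf xe) // lt0n wdeg_eq0.
Qed.

Lemma wR_homogeneous (I : finType) (B : yd k I word) : comul_check ->
  (forall g x, act B (bv k (g, x)) \in gr wdeg (wdeg x)) ->
  (forall x, coact B (bv k x) \in gr (fun p => wdeg p.2) (wdeg x)) ->
  homogeneous B wR wdeg.
Proof.
have /and5P[_ _ _ _ /all2wP mc] := algebra_checked.
move=> /all1P cc hA hC; split=> // [x y||x|x x0|x].
- by have /and3P[mt _ _] := mc x y; rewrite -tens_bv wmulE; apply: typed_gr mt.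
- exact: bv_cspan.
- have /and4P[ct _ _ _] := cc x; rewrite wcomulE; apply: ev_gr.
  by apply: sub_all ct => p /and3P[].
- by rewrite wcounitE /wcounit -wdeg_eq0 eqn0Ngt x0.
- by have /and4P[_ ct _ _] := cc x; rewrite wantipE; apply: typed_gr ct.
Qed.

(* The basis tensor (det w).2 occurs in the coproduct of w, with the sign
   (det w).1, and in that of no other basis word. *)
Variable det : word -> bool * (word * word).
Definition primitive_check := all2w (fun w x =>
  (wdeg w == 1%N) ||
  [&& if w == e then det w == pos (e, e) else ((det w).2.1 != e) && ((det w).2.2 != e) &
      [seq p <- comul x | p.2 == (det w).2] == if x == w then [:: det w] else [::]]).
Definition generators_primitive_check := all1 (fun x =>
  (wdeg x == 1%N) ==> (comul x == [:: pos (x, e); pos (e, x)])).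

(** The coefficient of a primitive element v at a word w of degree other than 1 is,
    up to sign, the coefficient of its coproduct at (det w).2.  If w is not e, both
    components of this tensor have positive degree, so the coefficient in
    v ⊗ 1 + 1 ⊗ v is 0; for w = e it is twice that of v at e. *)
Lemma wR_primitive : primitive_check -> generators_primitive_check ->
  forall v : vec k word, v \in gr wdeg 1%N <-> primitive wR v.
Proof.
move=> /all2wP pc /all1P gc v; split=> [|pv].
  apply: (cspan_ext (f := hcomul wR) (g := fun v => v ⊗ hone wR + hone wR ⊗ v)); first by lin.
    have l1 : is_linear (fun v : vec k word => v ⊗ hone wR) by lin.
    have l2 : is_linear (fun v : vec k word => hone wR ⊗ v) by lin.
    by move=> c u t; rewrite l1 l2 scalerDr addrACA.
  move=> x x1; have := gc x; rewrite x1 /= => /eqP cx.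
  by rewrite wcomulE cx /ev big_cons big_seq1 !scale1r !tens_bv.
apply/memv_cspan => w; apply: contraNT => /negPf w1.
have coefE (s : fsum (word * word)) q : (ev s : vec k (word * word)) q
    = \sum_(p <- [seq p <- s | p.2 == q]) (-1) ^+ p.1.
  rewrite /ev sum_ffunE big_filter [RHS]big_mkcond; apply: eq_bigr => p _.
  by rewrite !ffunE; case: eqP => _; rewrite ?[_ *: _]mulr1 ?[_ *: _]mulr0.
have cw : hcomul wR v (det w).2 = v w * (-1) ^+ (det w).1.
  rewrite (linear_vecE (f := hcomul wR)) ?sum_ffunE; last by lin.
  rewrite (bigD1 w) //= [X in _ + X]big1 ?addr0 => [|x xw].
    have := pc w w; rewrite w1 eqxx /= => /andP[_ /eqP e1].
    by rewrite ffunE wcomulE coefE e1 big_seq1.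
  have := pc w x; rewrite w1 (negPf xw) /= => /andP[_ /eqP e1].
  by rewrite ffunE wcomulE coefE e1 big_nil scaler0.
move: cw; rewrite pv; have := pc w w; rewrite w1 /= => /andP[+ _].
have [->|_] := eqVneq w e.
  move=> /eqP ->; rewrite !ffunE eqxx !mulr1 mul1r => /eqP.
  by rewrite -subr_eq0 addrK.
case: (det w) => b [d1 d2] /= /andP[/negPf d1e /negPf d2e].
rewrite !ffunE /= ![e == _]eq_sym d1e d2e mulr0 mul0r addr0 => /esym/eqP.
by rewrite mulf_eq0 signr_eq0 orbF.
Qed.

Lemma wR_generated : generated_by wR (gr wdeg 1%N).
Proof.
move=> U U1 /subvP Ug /subvP Um.
have step x y w : wmul x y = [:: pos w] -> bv k x \in U -> bv k y \in U -> bv k w \in U.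
  move=> xy xU yU; rewrite -ev1 -xy -wmulE; apply: Um; apply: memv_img.
  exact: memv_tens.
have Ux x : wdeg x = 1%N -> bv k x \in U by move=> x1; apply/Ug/bv_cspan; rewrite x1.
have U0 := Ux v0 erefl; have U1' := Ux v1 erefl; have U2 := Ux v2 erefl.
have U01 := step v0 v1 v01 erefl U0 U1'; have U10 := step v1 v0 v10 erefl U1' U0.
have U02 := step v0 v2 v02 erefl U0 U2; have U20 := step v2 v0 v20 erefl U2 U0.
have U010 := step v0 v10 v010 erefl U0 U10; have U020 := step v0 v20 v020 erefl U0 U20.
have U102 := step v1 v02 v102 erefl U1' U02; have U0102 := step v0 v102 v0102 erefl U0 U102.
apply/eqP; rewrite eqEsubv subvf -cspanT; apply/span_subvP => x /mapP[w _ ->].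
by case: w.
Qed.

Lemma wR_gr0 : gr wdeg 0%N = <[bv k e]>%VS.
Proof.
apply/eqP; rewrite eqEsubv; apply/andP; split.
  apply/span_subvP => x /mapP[w]; rewrite mem_enum unfold_in wdeg_eq0 => /eqP -> ->.
  exact: memv_line.
by rewrite -memvE; apply: bv_cspan.
Qed.

End Realization.
End Checks.

(** * The generating module *)

Section Generators.
Variable k : fieldType.

Definition gX (y : 'Z_2) (j : 'Z_3) : fsum 'Z_3 := [:: (y != 0, sg y j)].
Definition gW (b j : 'Z_3) : fsum 'Z_3 := [:: pos (j + b)].

Definition gD : datum k 'Z_3 :=
  Datum (fun _ => 1) id (fun y => tab (gX y)) (fun b => tab (gW b)).

Definition giota : 'Hom(vec k 'Z_3, vec k word) := tab (fun j : 'Z_3 => [:: pos (gen j)]).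

Lemma gD_laws : datum_laws gD.
Proof.
have XE y j : dX gD y (bv k j) = ev (gX y j) by exact: tab_bv.
have WE b j : dW gD b (bv k j) = bv k (j + b) by rewrite tab_bv ev1.
have evs b j : ev [:: (b, j)] = (-1) ^+ b *: bv k j :> vec k 'Z_3.
  by rewrite /ev big_seq1.
split=> [|y z||b c|y b|y j|b j].
- by apply: vec_ext; [lin | lin |] => j; rewrite XE evs scale1r.
- apply: vec_ext; [lin | lin |] => j; rewrite !XE !evs linearZ /= XE evs sgA scalerA.
  by congr (_ *: _); case: (Z2P y) => ->; case: (Z2P z) => ->; rewrite -signr_addb; congr (_ ^+ _); vm_compute.
- by apply: vec_ext; [lin | lin |] => j; rewrite WE addr0.
- by apply: vec_ext; [lin | lin |] => j; rewrite !WE -addrA [c + b]addrC.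
- apply: vec_ext; [lin | lin |] => j; rewrite WE !XE !evs linearZ /= WE.
  by rewrite sgD.
- by rewrite XE evs memvZ // bv_cspan //= !eqxx.
- by rewrite WE bv_cspan //= !eqxx.
Qed.

Lemma giota_dmorph : dmorph gD (wD k) giota.
Proof.
have gE j : giota (bv k j) = bv k (gen j) by rewrite tab_bv ev1.
split=> [j|y j|b j]; rewrite ?gE.
- by apply: bv_cspan; have := mem_Z3s j; rewrite !inE => /or3P[] /eqP ->; vm_compute.
- rewrite tab_bv wXE (ev_bindE (F := giota) (f := fun j : 'Z_3 => [:: pos (gen j)])) => [|i]; last by rewrite gE ev1.
  apply: feq_ev; have := mem_Z2s y; have := mem_Z3s j; rewrite !inE.
  by move=> /or3P[] /eqP -> /orP[] /eqP ->; vm_compute.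
- rewrite tab_bv wWE (ev_bindE (F := giota) (f := fun j : 'Z_3 => [:: pos (gen j)])) => [|i]; last by rewrite gE ev1.
  apply: feq_ev; have := mem_Z3s b; have := mem_Z3s j; rewrite !inE.
  by move=> /or3P[] /eqP -> /or3P[] /eqP ->; vm_compute.
Qed.

Lemma giota_coord v (j : 'Z_3) : giota v (gen j) = v j.
Proof.
rewrite (linear_vecE (f := giota)) ?sum_ffunE; last by lin.
rewrite (bigD1 j) //= big1 ?addr0 => [|i ij]; rewrite tab_bv ev1 !ffunE.
  by rewrite eqxx [_ *: _]mulr1.
case: eqP => [gij|_]; last by rewrite [_ *: _]mulr0.
case/eqP: ij; move: gij; have := mem_Z3s i; have := mem_Z3s j; rewrite !inE.
by move=> /or3P[] /eqP -> /or3P[] /eqP ->.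
Qed.

Lemma giota_inj : lker giota = 0%VS.
Proof.
apply/eqP; rewrite -subv0; apply/subvP => v; rewrite memv_ker memv0 => /eqP gv.
by apply/eqP/ffunP => j; rewrite -giota_coord gv !ffunE.
Qed.

Lemma giota_img : limg giota = gr wdeg 1%N.
Proof.
have gE j : giota (bv k j) = bv k (gen j) by rewrite tab_bv ev1.
apply/eqP; rewrite eqEsubv; apply/andP; split.
  rewrite -cspanT; apply: limg_cspan => j _; rewrite gE bv_cspan //.
  by have := mem_Z3s j; rewrite !inE => /or3P[] /eqP ->; vm_compute.
apply/span_subvP => x /mapP[w]; rewrite mem_enum unfold_in.
case: w => // _ ->.
- by rewrite -(gE 0); apply: memv_img; apply: memvf.
- by rewrite -(gE 1); apply: memv_img; apply: memvf.
- by rewrite -(gE (-1)); apply: memv_img; apply: memvf.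
Qed.

End Generators.

(** * The two Nichols algebras *)

Notation comulA := (wcomul comulA_table).
Notation comulD := (wcomul comulD_table).
Notation antipA := (wantip antipA_table).
Notation antipD := (wantip antipD_table).

(** For each word, a tensor that distinguishes its coproduct from those of the
    other basis words.  The last case is meant for e; [primitive_check] leaves out
    degree 1. *)
Definition detA (w : word) : bool * (word * word) :=
  match w with
  | v01 => neg (v2, v2) | v10 => pos (v1, v0) | v02 => neg (v1, v1) | v20 => pos (v2, v0)
  | v010 => pos (v0, v10) | v020 => pos (v0, v20) | v102 => pos (v10, v2)
  | v0102 => pos (v010, v2) | _ => pos (e, e)
  end.

Definition detD (w : word) : bool * (word * word) :=
  match w with
  | v01 => pos (v0, v1) | v10 => neg (v2, v2) | v02 => pos (v0, v2) | v20 => neg (v1, v1)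
  | v010 => pos (v01, v0) | v020 => pos (v02, v0) | v102 => pos (v10, v2)
  | v0102 => pos (v010, v2) | _ => pos (e, e)
  end.

Lemma coalgebraA_checked : [&& hopf_check comulA antipA braidA, comul_check comulA antipA,
  primitive_check comulA detA & generators_primitive_check comulA].
Proof. by vm_compute. Qed.

Lemma coalgebraD_checked : [&& hopf_check comulD antipD braidD, comul_check comulD antipD,
  primitive_check comulD detD & generators_primitive_check comulD].
Proof. by vm_compute. Qed.

Lemma dim_vec (k : fieldType) (I : finType) : \dim (fullv : {vspace vec k I}) = #|I|.
Proof. by rewrite dimvf /dim /= muln1. Qed.

(** What the theorem asserts about H, over an arbitrary field so that the proof
    does not depend on algebraic closedness. *)
Definition nichols_example (k : fieldType) (H : hopf k A18_basis) : Prop :=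
  exists (J : finType) (V : yd k A18_basis J),
    [/\ is_yd H V, (0 < \dim (fullv : {vspace vec k J}))%N &
      exists (K : finType) (B : yd k A18_basis K) (R : hopf k K),
        [/\ is_nichols H V B R,
            is_hopf (bosonization H B R),
            dual_chevalley (bosonization H B R) &
            \dim (fullv : {vspace vec k (K * A18_basis)}) = 216%N]].

Section Assembly.
Variable k : fieldType.

(** What the two cases have in common: [giota] embeds V, spanned by the three
    generators, as the degree 1 part of R. *)
Lemma nichols_of_datum (H : hopf k A18_basis) (V : yd k A18_basis 'Z_3)
    (B : yd k A18_basis word) (R : hopf k word) :
  is_hopf H -> cosemisimple H -> is_yd H V -> is_yd_hopf H B R ->
  hone R = bv k e -> homogeneous B R wdeg ->
  yd_morphism V B (giota k) ->
  (forall v, v \in gr wdeg 1%N <-> primitive R v) -> generated_by R (gr wdeg 1%N) ->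
  nichols_example H.
Proof.
move=> hH ssH yV hB R1 hd iota prim gen.
exists 'Z_3, V; split => //; first by rewrite dim_vec card_ord.
exists word, B, R; split.
- split=> //; exists (gr wdeg); split; first exact: homogeneous_is_grading.
  split=> //; first by rewrite R1 wR_gr0.
  exists (giota k); split=> //; [exact: giota_inj | exact: giota_img].
- exact: bosonization_is_hopf.
- apply: (bosonization_dual_chevalley hd hH hB R1) => // w.
  by move/eqP; rewrite wdeg_eq0 => /eqP.
- have w12 : #|{: word}| = 12%N by rewrite cardT enumT unlock.
  by rewrite dim_vec card_prod w12 /A18_basis /N18 !card_prod !card_ord.
Qed.

End Assembly.

Section GradedActions.
Variables (k : fieldType) (xi : k).

Lemma memv_tens_gr (I J : finType) (d : J -> nat) n i (v : vec k J) :
  v \in gr d n -> bv k (i : I) ⊗ v \in gr (fun p => d p.2) n.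
Proof.
move=> /memv_cspan vn; apply/memv_cspan => -[i' j]; rewrite ffunE mulf_eq0 negb_or.
by case/andP => _; exact: vn.
Qed.

Lemma yd_A_homogeneous comul antip : comul_check comul antip ->
  homogeneous (yd_A xi (wD k)) (wR comul antip k) wdeg.
Proof.
move=> cc; apply: wR_homogeneous => // [[g y] x|x].
  rewrite -tens_bv (actA_E _ _ _ (comp_bv (wD k) x)) memvZ // wXE.
  exact: typed_gr (wX_typed y x).
rewrite (coactA_E _ (comp_bv (wD k) x)) memv_suml // => r _.
by rewrite memvZ // memv_tens_gr // wWE; apply: typed_gr (wW_typed r.2 x).
Qed.

Lemma yd_D_homogeneous comul antip : comul_check comul antip ->
  homogeneous (yd_D xi (wD k)) (wR comul antip k) wdeg.
Proof.
move=> cc; apply: wR_homogeneous => // [[g y] x|x].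
  rewrite -tens_bv (actD_E _ _ _ (comp_bv (wD k) x)) !memvZ // wWE.
  exact: typed_gr (wW_typed g.2 x).
rewrite (coactD_E _ (comp_bv (wD k) x)) memv_suml // => y _.
by rewrite memv_tens_gr // wXE; apply: typed_gr (wX_typed y x).
Qed.

End GradedActions.

(** * Cosemisimplicity of A and of its dual *)

Section Cosemisimple.
Variables (k : fieldType) (xi : k) (xi3 : 3.-primitive_root xi).
Hypothesis char0 : [pchar k] =i pred0.
Let xi_exp : xi ^+ 3 = 1 := prim_expr_order xi3.
Notation A := (A18 xi).
Notation Ad := (hopf_dual (A18 xi)).

Lemma natr_neq0 n : n.+1%:R != 0 :> k.
Proof. by move/pcharf0P: char0 => ->. Qed.

Lemma sumZ2 (V : zmodType) (F : 'Z_2 -> V) : \sum_y F y = F 0 + F 1.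
Proof.
rewrite big_ord_recl big_ord1; congr (F _ + F _); exact: val_inj.
Qed.

Lemma sumZ3 (V : zmodType) (F : 'Z_3 -> V) : \sum_a F a = F 0 + F 1 + F (- 1).
Proof.
rewrite !big_ord_recl big_ord0 addr0 addrA; congr (F _ + F _ + F _); exact: val_inj.
Qed.

Lemma sum_chi c : \sum_a chi xi (a * c) = (c == 0)%:R * 3%:R.
Proof.
have xi1 : xi != 1.
  by apply/eqP => x1; have := prim_order_dvd xi3 1; rewrite x1 expr1n eqxx => /esym.
have s0 : 1 + xi + xi ^+ 2 = 0.
  have : (xi - 1) * (1 + xi + xi ^+ 2) = 0.
    rewrite mulrBl mul1r !mulrDr mulr1 -expr2 -exprS xi_exp.
    by rewrite addrC opprD; ring.
  by move/eqP; rewrite mulf_eq0 subr_eq0 (negPf xi1) => /eqP.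
rewrite sumZ3 mul0r mul1r mulN1r; have := mem_Z3s c; rewrite !inE.
move=> /or3P[] /eqP ->; rewrite /chi.
- by rewrite eqxx mul1r; ring.
- by rewrite mul0r -[RHS]s0; congr (_ + _ + _).
- by rewrite mul0r -[RHS]s0 addrAC; congr (_ + _ + _).
Qed.

(** Fourier inversion on Z/3: f is a combination of its Fourier transforms. *)
Lemma fourier_mem (V : vectType k) (U : {vspace V}) (f : 'Z_3 -> V) :
  (forall p, \sum_a chi xi (a * p) *: f a \in U) -> forall a, f a \in U.
Proof.
move=> fU a.
have -> : f a = 3%:R^-1 *: \sum_p chi xi (- (a * p)) *: \sum_b chi xi (b * p) *: f b.
  under eq_bigr => p _ do rewrite scaler_sumr.
  rewrite exchange_big (bigD1 a) //= [X in _ + X]big1 ?addr0 => [|b ba].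
    under eq_bigr => p _ do rewrite scalerA -(chiD xi_exp) addNr scale1r.
    by rewrite sumr_const card_ord -scaler_nat scalerA mulVf ?natr_neq0 // scale1r.
  under eq_bigr => p _ do rewrite scalerA -(chiD xi_exp) -mulNr -mulrDl mulrC.
  by rewrite -scaler_suml sum_chi addrC subr_eq0 (negPf ba) mul0r scale0r.
by rewrite memvZ // memv_suml // => p _; rewrite memvZ.
Qed.

Lemma memv_half (V : vectType k) (U : {vspace V}) (x y : V) :
  x + y \in U -> x - y \in U -> x \in U /\ y \in U.
Proof.
move=> pU mU; suff xU : x \in U by split=> //; rewrite -(addKr x y) memvD ?memvN.
have -> : x = 2%:R^-1 *: ((x + y) + (x - y)).
  rewrite addrACA subrr addr0 -mulr2n -scaler_nat scalerA.
  by rewrite mulVf ?natr_neq0 // scale1r.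
by rewrite memvZ // memvD.
Qed.

Lemma comatrix_unit (I : finType) (H : hopf k I) (c : vec k I) (phi : 'Hom(vec k I, k^o)) :
  hcomul H c = c ⊗ c -> phi c = 1 -> comatrix H (fun _ _ : unit => c).
Proof.
move=> Dc pc; split; [by exists tt | | by exists (fun _ _ => phi); case; case; case; case; rewrite pc].
by move=> _ _; rewrite (bigD1 tt) //= big1 ?addr0 // => -[].
Qed.

(** The part k^N # 1 is spanned by the characters of N, which are group-like.  On
    k^N # x the coproduct is dual to the multiplication of the group algebra of N
    twisted by the cocycle xi^(j r), which is a 3 x 3 matrix algebra; Fourier
    transform in the first component of N gives matrix coefficients c i l. *)
Lemma A_cosemisimple : cosemisimple A.
Proof.
move=> U cU.
have U0 a b : bv k ((a, b) : N18, 0 : 'Z_2) \in U.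
  move: a; apply: fourier_mem => p; move: b.
  apply: (fourier_mem (f := fun b => \sum_a chi xi (a * p) *: bv k ((a, b) : N18, 0 : 'Z_2))) => q.
  pose c : vec k A18_basis := \sum_(g : N18) chi xi (g.1 * p + g.2 * q) *: bv k (g, 0).
  have -> : \sum_b chi xi (b * q) *: \sum_a chi xi (a * p) *: bv k ((a, b) : N18, 0 : 'Z_2) = c.
    under eq_bigr do rewrite scaler_sumr.
    rewrite exchange_big pair_bigA; apply: eq_bigr => -[a b] _ /=.
    by rewrite scalerA -(chiD xi_exp) addrC.
  apply: (cU _ _ (comatrix_unit (phi := coordf k (nzero, 0)) _ _) tt tt).
    have Dg g : hcomul A (bv k (g, 0 : 'Z_2)) = \sum_s 1 *: (bv k (s, 0) ⊗ bv k (nadd g (nopp s), 0)).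
      by rewrite A_comulE.
    rewrite /c linear_sum tens_suml /=.
    under eq_bigr => g _ do rewrite linearZ /= Dg scaler_sumr.
    rewrite exchange_big; apply: eq_bigr => s _ /=; rewrite tens_sumr.
    rewrite (reindex_inj (h := nadd s)) /=; last by move=> v w; rewrite !naddE => /addrI.
    apply: eq_bigr => t _; rewrite scale1r tensZl tensZr scalerA -(chiD xi_exp).
    have -> : nadd (nadd s t) (nopp s) = t by rewrite !naddE noppE addrAC subrr add0r.
    by congr (chi _ _ *: _); ring.
  rewrite /c linear_sum (bigD1 nzero) //= big1 ?addr0 => [|g /negPf g0]; rewrite linearZ /= coordfE ffunE.
    by rewrite eqxx !mul0r addr0 [_ *: _]mulr1.
  by rewrite xpair_eqE g0 [_ *: _]mulr0.
have U1 a b : bv k ((a, b) : N18, 1 : 'Z_2) \in U.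
  move: a; apply: fourier_mem => j.
  pose c (i l : 'Z_3) : vec k A18_basis :=
    \sum_a chi xi (a * i) *: bv k ((a, l - i) : N18, 1 : 'Z_2).
  have -> : \sum_a chi xi (a * j) *: bv k ((a, b) : N18, 1 : 'Z_2) = c j (j + b).
    by apply: eq_bigr => a _; rewrite addrAC subrr add0r.
  apply: cU; split; first by exists 0.
    move=> i l; rewrite /c linear_sum /=.
    under eq_bigr => a _ do rewrite linearZ /= (A_comulE xi_exp) scaler_sumr.
    rewrite exchange_big /=.
    rewrite -(pair_bigA _ (fun s1 s2 => \sum_a chi xi (a * i) *: (chi xi (sh 1 (s2 * (a - s1)))
      *: (bv k ((s1, s2) : N18, 1 : 'Z_2) ⊗ bv k (nadd (a, l - i) (nopp (s1, s2)), 1 : 'Z_2))))) /=.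
    rewrite exchange_big (reindex_inj (addIr (- i))) /=; apply: eq_bigr => m _.
    rewrite tens_suml; apply: eq_bigr => s _; rewrite tens_sumr (reindex_inj (addrI s)) /=.
    apply: eq_bigr => t _; rewrite tensZl tensZr !scalerA -!(chiD xi_exp) sh1.
    congr (chi _ _ *: (_ ⊗ bv _ ((_, _), _))); rewrite ?naddE ?noppE /nadd /nopp /=; ring.
  exists (fun i l => lin (fun p : A18_basis =>
    (if (p.2 == 1) && (p.1.2 == l - i) then 3%:R^-1 * chi xi (- (p.1.1 * i)) else 0) : k^o)).
  move=> i l i' l'; rewrite /c linear_sum /=.
  under eq_bigr => a _ do rewrite linearZ /= lin_bv /=.
  have [ee|ne] := eqVneq (l' - i') (l - i); last first.
    rewrite big1 => [|a _]; last by rewrite [_ *: _]mulr0.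
    by case: eqP => //= ei; case: eqP => // el; rewrite ei el eqxx in ne.
  transitivity (\sum_a 3%:R^-1 * chi xi (a * (i' - i))).
    by apply: eq_bigr => a _; rewrite mulrBr (chiD xi_exp); exact: mulrCA.
  rewrite -mulr_sumr sum_chi subr_eq0 mulrCA mulVf ?natr_neq0 // mulr1 eq_sym.
  case: eqP ee => //= <- /addIr <-; by rewrite eqxx.
apply/eqP; rewrite eqEsubv subvf -cspanT; apply/span_subvP => x /mapP[[[a b] y] _ ->].
by case: (Z2P y) => ->.
Qed.

(** The coproduct is dual to the multiplication of the smash product of k^N with
    the group of order 2.  An orbit of two points gives a 2 x 2 matrix coalgebra,
    and for a fixed point (a, 0) the two characters of the group give group-like
    elements. *)
Lemma D_cosemisimple : cosemisimple Ad.
Proof.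
move=> U cU.
have Uj a b y : b != 0 -> bv k ((a, b) : N18, y : 'Z_2) \in U.
  move=> b0; pose c (u v : 'Z_2) : vec k A18_basis := bv k ((a, sg u b) : N18, v - u).
  have -> : bv k ((a, b) : N18, y) = c 0 y by rewrite /c subr0.
  apply: cU; split; first by exists 0.
    move=> u v; rewrite /c D_comul // (reindex_inj (addIr (- u))) /=.
    apply: eq_bigr => m _; rewrite nactE /= -sgA.
    by congr (_ ⊗ bv _ ((_, sg _ _), _)); rewrite ?subrK // opprB addrA subrK.
  exists (fun u v => coordf k ((a, sg u b) : N18, v - u)) => u v u' v'.
  rewrite coordfE ffunE !xpair_eqE eqxx /=; congr (_%:R); congr nat_of_bool.
  have [<-|uu] := eqVneq u u'; first by rewrite eqxx (inj_eq (addIr _)) eq_sym.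
  apply/negbTE; apply: contraNN b0 => /andP[/eqP + _].
  case: (Z2P u) (Z2P u') uu => -> [] -> //= _; rewrite sg0 sg1 => bb.
    by move: (Z3D b); rewrite bb => e2; apply/eqP/(addrI b); rewrite addr0.
  by move: (Z3D b); rewrite -bb => e2; apply/eqP/(addrI b); rewrite addr0.
have Ue a y : bv k ((a, 0) : N18, y : 'Z_2) \in U.
  pose z u : vec k A18_basis := bv k ((a, 0) : N18, u : 'Z_2).
  have Dz u : hcomul Ad (z u) = z 0 ⊗ z u + z 1 ⊗ z (u + 1).
    rewrite /z D_comul // sumZ2 !nactE /= sg00 subr0.
    by congr (_ + _ ⊗ bv _ (_, _)); rewrite Z2N.
  have cz (b : bool) : z 0 + (-1) ^+ b *: z 1 \in U.
    apply: (cU _ _ (comatrix_unit (phi := coordf k ((a, 0) : N18, 0 : 'Z_2)) _ _) tt tt).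
      rewrite linearD linearZ /= !Dz add0r Z2D11 tensDl !tensDr !(tensZl, tensZr) scalerA.
      rewrite -signr_addb addbb scale1r scalerDr addrACA; congr (_ + _); exact: addrC.
    rewrite coordfE !ffunE !xpair_eqE !eqxx /=.
    by rewrite [_ *: _]mulr0 addr0.
  have [z0U z1U] : z 0 \in U /\ z 1 \in U.
    by apply: memv_half; [have := cz false; rewrite scale1r | have := cz true; rewrite scaleN1r].
  by case: (Z2P y) => ->; [exact: z0U | exact: z1U].
apply/eqP; rewrite eqEsubv subvf -cspanT; apply/span_subvP => x /mapP[[[a b] y] _ ->].
by have [->|b0] := eqVneq b 0; [exact: Ue | exact: Uj].
Qed.

End Cosemisimple.

Section Examples.
Variables (k : fieldType) (char0 : [pchar k] =i pred0).
Variables (xi : k) (xi_prim : 3.-primitive_root xi).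
Let xi3 : xi ^+ 3 = 1 := prim_expr_order xi_prim.

Lemma nichols_example_A : nichols_example (A18 xi).
Proof.
have /and4P[hc cc pc gc] := coalgebraA_checked.
have br x y : yd_braiding (yd_A xi (wD k)) (yd_A xi (wD k)) (bv k x ⊗ bv k y) = ev (braidA x y).
  by rewrite yd_A_braiding wXE wWE -ev_tens.
have hR := yd_A_hopf xi3 (wR_datum k hc cc) (wR_hopf hc br).
exact: (nichols_of_datum (A18_is_hopf xi3) (A_cosemisimple xi_prim char0)
  (yd_A_is_yd xi3 (gD_laws k)) hR erefl (yd_A_homogeneous xi cc)
  (yd_A_morphism xi (giota_dmorph k)) (wR_primitive antipA pc gc) (@wR_generated comulA antipA k)).
Qed.

Lemma nichols_example_D : nichols_example (hopf_dual (A18 xi)).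
Proof.
have /and4P[hc cc pc gc] := coalgebraD_checked.
have br x y : yd_braiding (yd_D xi (wD k)) (yd_D xi (wD k)) (bv k x ⊗ bv k y) = ev (braidD x y).
  by rewrite yd_D_braiding wXE wWE -ev_tens.
have hR := yd_D_hopf xi3 (wR_datum k hc cc) (wR_hopf hc br).
exact: (nichols_of_datum (dual_is_hopf (A18_is_hopf xi3)) (@D_cosemisimple k xi char0)
  (yd_D_is_yd xi3 (gD_laws k)) hR erefl (yd_D_homogeneous xi cc)
  (yd_D_morphism xi (giota_dmorph k)) (wR_primitive antipD pc gc) (@wR_generated comulD antipD k)).
Qed.

End Examples.

Theorem theorem3p2 (k : closedFieldType) (char0 : [pchar k] =i pred0)
    (xi : k) (xi_prim : 3.-primitive_root xi)
    (H : hopf k A18_basis) (H_eq : H = A18 xi \/ H = hopf_dual (A18 xi)) :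
  exists (J : finType) (V : yd k A18_basis J),
    [/\ is_yd H V, (0 < \dim (fullv : {vspace vec k J}))%N &
      exists (K : finType) (B : yd k A18_basis K) (R : hopf k K),
        [/\ is_nichols H V B R,
            is_hopf (bosonization H B R),
            dual_chevalley (bosonization H B R) &
            \dim (fullv : {vspace vec k (K * A18_basis)}) = 216%N]].
Proof.
case: H_eq => ->; first exact: nichols_example_A.
exact: nichols_example_D.
Qed.
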